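(* Let $q$ be even with $q>k+1$, and let $C$ be a linear $(q+1,k+1,q)$-MDS code over $GF(q)$, where either (a) $k=3$ or $k=4$; or (b) $k\ge 5$ and $q\ge (k-2)^3$. Then $C$ is maximal, i.e. $C$ admits no extension (linear or non-linear).
   Context: An $(n,k,q)$-MDS code over an alphabet $\mathcal A$ of size $q$ is a set of $q^k$ $n$-tuples (words) over $\mathcal A$ such that no two distinct words agree in $k$ or more coordinate positions. It is linear if $\mathcal A=GF(q)$ and the code is a $k$-dimensional subspace of $GF(q)^n$. An $(m,k,q)$-MDS code $C'$ with $m>n$ (over the same alphabet) is an extension of the $(n,k,q)$-MDS code $C$ if deleting some fixed set of $m-n$ coordinate positions from every word of $C'$ yields $C$. An MDS code is maximal if it admits no extensions. *)

(* Defs.v *)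
From mathcomp Require Import all_boot all_order all_algebra.

Set Implicit Arguments.
Unset Strict Implicit.
Unset Printing Implicit Defensive.

(* A word of length n over an alphabet A is a row vector 'rV[A]_n, so that     *)
(* codes over a field F live in the vector space F^n.                          *)
Definition agree (A : finType) (n : nat) (x y : 'rV[A]_n) : {set 'I_n} :=
  [set i | x ord0 i == y ord0 i].

Definition MDS_code (n k q : nat) (A : finType) (C : {set 'rV[A]_n}) : Prop :=
  [/\ #|A| = q, #|C| = (q ^ k)%N
    & {in C &, forall x y, x != y -> (#|agree x y| < k)%N}].

Definition linear_MDS_code (n k q : nat) (F : finFieldType)
    (C : {set 'rV[F]_n}) : Prop :=
  MDS_code k q C /\
  exists V : {vspace 'rV[F]_n}, \dim V = k /\ C = [set x | x \in V].

(* enum_val lists the kept positions ~: D in increasing order.                 *)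
Definition delete (A : finType) (m n : nat) (D : {set 'I_m})
    (e : #|~: D| = n) (w : 'rV[A]_m) : 'rV[A]_n :=
  colsub (fun i : 'I_n => enum_val (cast_ord (esym e) i)) w.

Definition extension (k q : nat) (A : finType) (n m : nat)
    (C : {set 'rV[A]_n}) (C' : {set 'rV[A]_m}) : Prop :=
  [/\ (n < m)%N, MDS_code k q C'
    & exists (D : {set 'I_m}) (e : #|~: D| = n), C = [set delete e w | w in C']].

Definition maximal_MDS_code (n k q : nat) (A : finType)
    (C : {set 'rV[A]_n}) : Prop :=
  MDS_code k q C /\
  forall (m : nat) (C' : {set 'rV[A]_m}), ~ extension k q C C'.

(* Main.v *)
Require Import Defs.
From mathcomp Require Import all_boot all_order all_algebra all_field ring zify.

Set Implicit Arguments.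
Unset Strict Implicit.
Unset Printing Implicit Defensive.

Import GRing.Theory.
Local Open Scope ring_scope.

(** Put d = k + 1 and t = k - 2, so that d = t + 3. Here q is a power of 2, q >= 8 and
    t^3 <= q.

    From codes to arcs. An extension supplies, at a deleted position, a symbol f(c) for
    every word c of C, and words with equal symbols agree in fewer than d - 1 positions.
    Identify C with F^d by d of its coordinates. In a plane spanned by two coordinate
    directions, the level set of f is the graph of a function; equal symbols
    exclude the slope 0 and one slope for each of the q + 1 - d other positions, so that
    at most t + 1 slopes occur. A function with so few slopes is affine
    (few_slopes_affine), hence the level set is a hyperplane (level_linear): the
    extension yields q + 2 vectors of F^(t+3), any t + 3 of them independent.
    Such an arc does not exist (no_long_arc), for the following reasons.

    Projections. Projecting the arc from t of its points gives a planar arc r of q + 2 - t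
    points. Projecting it from all but one of these t points, say a, gives an arc in
    space, of q + 3 - t points, that lies over r. The planar tool is tangents_extend, a
    form of the lemma of tangents in characteristic 2: a point that lies on tangents at
    more than t points of r extends r.

    Arcs in space. If an arc of q + 3 - t points in space cannot be extended, then the
    special lines at its points, found by extending its projections, group into the two
    rulings of a hyperbolic quadric (three_lines, all_ruled, hyperbolic_chart), and t = 2
    (deficiency_2). Extending an arc as far as possible cannot reach t = 0, because an
    arc of q + 3 points would carry systems of triples that force 3 to divide q
    (no_full_arc). Hence every such arc is part of an arc
    (x f(x), x, f(x), 1), (1, 0, 0, 0) on a quadric (space_chart). As Casse and Glynn
    observed, f and its inversions at every point are o-polynomials; their exponents are
    even, so f is a monomial, and then an additive one: f(x) = k x^m + f(0) with m a power
    of 2 (curve_power).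

    Axes. So each of the t points a gives a description of the hyperoval that completes r
    as the set of points (x, x^m, 1) with (1, 0, 0) and (0, 1, 0), in which the line of
    the last two points is the axis of a group of translations; these two points are among
    the t points of the hyperoval that are not on r. Different a give different axes,
    since otherwise the arc would have too many points in a hyperplane. On the
    other hand two axes always have a common end, which m = 2 or m = q / 2 singles out
    (axis_A1, axis_A2, no_axis_off). Then all the t axes have a common end, and there are
    only t - 1 points left for the other ends (no_common_charts). *)

(** * Interpolation in characteristic two *)

Section Lagrange.
Variable F : fieldType.

(** f is its own interpolation polynomial at the nodes a i, because size f <= #|Y|; the
    left-hand side is the top coefficient of the latter. *)
Lemma lagrange_coef (I : finType) (Y : {set I}) (a : I -> F) (f : {poly F}) :
  {in Y &, injective a} -> (size f <= #|Y|)%N ->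
  \sum_(i in Y) f.[a i] / \prod_(j in Y :\ i) (a i - a j) = f`_(#|Y|.-1).
Proof.
move=> inj_a szf.
have nz i : i \in Y -> \prod_(j in Y :\ i) (a i - a j) != 0.
  move=> iY; apply/prodf_neq0 => j; rewrite in_setD1 => /andP[ji jY].
  by rewrite subr_eq0; apply: contra ji => /eqP/inj_a->.
pose g i := \prod_(j in Y :\ i) ('X - (a j)%:P).
have mon_g i : g i \is monic by apply: monic_prod => j _; apply: monicXsubC.
have szg i : i \in Y -> size (g i) = #|Y|.
  by move=> iY; rewrite /g -big_enum size_prod_XsubC -cardE (cardsD1 i Y) iY.
pose p := \sum_(i in Y) (f.[a i] / \prod_(j in Y :\ i) (a i - a j)) *: g i.
have fp : f = p.
  apply/eqP; rewrite -subr_eq0; apply/eqP.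
  pose rs := [seq a i | i <- enum Y].
  have szrs : size rs = #|Y| by rewrite size_map cardE.
  apply: (@roots_geq_poly_eq0 _ _ rs).
  - apply/allP => y /mapP[i]; rewrite mem_enum => iY ->{y}.
    rewrite /root hornerD hornerN subr_eq0 /p horner_sum (bigD1 i) //=.
    rewrite [X in _ + X]big1 ?addr0; last first.
      move=> j /andP[jY ji]; rewrite hornerZ horner_prod [X in _ * X](bigD1 i) /=.
        by rewrite hornerXsubC subrr mul0r mulr0.
      by rewrite in_setD1 eq_sym ji.
    rewrite hornerZ horner_prod.
    under [X in _ * X]eq_bigr do rewrite hornerXsubC.
    by rewrite divfK ?nz.
  - rewrite map_inj_in_uniq ?enum_uniq // => i j.
    by rewrite !mem_enum; apply: inj_a.
  - rewrite szrs; apply: (leq_trans (size_polyD _ _)).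
    rewrite geq_max szf size_polyN /p.
    apply: (leq_trans (size_sum _ _ _)); apply/bigmax_leqP => i iY.
    by rewrite (leq_trans (size_scale_leq _ _)) ?szg.
rewrite {2}fp coef_sum; apply: eq_bigr => i iY.
rewrite coefZ -{1}(szg i iY) -lead_coefE (monicP (mon_g i)) mulr1.
by [].
Qed.
End Lagrange.

Section Char2.
Variable F : finFieldType.
Hypothesis ch2 : 2%N \in [pchar F].

Lemma addF (x : F) : x + x = 0.
Proof. by rewrite addrr_pchar2. Qed.
Lemma oppF (x : F) : - x = x.
Proof. by rewrite oppr_pchar2. Qed.

(** Inversion permutes the factors, so the product w satisfies w = 1 / w, and in
    characteristic 2 this has the only solution 1. *)
Lemma prod_nz1 : \prod_(x : F | x != 0) x = 1.
Proof.
set w := \prod_(x | _) x.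
have wnz : w != 0 by apply/prodf_neq0.
have ww : w = w^-1.
  rewrite /w -prodfV (reindex_inj (inv_inj (@invrK F))) /=.
  by apply: eq_bigl => x; rewrite invr_eq0.
have w2 : w * w = 1 by rewrite {2}ww mulfV.
have : (w - 1) * (w - 1) = 0.
  have -> : (w - 1) * (w - 1) = (w * w + 1) - (w + w) by ring.
  by rewrite w2 !addF subr0.
by move/eqP; rewrite mulf_eq0 orbb subr_eq0 => /eqP.
Qed.

(** The product of all the differences x - y with y <> x is 1 by prod_nz1. *)
Lemma prod_others (A : {set F}) (x : F) : x \in A ->
  (\prod_(y in A :\ x) (x - y))^-1 = \prod_(y in ~: A) (x - y).
Proof.
move=> xA.
have E : \prod_(y in ~: A) (x - y) * \prod_(y in A :\ x) (x - y) = 1.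
  rewrite -[RHS]prod_nz1 [RHS](reindex_inj (subrI x)) /=.
  rewrite [RHS](bigID (mem (~: A))) /=; congr (_ * _); apply: eq_bigl => y.
    rewrite subr_eq0 in_setC andbC; case: eqP => [<-|]; last by rewrite andbT.
    by rewrite xA.
  by rewrite subr_eq0 in_setD1 in_setC negbK eq_sym.
have nz : \prod_(y in A :\ x) (x - y) != 0.
  by apply: contraNneq (oner_neq0 F) => N; rewrite -E N mulr0.
by apply: (mulIf nz); rewrite mulVf.
Qed.

(** The elements of S are points of a pencil, with affine parameters a y after scaling by
    c y. By prod_others the product over S :\ y is the inverse of the value at a y of the
    polynomial whose roots are the parameters missing from S. This makes the sum a
    Lagrange sum over Y, equal to a coefficient of that polynomial, whose degree is
    #|F| - #|S|. The exponent e is the one for which the powers of c y cancel, since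
    x^(q-1) = 1. *)
Lemma pencil_sum (I : finType) (S Y : {set I}) (c a : I -> F) (e : nat) :
  Y \subset S -> {in S &, injective a} -> {in S, forall y, c y != 0} ->
  (#|F| < #|S| + #|Y|)%N -> (#|S| + #|Y| + e = #|F| + 3)%N ->
  \sum_(y in Y) (c y ^+ e * (\prod_(x in S :\ y) (c y * c x * (a y - a x))
                  * \prod_(x in Y :\ y) (c y * c x * (a y - a x))))^-1
  = (\prod_(x in S) c x * \prod_(x in Y) c x)^-1
    * (#|F| + 1 == #|S| + #|Y|)%N%:R.
Proof.
move=> YS inj_a cnz ltS eS.
pose A := a @: S.
have cA : #|A| = #|S| by rewrite card_in_imset.
have SF : (#|S| <= #|F|)%N by rewrite -cA max_card.
pose f : {poly F} := \prod_(y in ~: A) ('X - y%:P).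
have szf : size f = (#|F| - #|S|).+1.
  by rewrite /f -big_enum size_prod_XsubC -cardE cardsCs setCK cA.
have Y0 : (0 < #|Y|)%N by lia.
have := @lagrange_coef F I Y a f _ _.
have -> : f`_#|Y|.-1 = (#|F| + 1 == #|S| + #|Y|)%N%:R.
  have fm : f \is monic by apply: monic_prod => y _; apply: monicXsubC.
  case: eqP => E.
    have ->: #|Y|.-1 = (size f).-1.
      by rewrite szf; lia.
    by rewrite -lead_coefE (monicP fm).
  rewrite nth_default // szf.
  by lia.
move=> <-.
- rewrite big_distrr /=; apply: eq_bigr => y yY.
  have yS : y \in S by apply: (subsetP YS).
  have split (T : {set I}) : y \in T -> T \subset S ->
    \prod_(x in T :\ y) (c y * c x * (a y - a x)) =
    (c y ^+ #|T|.-1 / c y) * \prod_(x in T) c x * \prod_(x in T :\ y) (a y - a x).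
    move=> yT TS; rewrite !big_split /= prodr_const.
    rewrite [in RHS](big_setD1 y) //= [#|T|](cardsD1 y) yT /=.
    by field; rewrite cnz.
  have fy : f.[a y] = (\prod_(x in S :\ y) (a y - a x))^-1.
    rewrite horner_prod; under eq_bigr do rewrite hornerXsubC.
    rewrite -prod_others ?imset_f //; congr (_^-1).
    have -> : A :\ a y = a @: (S :\ y).
      apply/setP => u; rewrite !inE; apply/andP/imsetP => [[un /imsetP[x xS ue]]|[x]].
        exists x => //; rewrite !inE xS andbT.
        by apply: contra un => /eqP <-; rewrite ue.
      rewrite !inE => /andP[xy xS] ->; split; last exact: imset_f.
      by apply: contra xy => /eqP/inj_a->.
    rewrite big_imset //= => u v; rewrite !inE => /andP[_ uS] /andP[_ vS].
    exact: inj_a.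
  rewrite fy (split S) // (split Y) //.
  have cy : c y != 0 by apply: cnz.
  have cq : c y ^+ #|F|.-1 = 1.
    by apply: (mulfI cy); rewrite -exprS prednK ?(ltnW (finNzRing_gt1 F)) // expf_card mulr1.
  have ce : c y ^+ e * (c y ^+ #|S|.-1 / c y) * (c y ^+ #|Y|.-1 / c y) = 1.
    have S0 : (0 < #|S|)%N by apply/card_gt0P; exists y.
    have F1 := finNzRing_gt1 F.
    have -> : c y ^+ e * (c y ^+ #|S|.-1 / c y) * (c y ^+ #|Y|.-1 / c y)
       = c y ^+ (e + #|S|.-1 + #|Y|.-1) / (c y * c y).
      by rewrite !exprD; field.
    have -> : (e + #|S|.-1 + #|Y|.-1 = #|F|.-1 + 2)%N by lia.
    by rewrite exprD cq mul1r expr2 mulfV // mulf_neq0.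
  move: ce; set x1 := c y ^+ #|S|.-1 / _; set x2 := c y ^+ #|Y|.-1 / _ => ce.
  set pS := \prod_(x in S) _; set pY := \prod_(x in Y) _.
  set aS := \prod_(x in S :\ y) _; set aY := \prod_(x in Y :\ y) _.
  have -> : c y ^+ e * (x1 * pS * aS * (x2 * pY * aY))
     = (c y ^+ e * x1 * x2) * ((pS * pY) * (aS * aY)) by ring.
  by rewrite ce mul1r !invfM.
- by move=> u v uY vY; apply: inj_a; apply: (subsetP YS).
- by rewrite szf; lia.
Qed.

(** The terms (i, j) and (j, i) cancel in characteristic 2. *)
Lemma sum_sym0 (I : finType) (T : {set I}) (s : I -> I -> F) :
  {in T &, forall i j, s i j = s j i} ->
  \sum_(i in T) \sum_(j in T :\ i) s i j = 0.
Proof.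
move=> sC.
pose lt (i j : I) := (enum_rank i < enum_rank j)%N.
have -> : \sum_(i in T) \sum_(j in T :\ i) s i j =
    \sum_(i in T) \sum_(j in T | lt i j) s i j
    + \sum_(i in T) \sum_(j in T | lt j i) s i j.
  rewrite -big_split; apply: eq_bigr => i iT /=.
  rewrite (bigID (lt i)) /=; congr (_ + _); apply: eq_bigl => j.
    rewrite !inE /lt; case: (j =P i) => [->|_] //=.
    by rewrite ltnn andbF.
  rewrite !inE /lt -leqNgt leq_eqVlt andbC andbA.
  have -> : (enum_rank j == enum_rank i :> nat) = (j == i).
    by rewrite val_eqE (inj_eq enum_rank_inj).
  by case: (j =P i) => [->|_] /=; rewrite ?ltnn ?andbF ?andbT // andbC.
rewrite [X in _ + X](exchange_big_dep (mem T)) //=; last by move=> ? ? _ /andP[].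
rewrite [X in _ + X](_ : _ = \sum_(i in T) \sum_(j in T | lt i j) s i j) ?addF //.
apply: eq_bigr => i iT; apply: eq_big => [j|j /andP[jT _]]; last exact: sC.
by rewrite iT.
Qed.

(** * Planar arcs *)

(** Written out, so that the identities below are polynomial identities in the
    coordinates. *)
Definition det3 (u v w : 'rV[F]_3) : F :=
  let x (a : 'rV[F]_3) := a ord0 (@Ordinal 3 0 isT) in
  let y (a : 'rV[F]_3) := a ord0 (@Ordinal 3 1 isT) in
  let z (a : 'rV[F]_3) := a ord0 (@Ordinal 3 2 isT) in
  x u * (y v * z w - z v * y w) - y u * (x v * z w - z v * x w)
  + z u * (x v * y w - y v * x w).

Lemma det3C12 u v w : det3 u v w = det3 v u w.
Proof. by rewrite -[RHS]oppF /det3 /=; ring. Qed.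
Lemma det3C23 u v w : det3 u v w = det3 u w v.
Proof. by rewrite -[RHS]oppF /det3 /=; ring. Qed.
Lemma det3rot u v w : det3 u v w = det3 v w u.
Proof. by rewrite det3C12 det3C23. Qed.
Lemma det3aab u v : det3 u u v = 0.
Proof. by rewrite /det3 /=; ring. Qed.
Lemma det3aba u v : det3 u v u = 0.
Proof. by rewrite /det3 /=; ring. Qed.
Lemma det3abb u v : det3 u v v = 0.
Proof. by rewrite /det3 /=; ring. Qed.
Lemma det3D1 u u' v w : det3 (u + u') v w = det3 u v w + det3 u' v w.
Proof. by rewrite /det3 !mxE /=; ring. Qed.
Lemma det3D2 u v v' w : det3 u (v + v') w = det3 u v w + det3 u v' w.
Proof. by rewrite /det3 !mxE /=; ring. Qed.
Lemma det3D3 u v w w' : det3 u v (w + w') = det3 u v w + det3 u v w'.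
Proof. by rewrite /det3 !mxE /=; ring. Qed.
Lemma det3Z1 a u v w : det3 (a *: u) v w = a * det3 u v w.
Proof. by rewrite /det3 !mxE /=; ring. Qed.
Lemma det3Z2 a u v w : det3 u (a *: v) w = a * det3 u v w.
Proof. by rewrite /det3 !mxE /=; ring. Qed.
Lemma det3Z3 a u v w : det3 u v (a *: w) = a * det3 u v w.
Proof. by rewrite /det3 !mxE /=; ring. Qed.
Lemma det30 u w : det3 u 0 w = 0.
Proof. by rewrite /det3 !mxE /=; ring. Qed.
Lemma plucker3 p u v x y :
  det3 p u v * det3 p x y - det3 p u x * det3 p v y + det3 p u y * det3 p v x = 0.
Proof. by rewrite /det3 /=; ring. Qed.

(** a is an affine parameter for the lines through p, with the line p z at infinity. *)
Lemma pencil3 p z y0 : det3 p y0 z != 0 ->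
  exists a : 'rV[F]_3 -> F, forall y x, det3 p y z != 0 -> det3 p x z != 0 ->
  det3 p y z * det3 p x z * (a y - a x) = det3 p y x.
Proof.
move=> nz; exists (fun y => det3 p y y0 / (det3 p y z * det3 p y0 z)) => y x yn xn.
have := plucker3 p y x y0 z.
set D := det3 p y x => E.
have {}E : D * det3 p y0 z = det3 p y y0 * det3 p x z - det3 p y z * det3 p x y0.
  by apply/eqP; rewrite -subr_eq0; apply/eqP; rewrite -[RHS]E; ring.
apply: (mulIf nz); rewrite E; field.
by rewrite yn xn nz.
Qed.

Section PlaneArc.
Variables (I : finType) (r : I -> 'rV[F]_3).

Definition arc3 := forall i j k, i != j -> i != k -> j != k ->
  det3 (r i) (r j) (r k) != 0.
Definition tangent_at i (y : 'rV[F]_3) := forall j, j != i -> det3 (r i) y (r j) != 0.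
Definition extends y := forall i, tangent_at i y.

Variable t : nat.
Hypotheses (arc_r : arc3) (cardI : (#|I| + t = #|F| + 2)%N).

(** Suppose that N is on the secant of p and q. Interpolating at t + 1 of the tangent
    points, on the pencil of p with p q at infinity, gives a nonzero sum (R1). Each of its
    terms, say at y, is a multiple of a sum over the other points, by interpolation on the pencil of y
    with y N at infinity (R2). The terms of the resulting double sum are symmetric, so it
    is 0 in characteristic 2: a contradiction. *)
Lemma tangents_extend (N : 'rV[F]_3) (T : {set I}) :
  (t < #|T|)%N -> {in T, forall i, tangent_at i N} -> extends N.
Proof.
move=> ltT tanT p q qp; apply/eqP => pNq.
wlog cT : T tanT {ltT} / #|T| = t.+1.
  move=> WL; have [T' sT' cT'] : exists2 T' : {set I}, T' \subset T & #|T'| = t.+1.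
    exists [set x in take t.+1 (enum T)].
      by apply/subsetP => x; rewrite inE => /mem_take; rewrite mem_enum.
    rewrite cardsE; have /card_uniqP -> : uniq (take t.+1 (enum T)).
      by rewrite take_uniq ?enum_uniq.
    rewrite size_take -cardE; case: ifP => // /negbT; rewrite -leqNgt => h; move: h ltT; clear; lia.
  by apply: (WL T') => // x /(subsetP sT'); apply: tanT.
have pT : p \notin T by apply/negP => /tanT/(_ q qp); rewrite pNq eqxx.
have qT : q \notin T.
  apply/negP => /tanT/(_ p); rewrite eq_sym => /(_ qp).
  by rewrite det3rot det3C12 pNq eqxx.
have Tp x : x \in T -> x != p by apply: contraTneq => ->.
have Tq x : x \in T -> x != q by apply: contraTneq => ->.
have T0 : (0 < #|T|)%N by rewrite cT.
have [x0 x0T] := card_gt0P T0.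
have pqx0 : det3 (r p) (r q) (r x0) != 0.
  by apply: arc_r; rewrite eq_sym ?qp ?Tp ?Tq.
have [rho rhoE] : exists rho, forall x, det3 (r p) (r x) N = rho * det3 (r p) (r x) (r q).
  exists (det3 (r p) N (r x0) / det3 (r p) (r q) (r x0)) => x.
  apply: (mulIf pqx0); rewrite mulrAC divfK //.
  have := plucker3 (r p) (r q) (r x0) N (r x).
  have -> : det3 (r p) (r q) N = 0 by rewrite det3C23.
  rewrite mul0r subr0 => /eqP; rewrite addr_eq0 oppF => /eqP E.
  by rewrite det3C23 mulrC E mulrC (det3C23 _ (r x0)) (det3C23 _ (r q)).
pose br i j k := det3 (r i) (r j) (r k).
have brn i j k : i != j -> i != k -> j != k -> br i j k != 0 by apply: arc_r.
pose w i j := \prod_(x in [set~ i] :\ j) br i j x.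
have wC i j : w i j = w j i.
  apply: eq_big => [x|x _]; last by rewrite /br det3C12.
  by rewrite !inE andbC.
pose W (i j : I) := \prod_(x in T :\ i :\ j) br i j x.
have WC i j : W i j = W j i.
  apply: eq_big => [x|x _]; last by rewrite /br det3C12.
  by rewrite !inE andbA (andbC (x != j)) -andbA.
(* here the interpolated polynomial has degree t and the sum is its leading coefficient *)
have R1 : \sum_(y in T) (br p y q * w p y * (\prod_(x in T :\ y) br p y x))^-1 != 0.
  have nzq : det3 (r p) (r x0) (r q) != 0 by rewrite det3C23.
  have [a aE] := pencil3 nzq.
  pose S := [set~ p] :\ q.
  have cS : #|S| = (#|I| - 2)%N.
    have := cardsC1 p; rewrite (cardsD1 q) !inE qp => E.
    by rewrite /S; move: E; clear; lia.
  have I2 : (1 < #|I|)%N by rewrite (cardD1 p) (cardD1 q) !inE qp.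
  have SE x : x \in S -> br p x q != 0.
    by rewrite !inE => /andP[xq xp]; apply: brn; rewrite // eq_sym.
  have TS : T \subset S by apply/subsetP => x xT; rewrite !inE Tp ?Tq.
  have big (T' : {set I}) y : y \in T' -> T' \subset S ->
    \prod_(x in T' :\ y) (br p y q * br p x q * (a (r y) - a (r x)))
      = \prod_(x in T' :\ y) br p y x.
    move=> yT TS'; apply: eq_bigr => x; rewrite in_setD1 => /andP[_ xT].
    by apply: aE; apply: SE; apply: (subsetP TS').
  have := @pencil_sum I S T (fun y => br p y q) (fun y => a (r y)) 2 TS.
  rewrite (eq_bigr (fun y => (br p y q * w p y * (\prod_(x in T :\ y) br p y x))^-1)).
    move=> -> //.
    - have -> : (#|F| + 1 == #|S| + #|T|)%N by apply/eqP; rewrite cS cT; move: cardI I2; clear; lia.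
      rewrite mulr1 invr_neq0 // mulf_neq0 //; apply/prodf_neq0 => x xT; apply: SE => //.
      by apply: (subsetP TS).
    - move=> x y xS yS axy; apply: contraTeq (isT) => xy.
      have := brn p x y; rewrite -[br p x y]aE ?SE // axy subrr mulr0 eqxx.
      move: xS yS; rewrite !inE => /andP[_ xp] /andP[_ yp].
      by rewrite (eq_sym p) xp (eq_sym p) yp xy => /(_ isT isT isT).
    - by rewrite cS cT; move: cardI I2; clear; lia.
    - by rewrite cS cT; move: cardI I2; clear; lia.
  move=> y yT; have yS := subsetP TS _ yT.
  rewrite !big //; congr (_^-1); rewrite mulrA; congr (_ * _).
  rewrite expr2 -mulrA; congr (_ * _); rewrite [w p y](bigD1 q) //=.
    congr (_ * _); apply: eq_bigl => x; rewrite !inE.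
    by case: (x == p) (x == q) (x == y) => [] [] [].
  by rewrite !inE qp eq_sym Tq.
(* the nodes are p and the other points of T; here the coefficient is 0, and the term of p is
   the left-hand side *)
have R2 y : y \in T ->
  (br p y q * w p y * (\prod_(x in T :\ y) br p y x))^-1 =
  rho * \sum_(x in T :\ y)
     (det3 (r y) (r x) N * w y x * br y x p * W y x)^-1.
  move=> yT.
  have yp : y != p by apply: Tp.
  have cn x : x != y -> det3 (r y) (r x) N != 0.
    by move=> xy; rewrite det3C23; apply: tanT.
  have py : p != y by rewrite eq_sym.
  have [a aE] := pencil3 (cn p py).
  pose S := [set~ y]; pose Y := p |: (T :\ y).
  have SE x : x \in S -> x != y by rewrite !inE.
  have YS : Y \subset S.
    by apply/subsetP => x; rewrite !inE => /orP[/eqP->|/andP[]].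
  have pTy : p \notin T :\ y by rewrite !inE (negbTE pT) andbF.
  have cS : #|S| = (#|I| - 1)%N by rewrite cardsC1 subn1.
  have cY : #|Y| = t.+1.
    by rewrite cardsU1 pTy /=; have := cardsD1 y T; rewrite yT cT.
  have big (T' : {set I}) x : x \in T' -> T' \subset S ->
    \prod_(x' in T' :\ x) (det3 (r y) (r x) N * det3 (r y) (r x') N * (a (r x) - a (r x')))
      = \prod_(x' in T' :\ x) br y x x'.
    move=> xT TS'; apply: eq_bigr => x'; rewrite in_setD1 => /andP[_ xT'].
    by apply: aE; apply: cn; apply: SE; apply: (subsetP TS').
  have I2 : (1 < #|I|)%N by rewrite (cardD1 p) (cardD1 y) !inE yp.
  have inj_a : {in S &, injective (fun x => a (r x))}.
    move=> x x' xS x'S axx'; apply: contraTeq (isT) => xx'.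
    have := brn y x x'; rewrite -[br y x x']aE ?cn ?SE // axx' subrr mulr0 eqxx.
    by rewrite (eq_sym y) SE // (eq_sym y) SE // xx' => /(_ isT isT isT).
  have ltS : (#|F| < #|S| + #|Y|)%N by rewrite cS cY; move: cardI I2; clear; lia.
  have eS : (#|S| + #|Y| + 1 = #|F| + 3)%N by rewrite cS cY; move: cardI I2; clear; lia.
  have := @pencil_sum I S Y (fun x => det3 (r y) (r x) N) (fun x => a (r x)) 1 YS.
  have -> : (#|F| + 1 == #|S| + #|Y|)%N = false.
    by apply/eqP; rewrite cS cY; move: cardI I2; clear; lia.
  rewrite mulr0 => E; have {E} := E inj_a (fun x xS => cn x (SE x xS)) ltS eS.
  rewrite (eq_bigr (fun x => (det3 (r y) (r x) N * (w y x * \prod_(x' in Y :\ x) br y x x'))^-1)); last first.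
    by move=> x xY; rewrite !big ?expr1 //; apply: (subsetP YS).
  rewrite big_setU1 //=.
  have -> : Y :\ p = T :\ y.
    by apply/setP => x; rewrite !inE; case: (x =P p) => [->|_] //=; rewrite (negbTE pT) andbF.
  rewrite [X in _ + X](eq_bigr (fun x => (det3 (r y) (r x) N * w y x * br y x p * W y x)^-1)); last first.
    move=> x xT; congr (_^-1); rewrite -!mulrA; congr (_ * (_ * _)).
    have xp : x != p by apply: Tp; move: xT; rewrite !inE => /andP[].
    have -> : Y :\ x = p |: (T :\ y :\ x).
      by apply/setP => x'; rewrite !inE; case: (x' =P p) => [->|_] //=; rewrite eq_sym xp.
    by rewrite big_setU1 //= !inE (negbTE pT) !andbF.
  move/eqP; rewrite addr_eq0 oppF => /eqP <-.
  have cE : det3 (r y) (r p) N = rho * br p y q.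
    by rewrite det3C12 rhoE.
  have rho0 : rho != 0.
    by have := cn p py; rewrite cE; apply: contraNneq => ->; rewrite mul0r.
  rewrite cE [w y p]wC.
  rewrite -!mulrA [in RHS]invfM mulVKf ?mulrA //.
  by congr ((_ * _)^-1); apply: eq_bigr => x _; rewrite /br det3C12.
move/eqP: R1; apply.
rewrite (eq_bigr _ R2) -big_distrr /=.
rewrite (@sum_sym0 _ T (fun y x => (det3 (r y) (r x) N * w y x * br y x p * W y x)^-1)) ?mulr0 //.
move=> x y _ _; congr (_^-1).
by rewrite (wC x) (WC x) /br (det3C12 (r x) (r y) N) (det3C12 (r x) (r y) (r p)).
Qed.
End PlaneArc.
End Char2.

(** * Points that extend a planar arc *)

Section PlaneExtensions.
Variable F : finFieldType.
Hypothesis ch2 : 2%N \in [pchar F].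
Implicit Types (t : nat) (I : finType) (u v w N : 'rV[F]_3).

Lemma det3_prop u v : u != 0 -> (forall x, det3 u v x = 0) -> exists a, v = a *: u.
Proof.
move=> u0 H.
have Hk (i j : 'I_3) : u ord0 i * v ord0 j = u ord0 j * v ord0 i.
  have e0 := H (delta_mx ord0 (@Ordinal 3 0 isT)).
  have e1 := H (delta_mx ord0 (@Ordinal 3 1 isT)).
  have e2 := H (delta_mx ord0 (@Ordinal 3 2 isT)).
  move: e0 e1 e2; rewrite /det3 !mxE /= !(mulr0, mulr1, subr0, sub0r, addr0, add0r).
  set u0_ := u _ (@Ordinal 3 0 isT); set u1 := u _ (@Ordinal 3 1 isT); set u2 := u _ (@Ordinal 3 2 isT).
  set v0 := v _ (@Ordinal 3 0 isT); set v1 := v _ (@Ordinal 3 1 isT); set v2 := v _ (@Ordinal 3 2 isT).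
  move=> e0 e1 e2.
  have E01 : u0_ * v1 = u1 * v0 by apply/eqP; rewrite -subr_eq0; apply/eqP; rewrite -[RHS]e2; ring.
  have E02 : u0_ * v2 = u2 * v0 by apply/eqP; rewrite -subr_eq0; apply/eqP; rewrite -[RHS]oppr0 -e1; ring.
  have E12 : u1 * v2 = u2 * v1 by apply/eqP; rewrite -subr_eq0; apply/eqP; rewrite -[RHS]e0; ring.
  by case: i => [[|[|[|]]] Hi] //; case: j => [[|[|[|]]] Hj] //;
    rewrite (bool_irrelevance Hi isT) (bool_irrelevance Hj isT) // ?E01 ?E02 ?E12.
have [i ui] : exists i, u ord0 i != 0.
  apply/existsP; apply: contraNT u0; rewrite negb_exists => /forallP Z.
  by apply/eqP/rowP => j; rewrite mxE; apply/eqP; move: (Z j); rewrite negbK.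
exists (v ord0 i / u ord0 i); apply/rowP => j; rewrite mxE.
by rewrite mulrAC mulrC [_ * u _ _]mulrC Hk; field.
Qed.

Lemma card_complF (A : {set F}) : #|~: A| = (#|F| - #|A|)%N.
Proof. by rewrite cardsCs setCK. Qed.

Section Basic.
Variables (I : finType) (r : I -> 'rV[F]_3) (t : nat).
Hypotheses (arc_r : arc3 r) (cardI : (#|I| + t = #|F| + 2)%N).

(** Of the q + 1 lines through r i0, the #|I| - 1 secants leave t tangents, labelled by B
    through a parameter a of the pencil. *)
Lemma tangent_code i0 j0 : i0 != j0 -> (2 < #|I|)%N ->
  exists (a : 'rV[F]_3 -> F) (B : {set F}), #|B| = t /\
   (forall N, tangent_at r i0 N -> a N \in B) /\
   (forall N N', tangent_at r i0 N -> tangent_at r i0 N' ->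
     a N = a N' -> det3 (r i0) N N' = 0).
Proof.
move=> ij I3.
have ji : j0 != i0 by rewrite eq_sym.
have : (0 < #|~: [set i0; j0]|)%N by rewrite cardsCs setCK cards2 ij; move: I3; clear; lia.
case/card_gt0P=> k; rewrite !inE negb_or => /andP[ki kj].
have nzk : det3 (r i0) (r k) (r j0) != 0 by apply: arc_r; rewrite // eq_sym.
have [a aE] := pencil3 nzk.
have nj x : x != i0 -> x != j0 -> det3 (r i0) (r x) (r j0) != 0.
  by move=> xi xj; apply: arc_r; rewrite // eq_sym.
pose S := ~: [set i0; j0].
have SP x : x \in S = (x != i0) && (x != j0) by rewrite !inE negb_or.
have cS : #|S| = (#|I| - 2)%N by rewrite cardsCs setCK cards2 ij.
have inja : {in S &, injective (fun x => a (r x))}.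
  move=> x y; rewrite !SP => /andP[xi xj] /andP[yi yj] axy; apply: contraTeq (isT) => xy.
  have /negP[] : det3 (r i0) (r x) (r y) != 0 by apply: arc_r; rewrite // eq_sym.
  by rewrite -aE ?nj // axy subrr mulr0.
exists a, (~: [set a (r x) | x in S]); split; [|split].
- rewrite card_complF card_in_imset // cS; move: cardI I3; clear; lia.
- move=> N tN; rewrite inE; apply/imsetP => -[x]; rewrite SP => /andP[xi xj] E.
  have /negP[] := tN x xi; rewrite -aE ?nj ?E ?subrr ?mulr0 //.
  exact: tN.
- by move=> N N' tN tN' E; rewrite -aE ?tN ?tN' // E subrr mulr0.
Qed.

(** Count the pairs (p, l) such that y + l r_i is on a tangent at p. For p = i all the q
    values of l count, for every other p exactly t. If no y + l r_i extends the arc, then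
    by tangents_extend every l has at most t such p, which is not enough for
    t (t - 1) < q. *)
Lemma tangent_meets_extension i y : (t * t.-1 < #|F|)%N -> (2 < #|I|)%N ->
  tangent_at r i y -> exists l, extends r (y + l *: r i).
Proof.
move=> tq I3 tan_y.
pose N l := y + l *: r i.
pose tb p l := [forall j, (j != p) ==> (det3 (r p) (N l) (r j) != 0)].
have tbP p l : reflect (tangent_at r p (N l)) (tb p l).
  by apply: (iffP forallP) => H j; [move=> jp; move: (H j); rewrite jp | apply/implyP/H].
case: (boolP [exists l, (t < #|[set p | tb p l]|)%N]) => [/existsP[l Hl]|].
  exists l; apply: (tangents_extend ch2 arc_r cardI Hl) => p.
  by rewrite inE => /tbP.
rewrite negb_exists => /forallP none; exfalso.
have le_l l : (#|[set p | tb p l]| <= t)%N by rewrite leqNgt.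
have dblE : (\sum_(l : F) #|[set p | tb p l]| = \sum_p #|[set l | tb p l]|)%N.
  transitivity (\sum_(l : F) \sum_(p in [set p | tb p l]) 1)%N.
    by apply: eq_bigr => l _; rewrite sum1_card.
  rewrite (exchange_big_dep xpredT) //=; apply: eq_bigr => p _.
  by rewrite -sum1_card; apply: eq_bigl => l; rewrite !inE.
have up : (\sum_(l : F) #|[set p | tb p l]| <= #|F| * t)%N.
  by rewrite -sum_nat_const; apply: leq_sum => l _.
have ci : #|[set l | tb i l]| = #|F|.
  have -> : [set l | tb i l] = setT; last by rewrite cardsT.
  apply/setP => l; rewrite !inE; apply/tbP => j ji.
  by rewrite det3D2 det3Z2 det3aab mulr0 addr0; apply: tan_y.
have cp p : p != i -> #|[set l | tb p l]| = t.
  move=> pi; have ip : i != p by rewrite eq_sym.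
  have piy : det3 (r p) y (r i) != 0.
    by rewrite (det3rot ch2) (det3C12 ch2) tan_y.
  pose S := ~: [set p; i].
  have SP x : x \in S = (x != p) && (x != i) by rewrite !inE negb_or.
  have cS : #|S| = (#|I| - 2)%N by rewrite cardsCs setCK cards2 pi.
  pose f j := det3 (r p) y (r j) / det3 (r p) (r i) (r j).
  have fnz j : j \in S -> det3 (r p) (r i) (r j) != 0.
    by rewrite SP => /andP[jp ji]; apply: arc_r; rewrite // eq_sym.
  have fE j l : j \in S -> (det3 (r p) (N l) (r j) == 0) = (l == f j).
    move=> jS; rewrite det3D2 det3Z2 addr_eq0 (oppF ch2) eq_sym.
    by rewrite -(inj_eq (mulIf (invr_neq0 (fnz j jS)))) mulfK ?fnz.
  have finj : {in S &, injective f}.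
    move=> j j' jS j'S E; apply: contraTeq (isT) => jj'.
    have e1 : det3 (r p) (N (f j)) (r j) = 0 by apply/eqP; rewrite fE.
    have e2 : det3 (r p) (N (f j)) (r j') = 0 by apply/eqP; rewrite fE ?E.
    have := plucker3 (r p) (N (f j)) (r j) (r j') (r i).
    rewrite e1 e2 !mul0r subr0 add0r => /eqP; rewrite mulf_eq0 => /orP[].
      by rewrite det3D2 det3Z2 det3abb mulr0 addr0 (negbTE piy).
    move=> e0; have /negP[] // : det3 (r p) (r j) (r j') != 0.
    move: jS j'S; rewrite !SP => /andP[jp ji] /andP[jp' ji'].
    by apply: arc_r; rewrite // eq_sym.
  have -> : [set l | tb p l] = ~: [set f j | j in S].
    apply/setP => l; rewrite !inE; apply/tbP/negP => [tN /imsetP[j jS lf]|nf j jp].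
      have jp : j != p by move: jS; rewrite SP => /andP[].
      by have /negP[] := tN j jp; rewrite fE // lf.
    case: (j =P i) => [->|/eqP ji].
      by rewrite det3D2 det3Z2 det3abb mulr0 addr0.
    apply/negP; rewrite fE ?SP ?jp // => /eqP lf; apply: nf.
    by apply/imsetP; exists j; rewrite ?SP ?jp.
  rewrite card_complF card_in_imset // cS; move: cardI I3; clear; lia.
move: up; rewrite dblE (bigD1 i) //= ci (eq_bigr (fun _ => t)) //.
rewrite sum_nat_const cardC1 => up.
have : (#|F| + #|I|.-1 * t <= #|F| * t)%N by [].
move: tq cardI I3; clear; case: t => [|u]; first by rewrite !muln0 addn0; lia.
rewrite /= !mulnS; nia.
Qed.
End Basic.

Definition add_point (I : finType) (V : Type) (r : I -> V) (N : V) (o : option I) : V :=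
  if o is Some i then r i else N.

Lemma arc3_add I (r : I -> 'rV[F]_3) N : arc3 r -> extends r N -> arc3 (add_point r N).
Proof.
move=> arc_r eN [i|] [j|] [k|] //=; rewrite ?(inj_eq (@Some_inj _)).
- exact: arc_r.
- by move=> ij _ _; rewrite (det3C23 ch2); apply: eN; rewrite eq_sym.
- by move=> _ ik _; apply: eN; rewrite eq_sym.
- by move=> _ _ jk; rewrite (det3C12 ch2); apply: eN; rewrite eq_sym.
Qed.

Section Ext.
Variables (I : finType) (r : I -> 'rV[F]_3) (t : nat).
Hypotheses (arc_r : arc3 r) (cardI : (#|I| + t = #|F| + 2)%N) (tI : (t < #|I|)%N) (I3 : (2 < #|I|)%N).

Lemma has_other (i : I) : exists j, i != j.
Proof.
have : (0 < #|[set~ i]|)%N by rewrite cardsC1; move: I3; clear; lia.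
by case/card_gt0P => j; rewrite !inE eq_sym; exists j.
Qed.

Lemma extends_nz N : extends r N -> N != 0.
Proof.
have /card_gt0P[i _] : (0 < #|I|)%N by move: I3; clear; lia.
have [j ij] := has_other i; rewrite eq_sym in ij.
move=> eN; apply/eqP => N0; have := eN i j ij.
by rewrite N0 det30 eqxx.
Qed.

Lemma extends_deficiency N : extends r N -> (0 < t)%N.
Proof.
have /card_gt0P[i _] : (0 < #|I|)%N by move: I3; clear; lia.
have [j ij] := has_other i => eN.
have [a [B [cB [aB _]]]] := tangent_code arc_r cardI ij I3.
by rewrite -cB; apply/card_gt0P; exists (a N); apply: aB.
Qed.

(** Adding N to the arc lowers the deficiency to t - 1. If N' is another point, then it is
    on a tangent of the new arc at every point r j with j <> i, so that it extends the new
    arc by tangents_extend; but it is on the secant of r i and N. *)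
Lemma extends_secant i N N' : extends r N -> extends r N' ->
  det3 (r i) N N' = 0 -> exists a, N' = a *: N.
Proof.
move=> eN eN' iNN'.
have t0 := extends_deficiency eN.
case: (boolP [forall x, det3 N N' x == 0]) => [/forallP H|].
  by apply: det3_prop; [apply: extends_nz | move=> x; apply/eqP].
rewrite negb_forall => /existsP[x NN'x]; exfalso.
have jNN' j : j != i -> det3 (r j) N' N != 0.
  move=> ji; apply/eqP => jNN'.
  have := plucker3 N N' (r i) (r j) x.
  have -> : det3 N N' (r i) = 0 by rewrite -(det3rot ch2).
  have -> : det3 N N' (r j) = 0 by rewrite -(det3rot ch2) (det3C23 ch2).
  rewrite !mul0r subr0 add0r => /eqP; rewrite mulf_eq0 (negbTE NN'x) /=.
  by rewrite (det3C12 ch2); apply/negP; apply: eN.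
have arc' := arc3_add arc_r eN.
have card' : (#|{: option I}| + t.-1 = #|F| + 2)%N.
  by rewrite card_option -cardI; move: t0; clear; lia.
pose T : {set option I} := [set Some j | j in [set~ i]].
have cT : #|T| = #|I|.-1 by rewrite card_imset ?cardsC1 //; apply: Some_inj.
have ltT : (t.-1 < #|T|)%N by rewrite cT; move: t0 tI; clear; lia.
have E : extends (add_point r N) N'.
  apply: (tangents_extend ch2 arc' card' ltT).
  move=> o /imsetP[j]; rewrite !inE => ji -> [k|] /= kj.
    by apply: eN'; apply: contra kj => /eqP->.
  exact: jNN'.
have /negP[] := E (Some i) None isT.
by rewrite /= (det3C23 ch2) iNN'.
Qed.

(** Distinct extending points are on distinct tangents at any point of the arc, by
    extends_secant; so their tangents label them, with t labels. *)
Lemma extends_code : exists (a : 'rV[F]_3 -> F) (B : {set F}), #|B| = t /\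
   (forall N, extends r N -> a N \in B) /\
   (forall N N', extends r N -> extends r N' -> a N = a N' -> exists c, N' = c *: N).
Proof.
have /card_gt0P[i _] : (0 < #|I|)%N by move: I3; clear; lia.
have [j ij] := has_other i.
have [a [B [cB [aB aE]]]] := tangent_code arc_r cardI ij I3.
exists a, B; split=> //; split=> [N eN|N N' eN eN' E]; first exact: aB.
by apply: (extends_secant eN eN' (i := i)); apply: aE.
Qed.

End Ext.

End PlaneExtensions.

(** * Arcs in space and their special lines *)

Section SpaceArcs.
Variable F : finFieldType.
Hypothesis ch2 : 2%N \in [pchar F].

Definition det4 (u v w x : 'rV[F]_4) : F :=
  let c i (a : 'rV[F]_4) := a ord0 i in
  let c0 := c (@Ordinal 4 0 isT) in let c1 := c (@Ordinal 4 1 isT) in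
  let c2 := c (@Ordinal 4 2 isT) in let c3 := c (@Ordinal 4 3 isT) in
  let m (f g h : 'rV[F]_4 -> F) :=
    f v * (g w * h x - h w * g x) - g v * (f w * h x - h w * f x)
    + h v * (f w * g x - g w * f x) in
  c0 u * m c1 c2 c3 - c1 u * m c0 c2 c3 + c2 u * m c0 c1 c3 - c3 u * m c0 c1 c2.

Ltac d4 := rewrite /det4 ?mxE /=; ring.
Lemma det4C12 u v w x : det4 u v w x = det4 v u w x.
Proof. by rewrite -[RHS](oppF ch2); d4. Qed.
Lemma det4C23 u v w x : det4 u v w x = det4 u w v x.
Proof. by rewrite -[RHS](oppF ch2); d4. Qed.
Lemma det4C34 u v w x : det4 u v w x = det4 u v x w.
Proof. by rewrite -[RHS](oppF ch2); d4. Qed.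
Lemma det4D1 u u' v w x : det4 (u + u') v w x = det4 u v w x + det4 u' v w x.
Proof. d4. Qed.
Lemma det4D2 u v v' w x : det4 u (v + v') w x = det4 u v w x + det4 u v' w x.
Proof. d4. Qed.
Lemma det4D3 u v w w' x : det4 u v (w + w') x = det4 u v w x + det4 u v w' x.
Proof. d4. Qed.
Lemma det4D4 u v w x x' : det4 u v w (x + x') = det4 u v w x + det4 u v w x'.
Proof. d4. Qed.
Lemma det4Z1 a u v w x : det4 (a *: u) v w x = a * det4 u v w x.
Proof. d4. Qed.
Lemma det4Z2 a u v w x : det4 u (a *: v) w x = a * det4 u v w x.
Proof. d4. Qed.
Lemma det4Z3 a u v w x : det4 u v (a *: w) x = a * det4 u v w x.
Proof. d4. Qed.
Lemma det4Z4 a u v w x : det4 u v w (a *: x) = a * det4 u v w x.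
Proof. d4. Qed.
Lemma det4_12 u w x : det4 u u w x = 0. Proof. d4. Qed.
Lemma det4_13 u v x : det4 u v u x = 0. Proof. d4. Qed.
Lemma det4_14 u v w : det4 u v w u = 0. Proof. d4. Qed.
Lemma det4_23 u v x : det4 u v v x = 0. Proof. d4. Qed.
Lemma det4_24 u v w : det4 u v w v = 0. Proof. d4. Qed.
Lemma det4_34 u v w : det4 u v w w = 0. Proof. d4. Qed.

Definition det4E := (det4D1, det4D2, det4D3, det4D4, det4Z1, det4Z2, det4Z3, det4Z4,
  det4_12, det4_13, det4_14, det4_23, det4_24, det4_34).

Lemma ord4P (P : 'I_4 -> Prop) : P (@Ordinal 4 0 isT) -> P (@Ordinal 4 1 isT) ->
  P (@Ordinal 4 2 isT) -> P (@Ordinal 4 3 isT) -> forall i, P i.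
Proof. by move=> P0 P1 P2 P3 [[|[|[|[|]]]] Hi] //; rewrite (bool_irrelevance Hi isT). Qed.

Lemma cramer4 u v w x z : det4 u v w x *: z =
  det4 z v w x *: u + det4 u z w x *: v + det4 u v z x *: w + det4 u v w z *: x.
Proof. by apply/rowP; apply: ord4P; rewrite !mxE; d4. Qed.

(** The projection from p, along a coordinate in which p does not vanish, and a section
    of it. *)
Lemma proj4 (p : 'rV[F]_4) : p != 0 ->
  exists (pr : 'rV[F]_4 -> 'rV[F]_3) (sec : 'rV[F]_3 -> 'rV[F]_4) (c : F),
  [/\ c != 0, forall u v w, det3 (pr u) (pr v) (pr w) = c * det4 p u v w,
   forall u l v, pr (u + l *: v) = pr u + l *: pr v,
   forall N, pr (sec N) = N & forall u, pr u = 0 -> exists b, u = b *: p].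
Proof.
move=> p0; have [i pi] : exists i, p ord0 i != 0.
  apply/existsP; apply: contraNT p0; rewrite negb_exists => /forallP Z.
  by apply/eqP/rowP => j; rewrite mxE; apply/eqP; move: (Z j); rewrite negbK.
exists (fun u => \row_j (u ord0 (lift i j) * p ord0 i - u ord0 i * p ord0 (lift i j))).
exists (fun N => \row_k if unlift i k is Some j then N ord0 j / p ord0 i else 0).
exists ((-1) ^+ i * p ord0 i ^+ 2); split.
- by rewrite mulf_neq0 ?expf_neq0 // oppr_eq0 oner_eq0.
- move=> u v w; move: pi; elim/ord4P: i => pi; rewrite /det3 !mxE /=.
  + have -> : lift (@Ordinal 4 0 isT) (@Ordinal 3 0 isT) = @Ordinal 4 1 isT by apply: val_inj.
    have -> : lift (@Ordinal 4 0 isT) (@Ordinal 3 1 isT) = @Ordinal 4 2 isT by apply: val_inj.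
    have -> : lift (@Ordinal 4 0 isT) (@Ordinal 3 2 isT) = @Ordinal 4 3 isT by apply: val_inj.
    d4.
  + have -> : lift (@Ordinal 4 1 isT) (@Ordinal 3 0 isT) = @Ordinal 4 0 isT by apply: val_inj.
    have -> : lift (@Ordinal 4 1 isT) (@Ordinal 3 1 isT) = @Ordinal 4 2 isT by apply: val_inj.
    have -> : lift (@Ordinal 4 1 isT) (@Ordinal 3 2 isT) = @Ordinal 4 3 isT by apply: val_inj.
    d4.
  + have -> : lift (@Ordinal 4 2 isT) (@Ordinal 3 0 isT) = @Ordinal 4 0 isT by apply: val_inj.
    have -> : lift (@Ordinal 4 2 isT) (@Ordinal 3 1 isT) = @Ordinal 4 1 isT by apply: val_inj.
    have -> : lift (@Ordinal 4 2 isT) (@Ordinal 3 2 isT) = @Ordinal 4 3 isT by apply: val_inj.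
    d4.
  + have -> : lift (@Ordinal 4 3 isT) (@Ordinal 3 0 isT) = @Ordinal 4 0 isT by apply: val_inj.
    have -> : lift (@Ordinal 4 3 isT) (@Ordinal 3 1 isT) = @Ordinal 4 1 isT by apply: val_inj.
    have -> : lift (@Ordinal 4 3 isT) (@Ordinal 3 2 isT) = @Ordinal 4 2 isT by apply: val_inj.
    d4.
- by move=> u l v; apply/rowP => j; rewrite !mxE; ring.
- by move=> N; apply/rowP => j; rewrite !mxE liftK unlift_none mul0r subr0 divfK.
- move=> u u0; exists (u ord0 i / p ord0 i); apply/rowP => k; rewrite mxE.
  case: (unliftP i k) => [j ->|->]; last by rewrite divfK.
  move/rowP/(_ j): u0; rewrite !mxE => /eqP; rewrite subr_eq0 => /eqP E.
  by apply: (mulIf pi); rewrite E mulrAC divfK.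
Qed.

Lemma pick_out (I : finType) (s : seq I) : (size s < #|I|)%N -> exists x, x \notin s.
Proof.
move=> sI; apply/existsP; apply: contraLR sI; rewrite negb_exists -leqNgt => /forallP H.
apply: leq_trans (card_size s); apply: subset_leq_card; apply/subsetP => x _.
by have := H x; rewrite negbK.
Qed.

Lemma pigeonhole (S T : finType) (X : {set S}) (B : {set T}) (f : S -> T) m :
  {in X, forall x, f x \in B} -> (#|B| * m < #|X|)%N ->
  exists2 b, b \in B & (m < #|[set x in X | f x == b]|)%N.
Proof.
move=> fB lt; apply/exists_inP; apply: contraLR lt => /exists_inPn none.
rewrite -leqNgt -sum1_card (partition_big f (mem B)) //= -sum_nat_const.
apply: leq_sum => b bB; have := none b bB; rewrite -leqNgt; apply: leq_trans.
by rewrite -sum1_card; apply: eq_leq; apply: eq_bigl => x; rewrite inE.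
Qed.

Lemma collision (S T : finType) (X : {set S}) (B : {set T}) (f : S -> T) :
  {in X, forall x, f x \in B} -> (#|B| < #|X|)%N ->
  exists x y, [/\ x \in X, y \in X, x != y & f x = f y].
Proof.
rewrite -[#|B|]muln1 => fB /(pigeonhole fB)[b _ /card_gt1P[x [y []]]].
rewrite !inE => /andP[xX /eqP fx] /andP[yX /eqP fy] xy.
by exists x, y; rewrite fx fy.
Qed.

Definition arc4 (I : finType) (g : I -> 'rV[F]_4) := forall i j k l,
  i != j -> i != k -> i != l -> j != k -> j != l -> k != l ->
  det4 (g i) (g j) (g k) (g l) != 0.
(** N extends the projection of the arc from its point P. Only the line that joins g P to
    N matters; it is a special line at P. *)
Definition special (I : finType) (g : I -> 'rV[F]_4) P N := forall R S,
  R != P -> S != P -> R != S -> det4 (g P) N (g R) (g S) != 0.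

Section Space.
Variables (I : finType) (g : I -> 'rV[F]_4) (t : nat).
Hypotheses (arc_g : arc4 g) (cardI : (#|I| + t = #|F| + 3)%N)
  (tq : (t * t.-1 < #|F|)%N) (tI : (t.+1 < #|I|)%N) (I4 : (3 < #|I|)%N).

(** The projection of an arc in space from one of its points is a planar arc of the same
    deficiency. *)
Lemma quotient_arc P : exists (J : finType) (v : J -> I) (r : J -> 'rV[F]_3)
    (pr : 'rV[F]_4 -> 'rV[F]_3),
  [/\ arc3 r /\ (#|J| + t = #|F| + 2)%N, (forall R, R != P -> exists2 j, v j = R & r j = pr (g R)),
   (forall j, v j != P), injective v &
   [/\ forall u l v, pr (u + l *: v) = pr u + l *: pr v,
   forall N, exists u, pr u = N ,
   (forall u w a, pr u = a *: pr w -> exists b, u = a *: w + b *: g P) &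
   exists2 c, c != 0 & forall u v w, det3 (pr u) (pr v) (pr w) = c * det4 (g P) u v w]].
Proof.
have : (2 < #|[set~ P]|)%N by rewrite cardsC1; move: I4; clear; lia.
have gP : g P != 0.
  have [i] := @pick_out I [:: P] (ltn_trans (isT : 1 < 3)%N I4); rewrite !inE => iP.
  have [j] := @pick_out I [:: P; i] (ltn_trans (isT : 2 < 3)%N I4); rewrite !inE negb_or => /andP[jP ji].
  have [k] := @pick_out I [:: P; i; j] I4; rewrite !inE !negb_or => /and3P[kP ki kj].
  have : det4 (g P) (g i) (g j) (g k) != 0 by apply: arc_g; rewrite // eq_sym.
  apply: contra => /eqP ->; apply/eqP.
  have -> : (0 : 'rV[F]_4) = 0 *: 0 by rewrite scale0r.
  by rewrite det4Z1 mul0r.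
move=> I3; have [pr [sec [c [c0 prE prL prS pr0]]]] := proj4 gP.
pose J : finType := {R : I | R != P}.
have cJ : #|{: J}| = #|I|.-1.
  by rewrite card_sig -(cardC1 P); apply: eq_card => x; rewrite !inE.
exists J, val, (fun R => pr (g (val R))), pr; split.
- split=> [i j k ij ik jk|].
    rewrite prE mulf_neq0 //; apply: arc_g; rewrite ?(inj_eq val_inj) // eq_sym; [exact: (valP i)|exact: (valP j)|exact: (valP k)].
  by rewrite cJ; move: cardI I4; clear; lia.
- by move=> R RP; exists (Sub R RP); rewrite ?SubK.
- by move=> j; exact: (valP j).
- exact: val_inj.
- split=> //; last by exists c.
    by move=> N; exists (sec N).
  move=> u w a E; have [|b bE] := pr0 (u + (-a) *: w).
    by rewrite prL E scaleNr subrr.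
  by exists b; rewrite -bE addrCA scaleNr subrr addr0.
Qed.

Lemma special_ext P (J : finType) (v : J -> I) (r : J -> 'rV[F]_3) pr c N :
  c != 0 -> (forall u v w, det3 (pr u) (pr v) (pr w) = c * det4 (g P) u v w) ->
  (forall R, R != P -> exists2 j, v j = R & r j = pr (g R)) ->
  (forall j, v j != P) -> injective v ->
  extends r (pr N) <-> special g P N.
Proof.
move=> c0 prE vS vP vI.
have rE j : r j = pr (g (v j)).
  by have [j' /vI -> ->] := vS _ (vP j).
split=> [eN R S RP SP RS|sN i j ji].
  have [i iR ri] := vS R RP; have [j jS rj] := vS S SP.
  have : det3 (r i) (pr N) (r j) != 0.
    by apply: eN; apply: contra RS => /eqP ij; rewrite -iR -jS ij.
  by rewrite ri rj prE mulf_eq0 negb_or det4C23 => /andP[].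
rewrite !rE prE mulf_neq0 // det4C23; apply: sN; rewrite ?vP //.
by rewrite (inj_eq vI) eq_sym.
Qed.

(** This is tangent_meets_extension in the projection from P. *)
Lemma special_tangent P R y : R != P ->
  (forall S, S != P -> S != R -> det4 (g P) (g R) y (g S) != 0) ->
  exists l, special g P (y + l *: g R).
Proof.
move=> RP tan_y.
have [J [v [r [pr [[arc_r cJ] vS vP vI [prL prS pr1 [c c0 prE]]]]]]] := quotient_arc P.
have [i iR ri] := vS R RP.
have rE j : r j = pr (g (v j)) by have [j' /vI -> ->] := vS _ (vP j).
have sE N := special_ext N c0 prE vS vP vI.
have [||l el] := @tangent_meets_extension _ ch2 _ r t arc_r cJ i (pr y) tq.
- by move: cJ cardI I4; clear; lia.
- move=> j ji; rewrite ri rE prE mulf_neq0 // tan_y //.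
  by apply: contra ji => /eqP E; apply/eqP/vI; rewrite E iR.
by exists l; apply/sE; rewrite prL -ri.
Qed.

(** This is extends_secant in the projection from P. *)
Lemma special_unique P R N N' : R != P -> special g P N -> special g P N' ->
  det4 (g P) (g R) N N' = 0 -> exists a b, N' = a *: N + b *: g P.
Proof.
move=> RP sN sN' D0.
have [J [v [r [pr [[arc_r cJ] vS vP vI [prL prS pr1 [c c0 prE]]]]]]] := quotient_arc P.
have [i iR ri] := vS R RP.
have sE N := special_ext N c0 prE vS vP vI.
have [|||a E] := @extends_secant _ ch2 _ r t arc_r cJ _ _ i (pr N) (pr N') (proj2 (sE _) sN) (proj2 (sE _) sN').
- by move: cJ cardI tI; clear; lia.
- by move: cJ cardI I4; clear; lia.
- by rewrite ri prE D0 mulr0.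
by exists a; apply: pr1.
Qed.

(** This is tangent_meets_extension in the projection from P, to which the point of N' has
    been added. *)
Lemma special_second P N' y : special g P N' ->
  (forall S, S != P -> det4 (g P) N' y (g S) != 0) ->
  exists l, special g P (y + l *: N').
Proof.
move=> sN' tan_y.
have [J [v [r [pr [[arc_r cJ] vS vP vI [prL prS pr1 [c c0 prE]]]]]]] := quotient_arc P.
have rE j : r j = pr (g (v j)) by have [j' /vI -> ->] := vS _ (vP j).
have sE N := special_ext N c0 prE vS vP vI.
have eN' := proj2 (sE _) sN'.
have J3 : (2 < #|J|)%N by move: cJ cardI I4; clear; lia.
have t0 : (0 < t)%N by apply: (extends_deficiency arc_r cJ J3 eN').
have cJ' : (#|{: option J}| + t.-1 = #|F| + 2)%N.
  by rewrite card_option; move: cJ t0; clear; lia.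
have [|||l el] := @tangent_meets_extension _ ch2 _ (add_point r (pr N')) t.-1 (arc3_add ch2 arc_r eN') cJ' None (pr y).
- by move: tq; apply: leq_ltn_trans; apply: leq_mul; rewrite ?leq_pred // leq_pred.
- by rewrite card_option; move: J3; clear; lia.
- by move=> [j|] //= _; rewrite rE prE mulf_neq0 // tan_y.
exists l; apply/sE; rewrite prL => i j ij.
by have := el (Some i) (Some j); rewrite /= (inj_eq (@Some_inj _)) ij => /(_ isT).
Qed.

(** This is extends_code in the projection from P: there are at most t special lines at P. *)
Lemma special_code P : exists (a : 'rV[F]_4 -> F) (B : {set F}), #|B| = t /\
   (forall N, special g P N -> a N \in B) /\
   (forall N N', special g P N -> special g P N' -> a N = a N' ->
      exists c d, N' = c *: N + d *: g P).
Proof.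
have [J [v [r [pr [[arc_r cJ] vS vP vI [prL prS pr1 [c c0 prE]]]]]]] := quotient_arc P.
have sE N := special_ext N c0 prE vS vP vI.
have J3 : (2 < #|J|)%N by move: cJ cardI I4; clear; lia.
have tJ : (t < #|J|)%N by move: cJ cardI tI; clear; lia.
have [a [B [cB [aB aE]]]] := extends_code ch2 arc_r cJ tJ J3.
exists (fun N => a (pr N)), B; split=> //; split=> [N /sE/aB //|N N' /sE eN /sE eN' E].
by have [d /pr1 [b ->]] := aE _ _ eN eN' E; exists d, b.
Qed.

End Space.
End SpaceArcs.

(** * Three skew special lines *)

Section SkewLines.
Variable F : finFieldType.
Hypothesis ch2 : 2%N \in [pchar F].
Local Notation oppF := (oppF ch2).
Local Notation C12 := (det4C12 ch2).
Local Notation C23 := (det4C23 ch2).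
Local Notation C34 := (det4C34 ch2).

Section Space.
Variables (I : finType) (g : I -> 'rV[F]_4) (t : nat).
Hypotheses (arc_g : arc4 g) (cardI : (#|I| + t = #|F| + 3)%N)
  (tq : (t * t.-1 < #|F|)%N) (tI : (t.+1 < #|I|)%N) (I4 : (3 < #|I|)%N).

Lemma special_rescale P N c d : special g P N -> c != 0 -> special g P (c *: N + d *: g P).
Proof.
move=> sN c0 R S RP SP RS; rewrite !det4E mulr0 addr0 mulf_neq0 //.
exact: sN.
Qed.

Lemma special_shift P N d : special g P N -> special g P (N + d *: g P).
Proof. by move=> sN; rewrite -[N]scale1r; apply: special_rescale; rewrite ?oner_neq0. Qed.

Lemma third_point (s : seq I) : (size s <= 3)%N -> exists x, x \notin s.
Proof. by move=> s3; apply: pick_out; apply: leq_ltn_trans I4. Qed.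

(** Seen from R, the special line at P is a tangent at P; so one of its points is special
    at R. *)
Lemma special_match P N R : special g P N -> R != P -> exists l, special g R (N + l *: g P).
Proof.
move=> sN RP; apply: (special_tangent ch2 arc_g cardI) => //; first by rewrite eq_sym.
move=> S SR SP; rewrite C12 C23.
by apply: sN; rewrite // eq_sym.
Qed.

(** Seen from R, two such points would be extending points on a line with P. *)
Lemma special_match_inj P N R l m : special g P N -> R != P ->
  special g R (N + l *: g P) -> special g R (N + m *: g P) -> l = m.
Proof.
move=> sN RP sl sm; have PR : P != R by rewrite eq_sym.
have [|a [b E]] := special_unique ch2 arc_g cardI tI I4 PR sl sm.
  by rewrite !det4E !(mulr0, addr0, add0r).
have [S] := @third_point [:: P; R] isT; rewrite !inE negb_or => /andP[SP SR].
have D0 : det4 (g P) N (g R) (g S) != 0 by apply: sN; rewrite // eq_sym.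
have e1 := congr1 (fun x => det4 (g P) x (g R) (g S)) E.
have e2 := congr1 (fun x => det4 x N (g R) (g S)) E.
move: e1 e2; rewrite /= !det4E !(mulr0, addr0, add0r) => e1 e2.
have a1 : a = 1 by apply: (mulIf D0); rewrite -e1 mul1r.
by apply/esym/(mulIf D0); rewrite e2 a1 mul1r.
Qed.

(** Seen from U, the line R X is a tangent for every R in T, and it has a point
    X + l_R g_R that is special at U. If there were more than t of these points, two of
    them would be on one line through U, which forces l_R = 0 and makes X special at U. *)
Lemma special_few X U (T : {set I}) : ~ special g U X -> {in T, forall R, special g R X} ->
  (#|T| <= t)%N.
Proof.
move=> nU sT.
have TU R : R \in T -> R != U by move=> /sT sR; apply: contra_notN nU => /eqP <-.
have /fin_all_exists [l lE] : forall R, exists l, R \in T -> special g U (X + l *: g R).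
  move=> R; case: (boolP (R \in T)) => [RT|_]; last by exists 0.
  have [||l sl] := special_tangent ch2 arc_g cardI tq I4 (P := U) (R := R) (y := X).
  - exact: TU.
  - move=> S SU SR; rewrite C12 C23; apply: (sT R) => //.
      by rewrite eq_sym TU.
    by rewrite eq_sym.
  by exists l.
have [a [B [<- [aB aE]]]] := special_code ch2 arc_g cardI tI I4 U.
rewrite -(@card_in_imset _ _ (fun R => a (X + l R *: g R)) T).
  by apply: subset_leq_card; apply/subsetP => y /imsetP[R RT ->]; apply/aB/lE.
move=> R S RT ST E; apply: contraTeq (isT) => RS; exfalso; apply: nU.
have [c [d eE]] := aE _ _ (lE R RT) (lE S ST) E.
have D0 : det4 (g R) X (g U) (g S) != 0.
  by apply: sT; rewrite // eq_sym // TU.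
have e1 := congr1 (fun x => det4 (g R) x (g U) (g S)) eE.
have e2 := congr1 (fun x => det4 (g R) X (g U) x) eE.
move: e1 e2; rewrite /= !det4E !(mulr0, addr0, add0r) => e1 e2.
have l0 : l S = 0 by move/eqP: e2; rewrite mulf_eq0 (negbTE D0) orbF => /eqP.
by have := lE S ST; rewrite l0 scale0r addr0.
Qed.

Hypothesis noext : forall X, exists U, ~ special g U X.

Lemma few_specials X (T : {set I}) : {in T, forall R, special g R X} -> (#|T| <= t)%N.
Proof. by have [U nU] := noext X; apply: special_few nU. Qed.

Hypotheses (t1 : (0 < t)%N) (t3q : (t ^ 3 <= #|F|)%N).

(** Start with the special line L1 at P1. Every other R is matched to a point X_R of L1,
    and the special line R X_R is matched to special lines at P2 and at P3. By
    few_specials, these lines are skew to L1 for all R but 2 (t - 2). For the remaining R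
    they take at most (t - 1)^2 values, so by t^3 <= q more than t points R have the same
    pair of lines, L2 and L3. If L2 met L3, then the common point would be special for all
    these R. *)
Lemma three_lines P1 P2 P3 N1 : P1 != P2 -> P1 != P3 -> P2 != P3 -> special g P1 N1 ->
  exists N2 N3 (A : {set I}),
  [/\ (t < #|A|)%N, special g P2 N2 /\ special g P3 N3,
      [/\ det4 (g P1) N1 (g P2) N2 != 0, det4 (g P1) N1 (g P3) N3 != 0 &
      det4 (g P2) N2 (g P3) N3 != 0] &
   {in A, forall R, [/\ R != P1, R != P2 & R != P3] /\
      exists l m n, [/\ special g R (N1 + l *: g P1),
        exists a b, N1 + l *: g P1 + m *: g R = a *: N2 + b *: g P2 &
        exists a b, N1 + l *: g P1 + n *: g R = a *: N3 + b *: g P3]}].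
Proof.
move=> P12 P13 P23 sN1.
have [D [DP cD [P1D P2D P3D]]] : exists D : {set I},
    [/\ (forall R, R \in D -> [/\ R != P1, R != P2 & R != P3]),
        #|D| = (#|I| - 3)%N & [/\ P1 \notin D, P2 \notin D & P3 \notin D]].
  exists (~: [set P1; P2; P3]); split; last by rewrite !inE !eqxx !orbT.
    by move=> R; rewrite !inE !negb_or -andbA => /and3P.
  rewrite cardsCs setCK; congr (_ - _)%N.
  by rewrite setUC cardsU1 cards2 !inE negb_or P12 eq_sym P13 eq_sym P23.
have /fin_all_exists [l lE] : forall R, exists l, R \in D -> special g R (N1 + l *: g P1).
  move=> R; case: (boolP (R \in D)) => [/DP[R1 _ _]|_]; last by exists 0.
  by have [l sl] := special_match sN1 R1; exists l.
pose X R := N1 + l R *: g P1.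
have mk Q : Q \notin D -> forall R, exists m, R \in D -> special g Q (X R + m *: g R).
  move=> QD R; case: (boolP (R \in D)) => [RD|_]; last by exists 0.
  have [|m sm] := special_match (lE R RD) (R := Q); last by exists m.
  by apply: contraNneq QD => ->.
have [P21 P31] : P2 != P1 /\ P3 != P1 by rewrite eq_sym P12 eq_sym P13.
have /fin_all_exists [m mE] := mk P2 P2D.
have /fin_all_exists [n nE] := mk P3 P3D.
have [z2 sz2] := special_match sN1 P21.
have [z3 sz3] := special_match sN1 P31.
pose Y2 R := X R + m R *: g R; pose Y3 R := X R + n R *: g R.
have [a2 [B2 [cB2 [aB2 aE2]]]] := special_code ch2 arc_g cardI tI I4 P2.
have [a3 [B3 [cB3 [aB3 aE3]]]] := special_code ch2 arc_g cardI tI I4 P3.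
(* if the line at Q meets L1, then the common point is matched to Q and is special at R *)
have bad Q z (mu : I -> F) : Q != P1 -> Q \notin D -> special g Q (N1 + z *: g P1) ->
    (forall R, R \in D -> special g Q (X R + mu R *: g R)) ->
    (#|[set R in D | det4 (g P1) N1 (g Q) (X R + mu R *: g R) == 0]%R| <= t - 2)%N.
  move=> QP1 QD sz sY.
  set T := [set R in D | _].
  have Tsp : {in P1 |: (Q |: T), forall R, special g R (N1 + z *: g P1)}.
    move=> R; rewrite !inE => /or3P[/eqP->|/eqP->//|/andP[RD]].
      exact: special_shift.
    have [R1 R2 R3] := DP R RD.
    have RQ : R != Q by apply: contraNneq QD => <-.
    rewrite !det4E !(mulr0, addr0, add0r) mulf_eq0.
    have /negPf-> : det4 (g P1) N1 (g Q) (g R) != 0 by apply: sN1; rewrite // eq_sym.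
    rewrite orbF => /eqP mu0.
    have := sY R RD; rewrite mu0 scale0r addr0 => sXQ.
    by rewrite -(special_match_inj sN1 QP1 sXQ sz); apply: lE.
  have := few_specials Tsp.
  have QT : Q \notin T by rewrite inE (negbTE QD).
  have PT : P1 \notin Q |: T by rewrite !inE negb_or eq_sym QP1 (negbTE P1D).
  by rewrite cardsU1 PT cardsU1 QT; clear; lia.
have bad2 := bad P2 z2 m P21 P2D sz2 mE.
have bad3 := bad P3 z3 n P31 P3D sz3 nE.
set D2 := [set R in D | _] in bad2; set D3 := [set R in D | _] in bad3.
pose D' := D :\: (D2 :|: D3).
have cD' : (t * (t.-1 * t.-1) < #|D'|)%N.
  have h1 : (#|D2 :|: D3| <= (t - 2) + (t - 2))%N.
    by apply: leq_trans (leq_card_setU _ _) _; apply: leq_add.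
  have h2 : (#|D| <= #|D2 :|: D3| + #|D'|)%N.
    by rewrite -(cardsID (D2 :|: D3) D) leq_add2r subset_leq_card // subsetIr.
  move: h1 h2 cD cardI I4 t1 t3q; clear.
  move: #|D2 :|: D3| #|D'| #|D| #|I| #|F| => a b d i q h1 h2 cD hI hI4 ht hq.
  case: t ht h1 hI hq => [|[|u]] //= _ h1 hI hq; first by lia.
  have hq' : (u.+2 * (u.+2 * u.+2) <= q)%N by move: hq; rewrite !expnS expn0 muln1.
  clear hq; nia.
pose C2 := B2 :\ a2 (N1 + z2 *: g P1); pose C3 := B3 :\ a3 (N1 + z3 *: g P1).
have cC2 : #|C2| = t.-1.
  by rewrite -cB2 (cardsD1 (a2 (N1 + z2 *: g P1)) B2) aB2.
have cC3 : #|C3| = t.-1.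
  by rewrite -cB3 (cardsD1 (a3 (N1 + z3 *: g P1)) B3) aB3.
have code_ne Q z Y (a : 'rV[F]_4 -> F) : special g Q (N1 + z *: g P1) -> special g Q Y ->
    (forall N N', special g Q N -> special g Q N' -> a N = a N' ->
       exists c d : F, N' = c *: N + d *: g Q) ->
    det4 (g P1) N1 (g Q) Y != 0 -> a Y != a (N1 + z *: g P1).
  move=> sz sY aE; apply: contra => /eqP/esym E.
  have [c [d ->]] := aE _ _ sz sY E.
  by rewrite !det4E !(mulr0, addr0).
have D'P R : R \in D' -> [/\ R \in D, a2 (Y2 R) \in C2 & a3 (Y3 R) \in C3].
  rewrite in_setD in_setU => /andP[]; rewrite negb_or => /andP[n2 n3] RD.
  move: n2 n3; rewrite !inE RD /= => n2 n3.
  split=> //.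
    by rewrite (code_ne _ _ _ _ sz2 (mE R RD) aE2 n2) /= aB2 //; apply: mE.
  by rewrite (code_ne _ _ _ _ sz3 (nE R RD) aE3 n3) /= aB3 //; apply: nE.
pose fib c := [set R in D' | (a2 (Y2 R), a3 (Y3 R)) == c].
have [||c _ ltc] := @pigeonhole _ _ D' (setX C2 C3) (fun R => (a2 (Y2 R), a3 (Y3 R))) t.
- by move=> R /D'P[_ ? ?]; rewrite in_setX; apply/andP.
- by rewrite cardsX cC2 cC3 mulnC.
have /card_gt0P[R0 R0f] : (0 < #|fib c|)%N by apply: leq_trans ltc.
have fE R : (R \in fib c) = (R \in D') && ((a2 (Y2 R), a3 (Y3 R)) == c) by rewrite in_set.
have fibP R : R \in fib c -> [/\ R \in D, a2 (Y2 R) = a2 (Y2 R0) & a3 (Y3 R) = a3 (Y3 R0)].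
  move=> Rf; move: R0f Rf; rewrite !fE => /andP[_ /eqP<-] /andP[/D'P[RD _ _]].
  by rewrite xpair_eqE => /andP[/eqP-> /eqP->].
have R0D' : R0 \in D' by move: R0f; rewrite fE => /andP[].
have [R0D _ _] := D'P _ R0D'.
have [n20 n30] : det4 (g P1) N1 (g P2) (Y2 R0) != 0 /\ det4 (g P1) N1 (g P3) (Y3 R0) != 0.
  move: R0D'; rewrite in_setD in_setU => /andP[]; rewrite negb_or => /andP[n2 n3] _.
  by move: n2 n3; rewrite [R0 \in D2]inE [R0 \in D3]inE R0D.
exists (Y2 R0), (Y3 R0), (fib c); split=> //; first by split; [apply: mE|apply: nE].
- split=> //; apply/eqP => meet.
  have lines R : R \in fib c -> (exists a b, Y2 R = a *: Y2 R0 + b *: g P2)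
      /\ (exists a b, Y3 R = a *: Y3 R0 + b *: g P3).
    move=> /fibP[RD /esym e2 /esym e3]; split.
      by apply: aE2 e2; apply: mE.
    by apply: aE3 e3; apply: nE.
  have mn R : R \in fib c -> m R = n R.
    move=> Rf; have [[a [b e2]] [a' [b' e3]]] := lines R Rf; have [RD _ _] := fibP _ Rf.
    have [R1 R2 R3] := DP _ RD.
    have : det4 (g P2) (Y2 R) (g P3) (Y3 R) = 0.
      rewrite e2 e3; move: (Y2 R0) (Y3 R0) meet => u v uv.
      by rewrite !det4E !(mulr0, addr0, add0r) uv !mulr0.
    have D0 : det4 (g P2) (X R) (g P3) (g R) != 0.
      by rewrite C34 C23 C12 C23; apply: (lE R RD); rewrite // eq_sym.
    rewrite /Y2 /Y3; move: (X R) D0 => x D0.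
    rewrite !det4E !(mulr0, addr0, add0r) => /eqP; rewrite addr_eq0 oppF.
    have -> : det4 (g P2) (g R) (g P3) x = det4 (g P2) x (g P3) (g R).
      by rewrite C23 C34 C23.
    by move/eqP/(mulIf D0)=> ->.
  have sp : {in fib c, forall R, special g R (Y2 R0)}.
    move=> R Rf; have [[a [b e2]] [a' [b' e3]]] := lines R Rf; have [RD _ _] := fibP _ Rf.
    have [S] := @third_point [:: P2; P3] isT; rewrite !inE negb_or => /andP[SP2 SP3].
    have Y23 : Y2 R0 = Y3 R0 by rewrite /Y2 /Y3 mn.
    have D0 : det4 (g P2) (Y2 R0) (g P3) (g S) != 0.
      by apply: (mE R0 R0D); rewrite // eq_sym.
    have b0 : b = 0.
      have : det4 (Y2 R) (Y2 R0) (g P3) (g S) = det4 (Y3 R) (Y2 R0) (g P3) (g S).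
        by rewrite /Y2 /Y3 mn.
      rewrite e2 e3 -Y23; move: (Y2 R0) D0 => u D0.
      rewrite !det4E !(mulr0, addr0, add0r) => /eqP.
      by rewrite mulf_eq0 (negbTE D0) orbF => /eqP.
    have sR : special g R (Y2 R) by apply: special_shift; apply: lE.
    have a0 : a != 0.
      apply/eqP => a0; have [R1 R2 R3] := DP _ RD.
      have : det4 (g R) (Y2 R) (g P2) (g P3) != 0 by apply: sR; rewrite // eq_sym.
      by rewrite e2 a0 b0 !det4E !mul0r addr0 eqxx.
    have := special_rescale 0 sR (invr_neq0 a0).
    by rewrite e2 b0 !scale0r !addr0 scalerA mulVf // scale1r.
  by have := few_specials sp; rewrite leqNgt ltc.
- move=> R Rf; have [RD e2 e3] := fibP _ Rf; split; first exact: DP.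
  exists (l R), (m R), (n R); split; first exact: lE.
    by apply: aE2 (esym e2); apply: mE.
  by apply: aE3 (esym e3); apply: nE.
Qed.
End Space.
End SkewLines.

(** * Special lines on the rulings of a quadric *)

Section Rulings.
Variable F : finFieldType.
Hypothesis ch2 : 2%N \in [pchar F].
Local Notation oppF := (oppF ch2).
Local Notation C12 := (det4C12 ch2).
Local Notation C23 := (det4C23 ch2).
Local Notation C34 := (det4C34 ch2).

Definition vec4 (a b c d : F) : 'rV[F]_4 := \row_j [:: a; b; c; d]`_j.
(** The points of the quadric x0 x3 = x1 x2 off the plane x3 = 0. The lines of the quadric
    through qpt b c have the directions (c, 1, 0, 0) and (b, 0, 1, 0). *)
Definition qpt (b c : F) := vec4 (b * c) b c 1.

Lemma vec4D a b c d a' b' c' d' : vec4 a b c d + vec4 a' b' c' d' =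
  vec4 (a + a') (b + b') (c + c') (d + d').
Proof. by apply/rowP; apply: ord4P; rewrite !mxE. Qed.
Lemma vec4Z k a b c d : k *: vec4 a b c d = vec4 (k * a) (k * b) (k * c) (k * d).
Proof. by apply/rowP; apply: ord4P; rewrite !mxE. Qed.
Lemma vec4_inj a b c d a' b' c' d' : vec4 a b c d = vec4 a' b' c' d' ->
  [/\ a = a', b = b', c = c' & d = d'].
Proof.
move/rowP=> H; move: (H (@Ordinal 4 0 isT)) (H (@Ordinal 4 1 isT)) (H (@Ordinal 4 2 isT))
  (H (@Ordinal 4 3 isT)).
by rewrite !mxE.
Qed.
Lemma vec4E (v : 'rV[F]_4) : v = vec4 (v ord0 (@Ordinal 4 0 isT)) (v ord0 (@Ordinal 4 1 isT))
  (v ord0 (@Ordinal 4 2 isT)) (v ord0 (@Ordinal 4 3 isT)).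
Proof. by apply/rowP; apply: ord4P; rewrite !mxE. Qed.
Lemma vec4_0 : (0 : 'rV[F]_4) = vec4 0 0 0 0.
Proof. by rewrite [LHS]vec4E !mxE. Qed.

(** Different lines of one ruling are skew. *)
Lemma ruling_indep s w c s' w' c' k : c != c' ->
  vec4 (s * c) s (w * c) w = k *: vec4 (s' * c') s' (w' * c') w' -> s = 0 /\ w = 0.
Proof.
move=> cc; rewrite vec4Z => /vec4_inj[e0 e1 e2 e3].
have d : c - c' != 0 by rewrite subr_eq0.
split; apply: (mulIf d); rewrite mul0r mulrBr.
  by rewrite e0 e1; ring.
by rewrite e2 e3; ring.
Qed.

Section Chart.
Variables (I : finType) (g : I -> 'rV[F]_4) (t : nat).
Hypotheses (arc_g : arc4 g) (cardI : (#|I| + t = #|F| + 3)%N)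
  (tq : (t * t.-1 < #|F|)%N) (tI : (t.+1 < #|I|)%N) (I4 : (3 < #|I|)%N).

Let special_code P := special_code ch2 arc_g cardI tI I4 P.

Lemma special_nz P N : special g P N -> N != 0.
Proof.
have [R] := third_point I4 (s := [:: P]) isT; rewrite !inE => RP.
have [S] := third_point I4 (s := [:: P; R]) isT; rewrite !inE negb_or => /andP[SP SR] sN.
apply/eqP => N0; have /eqP[] : det4 (g P) N (g R) (g S) != 0 by apply: sN; rewrite // eq_sym.
by rewrite N0 -(scale0r 0) !det4E mul0r.
Qed.

Lemma special_out P N R k l m : special g P N -> R != P -> k != 0 ->
  k *: g R = l *: g P + m *: N -> False.
Proof.
move=> sN RP k0 E.
have [S] := third_point I4 (s := [:: P; R]) isT; rewrite !inE negb_or => /andP[SP SR].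
have /eqP[] : k * det4 (g P) N (g R) (g S) != 0.
  by rewrite mulf_neq0 // sN // eq_sym.
by rewrite -det4Z3 E !det4E !mulr0 addr0.
Qed.

Lemma special_comb P N N' k l : special g P N -> k != 0 -> N' = k *: N + l *: g P ->
  special g P N'.
Proof. by move=> sN k0 ->; apply: special_rescale. Qed.

(** With equal c, the two points would be on one line of the quadric, which is special at R. *)
Lemma chart_neq b c b' c' k R S : g R = qpt b c -> g S = k *: qpt b' c' -> S != R ->
  special g R (vec4 c 1 0 0) -> c != c'.
Proof.
move=> gR gS SR sR; apply/eqP => cc.
apply: (@special_out R _ S 1 k (k * (b' - b)) sR SR (oner_neq0 _)).
by rewrite gS gR /qpt !vec4Z vec4D cc; congr vec4; ring.
Qed.

(** Matching with U the special lines at the points of A gives special points at U. None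
    of them is on the known special line at U, so they have only t - 1 labels, and two of
    them are on one line through U. As this line meets two lines of one ruling, it is the
    line through U of the other ruling. *)
Lemma other_ruling U b0 c0 k0 (A : {set I}) (b c : I -> F) :
  k0 != 0 -> g U = k0 *: qpt b0 c0 -> special g U (vec4 c0 1 0 0) -> (t <= #|A|)%N -> (0 < t)%N -> U \notin A ->
  {in A, forall R, g R = qpt (b R) (c R) /\ special g R (vec4 (c R) 1 0 0)} ->
  special g U (vec4 b0 0 1 0).
Proof.
move=> k00 gU sU tA t0 UA hA.
have RU R : R \in A -> R != U by apply: contraTneq => ->.
have cU R : R \in A -> c R != c0.
  by move=> RA; have [gR sR] := hA R RA; apply: (chart_neq gR gU _ sR); rewrite eq_sym RU.
have cRS R S : R \in A -> S \in A -> R != S -> c R != c S.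
  move=> RA SA RS; have [gR sR] := hA R RA; have [gS _] := hA S SA.
  by apply: (@chart_neq _ _ (b S) _ 1 _ S gR _ _ sR); rewrite ?scale1r // eq_sym.
have /fin_all_exists [m mE] : forall R, exists m, R \in A ->
    special g U (vec4 (c R) 1 0 0 + m *: g R).
  move=> R; case: (boolP (R \in A)) => [RA|_]; last by exists 0.
  have [_ sR] := hA R RA.
  have [|m sm] := special_match ch2 arc_g cardI tq I4 sR (R := U); last by exists m.
  by rewrite eq_sym RU.
have [a [B [cB [aB aE]]]] := special_code U.
pose Y R := vec4 (c R) 1 0 0 + m R *: g R.
have YE R : R \in A -> Y R = vec4 ((1 + m R * b R) * c R) (1 + m R * b R) (m R * c R) (m R).
  by move=> RA; rewrite /Y; have [-> _] := hA R RA; rewrite /qpt vec4Z vec4D; congr vec4; ring.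
have codes : {in A, forall R, a (Y R) \in B :\ a (vec4 c0 1 0 0)}.
  move=> R RA; rewrite in_setD1 aB ?andbT; last exact: mE.
  apply/eqP => E; have [k [l]] := aE _ _ sU (mE R RA) (esym E).
  rewrite -/(Y R) (YE R RA) gU scalerA; move: (l * k0) => {}l.
  rewrite /qpt !vec4Z vec4D => /vec4_inj[e0 e1 e2 e3].
  have m0 : m R = 0.
    have d : c R - c0 != 0 by rewrite subr_eq0 cU.
    by apply: (mulIf d); rewrite mul0r mulrBr e2 {1}e3; ring.
  have l0 : l = 0 by rewrite -[l]mulr1 -[l * 1]add0r -[X in X + _](mulr0 k) -e3.
  have /eqP[] := cU R RA; rewrite -[RHS]mul1r -[c R]mul1r.
  have k1 : k = 1 by rewrite -[k]mulr1 -[_ * 1]addr0 -(mul0r b0) -l0 -e1 m0 mul0r addr0.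
  by move: e0; rewrite m0 l0 k1 !mul0r !addr0 !mul1r.
have [R [S [RA SA RS E]]] : exists R S, [/\ R \in A, S \in A, R != S & a (Y R) = a (Y S)].
  apply: collision codes _; rewrite (cardsD1 (a (vec4 c0 1 0 0)) B) aB // in cB.
  by move: cB tA t0; clear; lia.
have [k [l eY]] := aE _ _ (mE S SA) (mE R RA) (esym E).
move: eY; rewrite -/(Y R) -/(Y S) (YE R RA) (YE S SA) gU scalerA; move: (l * k0) => {}l.
rewrite /qpt !vec4Z !vec4D => /vec4_inj[e0 e1 e2 e3].
set s := 1 + m R * b R in e0 e1; set w := m R in e2 e3.
have d : c R - c S != 0 by rewrite subr_eq0 cRS.
have sw : s = b0 * w.
  apply: (mulIf d); rewrite !mulrBr e0 {1}e1 -mulrA e2 {1}e3; ring.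
have w0 : w != 0.
  apply/eqP => w0; have := special_nz (mE R RA); rewrite -/(Y R) (YE R RA) -/s -/w sw w0.
  by rewrite !(mulr0, mul0r) vec4_0 eqxx.
have d0 : c R - c0 != 0 by rewrite subr_eq0 cU.
apply: (@special_comb U _ _ (w * (c R - c0))^-1 (- (k0 * (c R - c0))^-1) (mE R RA)).
  by rewrite invr_neq0 // mulf_neq0.
rewrite -/(Y R) (YE R RA) gU /qpt !vec4Z vec4D -/s -/w sw; congr vec4; field; by rewrite ?w0 ?d0 ?k00.
Qed.

Definition ruled U := exists k b c, [/\ k != 0, g U = k *: qpt b c,
  special g U (vec4 c 1 0 0) & special g U (vec4 b 0 1 0)].

Variables (Q : I) (A : {set I}) (b c : I -> F).
Hypotheses (gQ : g Q = vec4 1 0 0 0) (sQ1 : special g Q (vec4 0 1 0 0))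
  (sQ2 : special g Q (vec4 0 0 1 0))
  (hA : {in A, forall R, [/\ g R = qpt (b R) (c R), special g R (vec4 (c R) 1 0 0) &
     special g R (vec4 (b R) 0 1 0)]})
  (tA : (t < #|A|)%N) (t0 : (0 < t)%N).

(** mline and lline run through the points, other than g R, of the two lines of the quadric
    through g R. *)
Definition mline R m := vec4 ((1 + m * b R) * c R) (1 + m * b R) (m * c R) m.
Definition lline R m := vec4 (b R * (1 + m * c R)) (b R * m) (1 + m * c R) m.

Lemma mlineE R m : R \in A -> vec4 (c R) 1 0 0 + m *: g R = mline R m.
Proof. by move=> RA; have [-> _ _] := hA RA; rewrite /qpt vec4Z vec4D; congr vec4; ring. Qed.
Lemma llineE R m : R \in A -> vec4 (b R) 0 1 0 + m *: g R = lline R m.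
Proof. by move=> RA; have [-> _ _] := hA RA; rewrite /qpt vec4Z vec4D; congr vec4; ring. Qed.

Lemma chart_c_neq R S : R \in A -> S \in A -> R != S -> c R != c S.
Proof.
move=> RA SA RS; have [gR sR _] := hA RA; have [gS _ _] := hA SA.
by apply: (@chart_neq _ _ (b S) _ 1 _ S gR _ _ sR); rewrite ?scale1r // eq_sym.
Qed.

Lemma mline_indep R S m n k : R \in A -> S \in A -> R != S -> mline R m <> k *: mline S n.
Proof.
move=> RA SA RS /(ruling_indep (chart_c_neq RA SA RS))[s0 w0].
by move: s0; rewrite w0 mul0r addr0 => /eqP; rewrite oner_eq0.
Qed.

Section AtU.
Variable U : I.
Hypotheses (UQ : U != Q) (UA : U \notin A).
Definition same_line Y Y' := exists k l, Y' = k *: Y + l *: g U.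

(** Otherwise U would be in the plane of the two special lines at R, against
    special_unique. *)
Lemma one_ruling R m n : R \in A -> special g U (mline R m) -> special g U (lline R n) ->
  ~ same_line (mline R m) (lline R n).
Proof.
move=> RA sm sl [k [l]]; rewrite -(mlineE _ RA) -(llineE _ RA) => E.
have [gR s1 s2] := hA RA.
have UR : U != R by apply: contraNneq UA => ->.
have D0 : det4 (g R) (g U) (vec4 (c R) 1 0 0) (vec4 (b R) 0 1 0) = 0.
  have := congr1 (fun x => det4 (g R) (g U) (vec4 (c R) 1 0 0) x) E.
  by rewrite /= !det4E !(mulr0, addr0).
have [x [y]] := special_unique ch2 arc_g cardI tI I4 UR s1 s2 D0.
rewrite gR /qpt !vec4Z vec4D => /vec4_inj[e0 e1 e2 e3].
have y0 : y = 0 by move: e3; rewrite mulr0 add0r mulr1 => <-.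
by move: e2 => /eqP; rewrite y0 mulr0 mul0r addr0 oner_eq0.
Qed.

(** Two lines of opposite rulings, through R and V, span a plane. It does not contain U,
    because the line at R is special; so a line through U that meets both of them passes
    through their common point. *)
Lemma mixed_rulings R V m n : R \in A -> V \in A -> R != V ->
  special g U (lline V n) -> same_line (lline V n) (mline R m) ->
  exists k, mline R m = k *: lline V n.
Proof.
move=> RA VA RV sV [k [l E]].
have [gR s1 s2] := hA RA; have [gV s1' s2'] := hA VA.
have UR : U != R by apply: contraNneq UA => ->.
have UV : U != V by apply: contraNneq UA => ->.
have D0 : det4 (g R) (vec4 (c R) 1 0 0) (g V) (g U) != 0.
  by apply: s1; rewrite // eq_sym.
have cc : c R - c V != 0 by rewrite subr_eq0 chart_c_neq.
have XV : vec4 (b V) 0 1 0 = (c R - c V)^-1 *: g R + (c R - c V)^-1 * (b V - b R) *: vec4 (c R) 1 0 0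
   - (c R - c V)^-1 *: g V.
  rewrite gR gV /qpt -scaleNr !vec4Z !vec4D; congr vec4; field; exact: cc.
have : det4 (g R) (vec4 (c R) 1 0 0) (g V) (mline R m) = 0.
  by rewrite -(mlineE _ RA) !det4E !mulr0 addr0.
rewrite E !det4E -(llineE _ VA) XV -scaleNr !det4E !(mulr0, addr0) add0r => /eqP.
rewrite mulf_eq0 (negbTE D0) orbF => /eqP l0.
by exists k; rewrite l0 scale0r addr0.
Qed.

(** By mixed_rulings the two points on the lines of R and S would coincide with the point
    on the line of V, but the lines of one ruling are skew. *)
Lemma two_and_one R S V m n p : R \in A -> S \in A -> V \in A -> R != S -> R != V -> S != V ->
  special g U (mline R m) -> special g U (mline S n) -> special g U (lline V p) ->
  same_line (lline V p) (mline R m) -> same_line (lline V p) (mline S n) -> False.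
Proof.
move=> RA SA VA RS RV SV sR sS sV l1 l2.
have [k kE] := mixed_rulings RA VA RV sV l1; have [k' kE'] := mixed_rulings SA VA SV sV l2.
have k'0 : k' != 0.
  by apply: contraTneq (special_nz sS) => k'0; rewrite kE' k'0 scale0r eqxx.
apply: (@mline_indep R S m n (k / k') RA SA RS).
by rewrite kE kE' scalerA divfK.
Qed.

(** A line that meets three lines of a ruling is a line of the other ruling, so U is on
    the quadric. It is not in the plane x3 = 0 because of the two special lines at Q. *)
Lemma three_mlines R S V m n p : R \in A -> S \in A -> V \in A -> R != S -> R != V -> S != V ->
  special g U (mline R m) -> special g U (mline S n) -> special g U (mline V p) ->
  same_line (mline S n) (mline R m) -> same_line (mline V p) (mline R m) ->
  exists k b0 c0, [/\ k != 0, g U = k *: qpt b0 c0 & special g U (vec4 b0 0 1 0)].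
Proof.
move=> RA SA VA RS RV SV sR sS sV [k [l E]] [k' [l' E']].
have l0 : l != 0.
  by apply/eqP => l0; apply: (@mline_indep R S m n k) => //; rewrite E l0 scale0r addr0.
have gUE : g U = l^-1 *: mline R m - (l^-1 * k) *: mline S n.
  by rewrite E scalerDr !scalerA mulVf // scale1r addrAC addrN add0r.
have l'0 : l' != 0.
  by apply/eqP => l0'; apply: (@mline_indep R V m p k') => //; rewrite E' l0' scale0r addr0.
have nU N x : special g U N -> N <> x *: g U.
  move=> sN E0.
  have [X] := third_point I4 (s := [:: U]) isT; rewrite !inE => XU.
  have [Y] := third_point I4 (s := [:: U; X]) isT; rewrite !inE negb_or => /andP[YU YX].
  have : det4 (g U) N (g X) (g Y) != 0 by apply: sN; rewrite // eq_sym.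
  by rewrite E0 !det4E mulr0 eqxx.
have k0 : k != 0.
  by apply/eqP => k0; apply: (nU _ l sR); rewrite E k0 scale0r add0r.
have cSV : c S - c V != 0 by rewrite subr_eq0 chart_c_neq.
pose lam := (l' - l) * (c R - c V) / (l' * k * (c S - c V)).
have dep : (l' - l) *: mline R m = (l' * k) *: mline S n - (l * k') *: mline V p.
  have e1 : l' *: mline R m = (l' * k) *: mline S n + (l * l') *: g U.
    by rewrite E scalerDr !scalerA [l' * l]mulrC.
  have e2 : l *: mline R m = (l * k') *: mline V p + (l * l') *: g U.
    by rewrite E' scalerDr !scalerA.
  by rewrite scalerBl e1 e2 opprD addrACA addrN addr0.
move: dep; rewrite -scaleNr !vec4Z !vec4D => /vec4_inj[d0 d1 d2 d3].
set s := 1 + m * b R in d0 d1; set s' := 1 + n * b S in d0 d1.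
have den : l' * k * (c S - c V) != 0 by rewrite !mulf_neq0.
have lamE : lam * (l' * k * (c S - c V)) = (l' - l) * (c R - c V) by rewrite /lam divfK.
have sE : s' = lam * s.
  apply: (mulIf den); rewrite [RHS]mulrAC lamE.
  have -> : s' * (l' * k * (c S - c V)) =
    (l' * k * (s' * c S) + - (l * k') * ((1 + p * b V) * c V))
     - (l' * k * s' + - (l * k') * (1 + p * b V)) * c V by ring.
  by rewrite -d0 -d1; ring.
have wE : n = lam * m.
  apply: (mulIf den); rewrite [RHS]mulrAC lamE.
  have -> : n * (l' * k * (c S - c V)) =
    (l' * k * (n * c S) + - (l * k') * (p * c V))
     - (l' * k * n + - (l * k') * p) * c V by ring.
  by rewrite -d2 -d3; ring.
pose u := c R - k * lam * c S; pose u' := 1 - k * lam.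
have gU' : g U = l^-1 *: vec4 (s * u) (s * u') (m * u) (m * u').
  rewrite gUE /mline -/s -/s' sE wE -scaleNr !vec4Z vec4D /u /u'.
  by congr vec4; ring.
have m0 : m != 0.
  apply/eqP => m0; apply: (@special_out Q _ U 1 (l^-1 * (s * u)) (l^-1 * (s * u')) sQ1 UQ (oner_neq0 _)).
  by rewrite gU' gQ m0 !vec4Z vec4D; congr vec4; ring.
have u'0 : u' != 0.
  apply/eqP => u'0; apply: (@special_out Q _ U 1 (l^-1 * (s * u)) (l^-1 * (m * u)) sQ2 UQ (oner_neq0 _)).
  by rewrite gU' gQ u'0 !vec4Z vec4D; congr vec4; ring.
have gUq : g U = (l^-1 * m * u') *: qpt (s / m) (u / u').
  rewrite gU' /qpt !vec4Z; congr vec4; field; by rewrite ?m0 ?u'0 ?l0.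
have K0 : l^-1 * m * u' != 0 by rewrite !mulf_neq0 ?invr_neq0.
exists (l^-1 * m * u'), (s / m), (u / u'); split=> //.
have cne : c R * u' - u != 0.
  apply/eqP => cu; apply: (nU _ (l / u') sR).
  have {}cu : u = c R * u' by apply/esym/eqP; rewrite -subr_eq0 cu.
  rewrite gU' /mline -/s cu !vec4Z; congr vec4; field; by rewrite ?u'0 ?l0.
have kk0 : u' / (m * (c R * u' - u)) != 0 by rewrite mulf_neq0 ?invr_neq0 ?mulf_neq0.
apply: (@special_comb U _ _ (u' / (m * (c R * u' - u))) (- (l / (m * (c R * u' - u)))) sR kk0).
rewrite gU' /mline -/s !vec4Z !vec4D; congr vec4; field; by rewrite ?cne ?m0 ?l0.
Qed.
End AtU.
End Chart.

(** The exchange of the two rulings. *)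
Definition swap4 (v : 'rV[F]_4) := vec4 (v ord0 (@Ordinal 4 0 isT))
  (v ord0 (@Ordinal 4 2 isT)) (v ord0 (@Ordinal 4 1 isT)) (v ord0 (@Ordinal 4 3 isT)).
Lemma swap4_vec a b c d : swap4 (vec4 a b c d) = vec4 a c b d.
Proof. by rewrite /swap4 !mxE. Qed.
Lemma swap4Z k v : swap4 (k *: v) = k *: swap4 v.
Proof. by rewrite /swap4 vec4Z !mxE. Qed.
Lemma swap4K v : swap4 (swap4 v) = v.
Proof. by rewrite /swap4 !mxE /= -vec4E. Qed.
Lemma det4_swap u v w x : det4 (swap4 u) (swap4 v) (swap4 w) (swap4 x) = det4 u v w x.
Proof. by rewrite -[RHS]oppF /det4 !mxE /=; ring. Qed.
Lemma swap4_qpt b c : swap4 (qpt b c) = qpt c b.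
Proof. by rewrite swap4_vec mulrC. Qed.

Section Swap.
Variables (I : finType) (g : I -> 'rV[F]_4).
Lemma arc4_swap : arc4 g -> arc4 (swap4 \o g).
Proof. by move=> H i j k l *; rewrite /= det4_swap; apply: H. Qed.
Lemma special_swap P N : special g P N -> special (swap4 \o g) P (swap4 N).
Proof. by move=> H R S *; rewrite /= det4_swap; apply: H. Qed.
Lemma special_swapV P N : special (swap4 \o g) P (swap4 N) -> special g P N.
Proof. by move=> H R S *; rewrite -det4_swap; apply: H. Qed.
End Swap.

Section Ruling.
Variables (I : finType) (g : I -> 'rV[F]_4) (t : nat).
Hypotheses (arc_g : arc4 g) (cardI : (#|I| + t = #|F| + 3)%N)
  (tq : (t * t.-1 < #|F|)%N) (tI : (t.+1 < #|I|)%N) (I4 : (3 < #|I|)%N).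
Variables (Q : I) (A : {set I}) (b c : I -> F).
Hypotheses (gQ : g Q = vec4 1 0 0 0) (sQ1 : special g Q (vec4 0 1 0 0))
  (sQ2 : special g Q (vec4 0 0 1 0))
  (hA : {in A, forall R, [/\ g R = qpt (b R) (c R), special g R (vec4 (c R) 1 0 0) &
     special g R (vec4 (b R) 0 1 0)]})
  (tA : (t < #|A|)%N) (t0 : (0 < t)%N).
Let g' := swap4 \o g.
Let arc_g' : arc4 g' := arc4_swap arc_g.
Let gQ' : g' Q = vec4 1 0 0 0. Proof. by rewrite /g' /= gQ swap4_vec. Qed.
Let sQ1' : special g' Q (vec4 0 1 0 0).
Proof. by have := special_swap sQ2; rewrite swap4_vec. Qed.
Let sQ2' : special g' Q (vec4 0 0 1 0).
Proof. by have := special_swap sQ1; rewrite swap4_vec. Qed.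
Let hA' : {in A, forall R, [/\ g' R = qpt (c R) (b R), special g' R (vec4 (b R) 1 0 0) &
     special g' R (vec4 (c R) 0 1 0)]}.
Proof.
move=> R /hA[gR s1 s2]; split; first by rewrite /g' /= gR swap4_qpt.
  by have := special_swap s2; rewrite swap4_vec.
by have := special_swap s1; rewrite swap4_vec.
Qed.
Let mlineS R m : swap4 (lline b c R m) = mline c b R m.
Proof. by rewrite swap4_vec; congr vec4; ring. Qed.
Let llineS R m : swap4 (mline b c R m) = lline c b R m.
Proof. by rewrite swap4_vec; congr vec4; ring. Qed.
Let same_lineS U Y Y' : same_line g U Y Y' -> same_line g' U (swap4 Y) (swap4 Y').
Proof.
case=> k [l E]; exists k, l; rewrite E /g' /= -!swap4Z.
by rewrite /swap4 vec4D !mxE.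
Qed.

Lemma second_ruling k b0 c0 U : U \notin A -> k != 0 -> g U = k *: qpt b0 c0 ->
  (special g U (vec4 c0 1 0 0) \/ special g U (vec4 b0 0 1 0)) -> ruled g U.
Proof.
move=> UA k0 gU sU.
have tA' : (t <= #|A|)%N by apply: ltnW.
case: sU => sU; exists k, b0, c0; split=> //.
  apply: (other_ruling arc_g cardI tq tI I4 k0 gU sU tA' t0 UA (b := b) (c := c)).
  by move=> R /hA[].
have sU' : special g' U (vec4 b0 1 0 0) by have := special_swap sU; rewrite swap4_vec.
have gU' : g' U = k *: qpt c0 b0 by rewrite /g' /= gU swap4Z swap4_qpt.
apply: special_swapV; rewrite swap4_vec.
apply: (other_ruling arc_g' cardI tq tI I4 k0 gU' sU' tA' t0 UA (b := c) (c := b)).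
by move=> R /hA'[].
Qed.

(** Matching with U both special lines at the more than t points of A gives more than 2 t
    special points at U, so three of them have the same label. By one_ruling and
    two_and_one they come from the same ruling, and three_mlines applies. *)
Lemma all_ruled U : U != Q -> ruled g U.
Proof.
move=> UQ; case: (boolP (U \in A)) => [/hA[gU s1 s2]|UA].
  by exists 1, (b U), (c U); rewrite scale1r oner_neq0.
have AU R : R \in A -> U != R by apply: contraTneq => <-.
have match_ (X : I -> 'rV[F]_4) : {in A, forall R, special g R (X R)} ->
    exists m, forall R, R \in A -> special g U (X R + m R *: g R).
  move=> sX; apply: (fin_all_exists (P := fun R m => R \in A -> special g U (X R + m *: g R))).
  move=> R; case: (boolP (R \in A)) => [RA|_]; last by exists 0.
  by have [m sm] := special_match ch2 arc_g cardI tq I4 (sX R RA) (AU R RA); exists m.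
have [m mE] := match_ (fun R => vec4 (c R) 1 0 0) (fun R RA => let: And3 _ s _ := hA RA in s).
have [n nE] := match_ (fun R => vec4 (b R) 0 1 0) (fun R RA => let: And3 _ _ s := hA RA in s).
have mS R : R \in A -> special g U (mline b c R (m R)).
  by move=> RA; rewrite -(mlineE hA _ RA); apply: mE.
have nS R : R \in A -> special g U (lline b c R (n R)).
  by move=> RA; rewrite -(llineE hA _ RA); apply: nE.
have [a [B [cB [aB aE]]]] := special_code ch2 arc_g cardI tI I4 U.
pose Y (p : I * bool) := if p.2 then lline b c p.1 (n p.1) else mline b c p.1 (m p.1).
have YS p : p \in setX A setT -> special g U (Y p).
  by case: p => R e; rewrite in_setX /Y /= => /andP[RA _]; case: e; [apply: nS|apply: mS].
have [||z zB /card_gt2P[p1 [p2 [p3 [[p1G p2G p3G] [p12 p23 p31]]]]]] :=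
    @pigeonhole _ _ (setX A [set: bool]) B (fun p => a (Y p)) 2.
- by move=> p pA; apply/aB/YS.
- rewrite cardsX cardsT card_bool cB; move: tA; clear; lia.
have sl p p' : p \in [set x in setX A setT | a (Y x) == z] ->
    p' \in [set x in setX A setT | a (Y x) == z] -> same_line g U (Y p) (Y p').
  rewrite in_set => /andP[pA /eqP ap]; rewrite in_set => /andP[p'A /eqP ap'].
  by apply: aE; [exact: YS|exact: YS|rewrite ap ap'].
have one R : (R, false) \in [set x in setX A setT | a (Y x) == z] ->
    (R, true) \in [set x in setX A setT | a (Y x) == z] -> False.
  move=> h1 h2; have := sl _ _ h1 h2; move: h1; rewrite in_set in_setX => /andP[/andP[RA _] _].
  exact: (one_ruling arc_g cardI tI I4 hA UA RA (mS R RA) (nS R RA)).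
have ne R e R' e' : (R, e) \in [set x in setX A setT | a (Y x) == z] ->
    (R', e') \in [set x in setX A setT | a (Y x) == z] -> (R, e) != (R', e') -> R != R'.
  move=> h1 h2; apply: contra => /eqP RR; move: h1 h2; rewrite -RR.
  by case: e e' => [] [] h1 h2; rewrite ?eqxx //; case: (one R).
have inA p : p \in [set x in setX A setT | a (Y x) == z] -> p.1 \in A.
  by case: p => R e; rewrite in_set in_setX => /andP[/andP[]].
have mixed R S V e : (R, e) \in [set x in setX A setT | a (Y x) == z] ->
   (S, e) \in [set x in setX A setT | a (Y x) == z] ->
   (V, ~~ e) \in [set x in setX A setT | a (Y x) == z] -> R != S -> False.
  move=> h1 h2 h3 RS.
  have RV : R != V by apply: (ne _ _ _ _ h1 h3); rewrite xpair_eqE; case: e {h1 h2 h3}; rewrite andbF.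
  have SV : S != V by apply: (ne _ _ _ _ h2 h3); rewrite xpair_eqE; case: e {h1 h2 h3}; rewrite andbF.
  have RA : R \in A := inA _ h1; have SA : S \in A := inA _ h2; have VA : V \in A := inA _ h3.
  have l1 := sl _ _ h3 h1; have l2 := sl _ _ h3 h2.
  case: e h1 h2 h3 l1 l2 => h1 h2 h3 l1 l2; rewrite /Y /= in l1 l2.
    apply: (two_and_one I4 hA' UA RA SA VA RS RV SV (m := n R) (n := n S) (p := m V)).
    - by rewrite -mlineS; apply/special_swap/nS.
    - by rewrite -mlineS; apply/special_swap/nS.
    - by rewrite -llineS; apply/special_swap/mS.
    - by rewrite -llineS -mlineS; apply: same_lineS.
    - by rewrite -llineS -mlineS; apply: same_lineS.
  exact: (two_and_one I4 hA UA RA SA VA RS RV SV (mS R RA) (mS S SA) (nS V VA) l1 l2).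
case: p1 p2 p3 p1G p2G p3G p12 p23 p31 => [R e1] [S e2] [V e3] h1 h2 h3 p12 p23 p31.
have RS := ne _ _ _ _ h1 h2 p12; have SV := ne _ _ _ _ h2 h3 p23.
have VR := ne _ _ _ _ h3 h1 p31; have RV : R != V by rewrite eq_sym.
have RA : R \in A := inA _ h1; have SA : S \in A := inA _ h2; have VA : V \in A := inA _ h3.
have l1 := sl _ _ h2 h1; have l2 := sl _ _ h3 h1.
have [E12 E13] : e1 = e2 /\ e1 = e3.
  case: e1 e2 e3 h1 h2 h3 {p12 p23 p31 l1 l2} => [] [] [] // h1 h2 h3; exfalso.
  - exact: (mixed R S V true).
  - exact: (mixed R V S true).
  - exact: (mixed S V R false).
  - exact: (mixed S V R true).
  - exact: (mixed R V S false).
  - exact: (mixed R S V false).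
move: l1 l2; rewrite -E12 -E13 /Y /=; case: e1 {p12 p23 p31 h1 h2 h3 E12 E13} => l1 l2.
  have [||||| k [c0 [b0 [k0 gU sU]]]] := three_mlines I4 gQ' sQ1' sQ2' hA' UQ RA SA VA RS RV SV
     (m := n R) (n := n S) (p := n V).
  - by rewrite -mlineS; apply/special_swap/nS.
  - by rewrite -mlineS; apply/special_swap/nS.
  - by rewrite -mlineS; apply/special_swap/nS.
  - by rewrite -!mlineS; apply: same_lineS.
  - by rewrite -!mlineS; apply: same_lineS.
  apply: (@second_ruling k b0 c0 U UA k0).
    by rewrite -[g U]swap4K -[swap4 (g U)]/(g' U) gU swap4Z swap4_qpt.
  by left; apply: special_swapV; rewrite swap4_vec.
have [k [b0 [c0 [k0 gU sU]]]] := three_mlines I4 gQ sQ1 sQ2 hA UQ RA SA VA RS RV SV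
     (mS R RA) (mS S SA) (mS V VA) l1 l2.
by apply: (second_ruling UA k0 gU); right.
Qed.
End Ruling.
End Rulings.

(** * Changes of coordinates *)

Section Coordinates.
Variable F : finFieldType.
Hypothesis ch2 : 2%N \in [pchar F].
Local Notation oppF := (oppF ch2).
Local Notation C12 := (det4C12 ch2).
Local Notation C23 := (det4C23 ch2).
Local Notation C34 := (det4C34 ch2).

Lemma det4_det (A : 'M[F]_4) : \det A = det4 (row (@Ordinal 4 0 isT) A) (row (@Ordinal 4 1 isT) A)
  (row (@Ordinal 4 2 isT) A) (row (@Ordinal 4 3 isT) A).
Proof.
pose f i j := A (inord i) (inord j).
have fE i j : A i j = f i j by rewrite /f !inord_val.
rewrite /det4 !mxE !fE /=.
do 3 rewrite !(expand_det_row _ ord0) ?big_ord_recl ?big_ord0 /cofactor.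
rewrite !det_mx11 !mxE !fE /= /bump /=.
ring.
Qed.

Definition mat4 (u v w x : 'rV[F]_4) : 'M[F]_4 := \matrix_(i, j) ([:: u; v; w; x]`_i) ord0 j.

Lemma det_mat4 u v w x : \det (mat4 u v w x) = det4 u v w x.
Proof. by rewrite det4_det; congr det4; apply/rowP => j; rewrite !mxE. Qed.

Lemma mat4_mul u v w x (M : 'M[F]_4) : mat4 u v w x *m M = mat4 (u *m M) (v *m M) (w *m M) (x *m M).
Proof.
apply/matrixP => i j; rewrite !mxE; elim/ord4P: i; rewrite /= mxE;
  by apply: eq_bigr => k _; rewrite !mxE.
Qed.

Lemma det4_mul u v w x (M : 'M[F]_4) :
  det4 (u *m M) (v *m M) (w *m M) (x *m M) = det4 u v w x * \det M.
Proof. by rewrite -!det_mat4 -mat4_mul det_mulmx. Qed.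

Lemma basis_change (e0 e1 e2 e3 : 'rV[F]_4) : det4 e0 e1 e2 e3 != 0 -> exists M : 'M[F]_4,
  [/\ M \in unitmx, e0 *m M = vec4 1 0 0 0, e1 *m M = vec4 0 1 0 0,
      e2 *m M = vec4 0 0 1 0 & e3 *m M = vec4 0 0 0 1].
Proof.
rewrite -det_mat4 => D0; pose E := mat4 e0 e1 e2 e3.
have Eu : E \in unitmx by rewrite unitmxE unitfE.
have rE i : row i (E *m invmx E) = ([:: e0; e1; e2; e3]`_i) *m invmx E.
  by rewrite row_mul; congr (_ *m _); apply/rowP => j; rewrite !mxE.
exists (invmx E); rewrite unitmx_inv; split=> //.
- rewrite -(rE (@Ordinal 4 0 isT)) mulmxV // row1.
  by apply/rowP; apply: ord4P; rewrite !mxE.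
- rewrite -(rE (@Ordinal 4 1 isT)) mulmxV // row1.
  by apply/rowP; apply: ord4P; rewrite !mxE.
- rewrite -(rE (@Ordinal 4 2 isT)) mulmxV // row1.
  by apply/rowP; apply: ord4P; rewrite !mxE.
- rewrite -(rE (@Ordinal 4 3 isT)) mulmxV // row1.
  by apply/rowP; apply: ord4P; rewrite !mxE.
Qed.

Section Change.
Variables (I : finType) (g : I -> 'rV[F]_4) (k : I -> F) (M : 'M[F]_4).
Hypotheses (k0 : forall R, k R != 0) (Mu : M \in unitmx).
Definition change R := k R *: (g R *m M).
Let dM : \det M != 0. Proof. by rewrite -unitfE -unitmxE. Qed.
Lemma arc4_change : arc4 g -> arc4 change.
Proof.
by move=> H i j l m *; rewrite /change !det4E det4_mul !mulf_neq0 // H.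
Qed.
Lemma special_change P N : special g P N -> special change P (N *m M).
Proof. by move=> H R S *; rewrite /change !det4E det4_mul !mulf_neq0 // H. Qed.
Lemma special_changeV P N : special change P (N *m M) -> special g P N.
Proof.
move=> H R S RP SP RS; have := H R S RP SP RS.
by rewrite /change !det4E det4_mul !mulf_eq0 !negb_or => /and5P[].
Qed.
Lemma noext_change : (forall X, exists U, ~ special g U X) ->
  forall X, exists U, ~ special change U X.
Proof.
move=> H X; have [U nU] := H (X *m invmx M); exists U => sU; apply: nU.
by apply: special_changeV; rewrite mulmxKV.
Qed.
End Change.

Lemma cramer_span (u v w x z : 'rV[F]_4) : det4 u v w x != 0 ->
  exists a b c d, z = (a *: u + b *: v) + (c *: w + d *: x).
Proof.
move=> D0; exists (det4 z v w x / det4 u v w x), (det4 u z w x / det4 u v w x),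
  (det4 u v z x / det4 u v w x), (det4 u v w z / det4 u v w x).
apply: (scalerI D0); rewrite cramer4 !scalerDr !scalerA !addrA.
by congr (_ *: _ + _ *: _ + _ *: _ + _ *: _); field.
Qed.

Section Lines.
Variables (p1 n1 p2 n2 p3 n3 : 'rV[F]_4).
Hypotheses (D12 : det4 p1 n1 p2 n2 != 0) (D13 : det4 p1 n1 p3 n3 != 0)
  (D23 : det4 p2 n2 p3 n3 != 0).

(** p1 and n1 are sums of a vector of the second line and a vector of the third one. The
    summands on the second line complete p1, n1 to a basis in which the three lines are
    lines of one ruling of the quadric x0 x3 = x1 x2. *)
Lemma regulus_coordinates : exists M : 'M[F]_4, [/\ M \in unitmx, p1 *m M = vec4 1 0 0 0,
  n1 *m M = vec4 0 1 0 0,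
  forall a b, exists z w, (a *: n2 + b *: p2) *m M = vec4 0 0 z w &
  forall a b, exists z w, (a *: n3 + b *: p3) *m M = vec4 z w z w].
Proof.
have [x [y [z [w e1]]]] := cramer_span p1 D23.
have [x' [y' [z' [w' e2]]]] := cramer_span n1 D23.
pose f2 := - (x *: p2 + y *: n2); pose f3 := - (x' *: p2 + y' *: n2).
have e1' : p1 + f2 = z *: p3 + w *: n3 by rewrite /f2 {1}e1 addrAC addrN add0r.
have e2' : n1 + f3 = z' *: p3 + w' *: n3 by rewrite /f3 {1}e2 addrAC addrN add0r.
have e1f : f2 = z *: p3 + w *: n3 + (-1) *: p1 by rewrite -e1' scaleN1r addrAC addrN add0r.
have e2f : f3 = z' *: p3 + w' *: n3 + (-1) *: n1 by rewrite -e2' scaleN1r addrAC addrN add0r.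
have zw : z * w' - w * z' != 0.
  have : det4 p2 n2 p1 n1 != 0 by rewrite C23 C12 C34 C23.
  apply: contra => /eqP zw; apply/eqP; rewrite e1 e2 !det4E !(mulr0, addr0, add0r).
  rewrite [det4 p2 n2 n3 p3]C34.
  transitivity ((z * w' - w * z') * det4 p2 n2 p3 n3 + (w * z' + w * z') * det4 p2 n2 p3 n3).
    by ring.
  by rewrite zw (addF ch2) !mul0r addr0.
have D0 : det4 p1 n1 f2 f3 != 0.
  have -> : det4 p1 n1 f2 f3 = (z * w' - w * z') * det4 p1 n1 p3 n3.
    rewrite e1f e2f !det4E !(mulr0, addr0, add0r) [det4 p1 n1 n3 p3]C34.
    transitivity ((z * w' - w * z') * det4 p1 n1 p3 n3 + (w * z' + w * z') * det4 p1 n1 p3 n3).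
      by ring.
    by rewrite (addF ch2) !mul0r addr0.
  by rewrite mulf_neq0.
have [M [Mu h0 h1 h2 h3]] := basis_change D0.
exists M; split=> // a b.
  pose v := a *: n2 + b *: p2.
  have : det4 (v *m M) (n1 *m M) (f2 *m M) (f3 *m M) = 0.
    by rewrite det4_mul /v /f2 /f3 -!scaleN1r !det4E !(mulr0, addr0, add0r, mul0r).
  have : det4 (p1 *m M) (v *m M) (f2 *m M) (f3 *m M) = 0.
    by rewrite det4_mul /v /f2 /f3 -!scaleN1r !det4E !(mulr0, addr0, add0r, mul0r).
  rewrite h0 h1 h2 h3 [v *m M]vec4E; set v0 := _ (@Ordinal 4 0 isT); set v1 := _ (@Ordinal 4 1 isT).
  rewrite /det4 !mxE /= => E1 E0.
  have v00 : v0 = 0 by rewrite -[RHS]E0; ring.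
  have v10 : v1 = 0 by rewrite -[RHS]E1; ring.
  by rewrite v00 v10; eexists _, _; reflexivity.
pose v := a *: n3 + b *: p3.
have : det4 (v *m M) (n1 *m M) ((p1 + f2) *m M) ((n1 + f3) *m M) = 0.
  by rewrite det4_mul /v e1' e2' !det4E !(mulr0, addr0, add0r, mul0r).
have : det4 (v *m M) (p1 *m M) ((p1 + f2) *m M) ((n1 + f3) *m M) = 0.
  by rewrite det4_mul /v e1' e2' !det4E !(mulr0, addr0, add0r, mul0r).
rewrite (mulmxDl p1) (mulmxDl n1) h0 h1 h2 h3 [v *m M]vec4E.
set v0 := _ (@Ordinal 4 0 isT); set v1 := _ (@Ordinal 4 1 isT).
set v2 := _ (@Ordinal 4 2 isT); set v3 := _ (@Ordinal 4 3 isT).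
rewrite /det4 !mxE /= => E1 E0.
have v20 : v2 = v0.
  by apply/eqP; rewrite -subr_eq0 -[_ - _]oppF; apply/eqP; rewrite -[RHS]E0; ring.
have v31 : v3 = v1.
  by apply/eqP; rewrite -subr_eq0; apply/eqP; rewrite -[RHS]E1; ring.
by exists v0, v1; rewrite v20 v31.
Qed.
End Lines.
End Coordinates.

(** * An arc in space with no extension lies on a quadric *)

Section Quadric.
Variable F : finFieldType.
Hypothesis ch2 : 2%N \in [pchar F].
Local Notation oppF := (oppF ch2).
Local Notation C12 := (det4C12 ch2).
Local Notation C23 := (det4C23 ch2).
Local Notation C34 := (det4C34 ch2).
Local Notation e0 := (vec4 1 0 0 0 : 'rV[F]_4).
Local Notation e1 := (vec4 0 1 0 0 : 'rV[F]_4).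
Local Notation e2 := (vec4 0 0 1 0 : 'rV[F]_4).

Lemma special_not_point (I : finType) (g : I -> 'rV[F]_4) P N k : (3 < #|I|)%N ->
  special g P N -> N <> k *: g P.
Proof.
move=> I4 sN E0.
have [X] := third_point I4 (s := [:: P]) isT; rewrite !inE => XU.
have [Y] := third_point I4 (s := [:: P; X]) isT; rewrite !inE negb_or => /andP[YU YX].
have : det4 (g P) N (g X) (g Y) != 0 by apply: sN; rewrite // eq_sym.
by rewrite E0 !det4E mulr0 eqxx.
Qed.

Section Space.
Variables (I : finType) (g : I -> 'rV[F]_4) (t : nat).
Hypotheses (arc_g : arc4 g) (cardI : (#|I| + t = #|F| + 3)%N)
  (tq : (t * t.-1 < #|F|)%N) (tI : (t.+1 < #|I|)%N) (I4 : (3 < #|I|)%N) (t0 : (0 < t)%N).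

(** The planes through P, R and another point exclude at most #|I| - 3 < q of the points
    g K + x g J; any other one is, seen from P, on a tangent at R. *)
Lemma special_exists P : exists N, special g P N.
Proof.
have [R] := third_point I4 (s := [:: P]) isT; rewrite !inE => RP.
have [J] := third_point I4 (s := [:: P; R]) isT; rewrite !inE negb_or => /andP[JP JR].
have [K] := third_point I4 (s := [:: P; R; J]) isT; rewrite !inE !negb_or => /and3P[KP KR KJ].
pose l S := det4 (g P) (g R) (g K) (g S) / det4 (g P) (g R) (g J) (g S).
pose T := ~: [set P; R; J].
have cT : #|T| = (#|I| - 3)%N.
  rewrite cardsCs setCK; congr (_ - _)%N.
  by rewrite setUC cardsU1 cards2 !inE negb_or JP JR eq_sym RP.
have [x xl] : exists x, x \notin [set l S | S in T].
  have : (0 < #|~: [set l S | S in T]|)%N.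
    rewrite card_complF subn_gt0; apply: leq_ltn_trans (leq_imset_card _ _) _.
    by rewrite cT; move: cardI I4 t0; clear; lia.
  by case/card_gt0P => x; rewrite inE; exists x.
have [S SP SR|y sy] := special_tangent ch2 arc_g cardI tq I4 RP (y := g K + x *: g J).
  rewrite !det4E; case: (S =P J) => [->|/eqP SJ].
    by rewrite det4_34 mulr0 addr0; apply: arc_g; rewrite // eq_sym.
  have D0 : det4 (g P) (g R) (g J) (g S) != 0 by apply: arc_g; rewrite // eq_sym.
  apply: contra xl; rewrite addr_eq0 oppF => /eqP E; apply/imsetP; exists S.
    by rewrite !inE !negb_or SP SR.
  by rewrite /l E mulfK.
by exists (g K + x *: g J + y *: g R).
Qed.

(** The argument of other_ruling, at the point of the quadric that is not of the form
    qpt b c. *)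
Lemma second_at_base Q (A : {set I}) (b c : I -> F) : g Q = e0 -> special g Q e1 ->
  {in A, forall R, [/\ g R = qpt (b R) (c R), special g R (vec4 (c R) 1 0 0) &
     special g R (vec4 (b R) 0 1 0)]} -> (t <= #|A|)%N -> special g Q e2.
Proof.
move=> gQ sQ hA tA.
have AQ R : R \in A -> Q != R.
  move=> RA; apply: contraTneq (isT) => QR; exfalso; have [gR _ _] := hA R RA.
  move: gR; rewrite -QR gQ => /vec4_inj[_ _ _ /eqP].
  by rewrite eq_sym oner_eq0.
have /fin_all_exists [m mE] : forall R, exists m, R \in A ->
    special g Q (vec4 (b R) 0 1 0 + m *: g R).
  move=> R; case: (boolP (R \in A)) => [RA|_]; last by exists 0.
  have [_ _ sR] := hA R RA.
  by have [m sm] := special_match ch2 arc_g cardI tq I4 sR (AQ R RA); exists m.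
pose Y R := vec4 (b R) 0 1 0 + m R *: g R.
have YE R : R \in A -> Y R = lline b c R (m R) by move=> RA; rewrite -(llineE hA).
have [a [B [cB [aB aE]]]] := special_code ch2 arc_g cardI tI I4 Q.
have codes : {in A, forall R, a (Y R) \in B :\ a e1}.
  move=> R RA; rewrite in_setD1 aB ?andbT; last exact: mE.
  apply/eqP => E; have [k [l]] := aE _ _ sQ (mE R RA) (esym E).
  rewrite -/(Y R) (YE R RA) gQ !vec4Z vec4D => /vec4_inj[_ _ E2 E3].
  move: E2; rewrite E3 !(mulr0, mul0r, addr0) => /eqP.
  by rewrite oner_eq0.
have [R [S [RA SA RS E]]] : exists R S, [/\ R \in A, S \in A, R != S & a (Y R) = a (Y S)].
  apply: collision codes _; rewrite (cardsD1 (a e1) B) aB // in cB.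
  by move: cB tA t0; clear; lia.
have [k [l eY]] := aE _ _ (mE S SA) (mE R RA) (esym E).
have [gR sR1 sR2] := hA R RA; have [gS _ _] := hA S SA.
have bRS : b R != b S.
  apply/eqP => bb; apply: (@special_out _ _ _ I4 R _ S 1 1 (c S - c R) sR2 _ (oner_neq0 _)).
    by rewrite eq_sym.
  by rewrite gS gR /qpt !vec4Z vec4D bb; congr vec4; ring.
move: eY; rewrite -/(Y R) -/(Y S) (YE R RA) (YE S SA) gQ !vec4Z vec4D => /vec4_inj[E0 E1 E2 E3].
have m0 : m R = 0.
  have d : b R - b S != 0 by rewrite subr_eq0.
  apply: (mulIf d); rewrite mul0r mulrBr [m R * b R]mulrC E1 E3; ring.
have sY := mE R RA; rewrite -/(Y R) (YE R RA) /lline m0 !(mul0r, mulr0, addr0, mulr1) in sY.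
apply: (special_comb (l := - b R) sY (oner_neq0 _)).
by rewrite gQ !vec4Z vec4D; congr vec4; ring.
Qed.

End Space.

Section Chart.
Variables (I : finType) (g : I -> 'rV[F]_4) (t : nat).
Hypotheses (arc_g : arc4 g) (cardI : (#|I| + t = #|F| + 3)%N)
  (tq : (t * t.-1 < #|F|)%N) (tI : (t.+1 < #|I|)%N) (I4 : (3 < #|I|)%N) (t0 : (0 < t)%N).
Hypothesis noext : forall X, exists U, ~ special g U X.
Hypothesis t3q : (t ^ 3 <= #|F|)%N.

(** Let the lines of three_lines be lines of one ruling. For R in A the special line at R
    meets all three, so it is a line of the other ruling and R is on the quadric; then
    other_ruling gives the second line at R, and all_ruled treats the other points. *)
Lemma hyperbolic_chart Q : exists (M : 'M[F]_4) (k b c : I -> F),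
  [/\ M \in unitmx, forall R, k R != 0, change g k M Q = e0,
     special (change g k M) Q e1 /\ special (change g k M) Q e2 &
     forall U, U != Q -> [/\ change g k M U = qpt (b U) (c U),
        special (change g k M) U (vec4 (c U) 1 0 0) &
        special (change g k M) U (vec4 (b U) 0 1 0)]].
Proof.
have [N1 sN1] := special_exists arc_g cardI tq I4 t0 Q.
have [P2] := third_point I4 (s := [:: Q]) isT; rewrite !inE eq_sym => QP2.
have [P3] := third_point I4 (s := [:: Q; P2]) isT; rewrite !inE negb_or => /andP[P3Q P3P2].
rewrite eq_sym in P3Q; rewrite eq_sym in P3P2.
have [N2 [N3 [A [tA [sN2 sN3] [D12 D13 D23] hA]]]] :=
  three_lines ch2 arc_g cardI tq tI I4 noext t0 t3q QP2 P3Q P3P2 sN1.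
have [M [Mu M1 M2 M3 M4]] := regulus_coordinates ch2 D12 D13 D23.
pose h1 := change g (fun=> 1) M.
have one0 (R : I) : (fun=> 1 : F) R != 0 by rewrite oner_neq0.
have arc1 := arc4_change one0 Mu arc_g.
have h1E R : h1 R = g R *m M by rewrite /h1 /change scale1r.
have sp1 P N : special g P N -> special h1 P (N *m M) := @special_change _ _ g _ M one0 Mu P N.
have /fin_all_exists [kbc kE] : forall R, exists x : F * F * F, R \in A ->
   [/\ x.1.1 != 0, h1 R = x.1.1 *: qpt x.1.2 x.2 & special h1 R (vec4 x.2 1 0 0)].
  move=> R; case: (boolP (R \in A)) => [RA|_]; last by exists (0, 0, 0).
  have [_ [l [m [n [sR [a [b' Em]] [a' [b'' En]]]]]]] := hA R RA.
  have sX : special h1 R (vec4 l 1 0 0).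
    by have := sp1 _ _ sR; rewrite mulmxDl -scalemxAl M1 M2 vec4Z vec4D !(mulr0, mulr1, addr0, add0r).
  have EX : (N1 + l *: g Q) *m M = vec4 l 1 0 0.
    by rewrite mulmxDl -scalemxAl M1 M2 vec4Z vec4D !(mulr0, mulr1, addr0, add0r).
  have [z [w zw]] := M3 a b'; have [z' [w' zw']] := M4 a' b''.
  have Fm : vec4 l 1 0 0 + m *: h1 R = vec4 0 0 z w.
    by rewrite -zw -Em mulmxDl -scalemxAl EX h1E.
  have Fn : vec4 l 1 0 0 + n *: h1 R = vec4 z' w' z' w'.
    by rewrite -zw' -En mulmxDl -scalemxAl EX h1E.
  move: Fm Fn; rewrite [h1 R]vec4E.
  set r0 := _ (@Ordinal 4 0 isT); set r1 := _ (@Ordinal 4 1 isT).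
  set r2 := _ (@Ordinal 4 2 isT); set r3 := _ (@Ordinal 4 3 isT).
  rewrite !vec4Z !vec4D => /vec4_inj[F0 F1 F2 F3] /vec4_inj[G0 G1 G2 G3].
  have r1m : m * r1 = -1 by apply/eqP; rewrite -addr_eq0 addrC F1.
  have m0 : m != 0 by apply: contraTneq (oner_neq0 F) => m0; rewrite -oppr_eq0 -r1m m0 mul0r eqxx.
  have r10 : r1 != 0 by apply: contraTneq (oner_neq0 F) => r10; rewrite -oppr_eq0 -r1m r10 mulr0 eqxx.
  have r0E : r0 = l * r1.
    apply: (mulfI m0); rewrite mulrCA r1m mulrN1; apply/eqP.
    by rewrite -addr_eq0 addrC F0.
  have n0 : n != 0.
    apply: contraTneq (oner_neq0 F) => n0.
    by move: G1; rewrite -G3 n0 !mul0r !addr0 => ->; rewrite eqxx.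
  have r2E : r2 = l * r3.
    apply: (mulfI n0); move: G0 G1; rewrite -G2 -G3 !add0r r0E => <- G1'.
    by rewrite [RHS]mulrCA -G1'; ring.
  have r30 : r3 != 0.
    apply/eqP => r30; apply: (special_not_point I4 sX (k := r1^-1)).
    by rewrite -/h1 [h1 R]vec4E -/r0 -/r1 -/r2 -/r3 r2E r0E r30 vec4Z; congr vec4; field.
  exists (r3, r1 / r3, l); split=> //=.
  by rewrite r2E r0E /qpt vec4Z; congr vec4; field.
pose k R := if R \in A then (kbc R).1.1^-1 else 1.
pose b R := (kbc R).1.2; pose c R := (kbc R).2.
have k0 R : k R != 0.
  rewrite /k; case: ifP => RA; last exact: oner_neq0.
  by have [x0 _ _] := kE R RA; rewrite invr_neq0.
pose h := change g k M.
have arch := arc4_change k0 Mu arc_g.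
have hE R : h R = k R *: h1 R by rewrite h1E.
have spk P N : special h1 P N -> special h P N.
  move=> H R S RP SP RS; have := H R S RP SP RS.
  by rewrite !hE !det4E !mulf_eq0 !negb_or !k0.
have QA : Q \notin A by apply/negP => /hA[[]]; rewrite eqxx.
have hQ : h Q = e0 by rewrite hE /k (negbTE QA) scale1r h1E M1.
have sQ1 : special h Q e1 by apply: spk; rewrite -M2; apply: sp1.
have hAc : {in A, forall R, h R = qpt (b R) (c R) /\ special h R (vec4 (c R) 1 0 0)}.
  move=> R RA; have [x0 gR sR] := kE R RA; split; last exact: spk.
  by rewrite hE /k RA gR scalerA mulVf // scale1r.
have hAbc : {in A, forall R, [/\ h R = qpt (b R) (c R), special h R (vec4 (c R) 1 0 0) &
     special h R (vec4 (b R) 0 1 0)]}.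
  move=> R RA; have [gR sR] := hAc R RA; split=> //.
  apply: (other_ruling ch2 arch cardI tq tI I4 (U := R) (k0 := 1) (A := A :\ R) (oner_neq0 _) _ sR (b := b) (c := c)) => //.
  - by rewrite scale1r.
  - by move: tA; rewrite (cardsD1 R A) RA.
  - by rewrite !inE eqxx.
  - by move=> S; rewrite in_setD1 => /andP[_ /hAc].
have sQ2 : special h Q e2.
  by apply: (second_at_base arch cardI tq tI I4 t0 hQ sQ1 hAbc) => //; apply: ltnW.
have /fin_all_exists [x xE] : forall U, exists x : F * F * F, [/\ x.1.1 != 0,
    U = Q -> x.1.1 = 1 & U != Q -> [/\ h U = x.1.1 *: qpt x.1.2 x.2,
    special h U (vec4 x.2 1 0 0) & special h U (vec4 x.1.2 0 1 0)]].
  move=> U; case: (eqVneq U Q) => [->|UQ].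
    by exists (1, 0, 0); split; rewrite ?oner_neq0.
  have [k' [b' [c' [k'0 hU s1 s2]]]] :=
    all_ruled ch2 arch cardI tq tI I4 hQ sQ1 sQ2 hAbc tA t0 UQ.
  by exists (k', b', c'); split=> // UQ'; rewrite UQ' eqxx in UQ.
pose k' R := (x R).1.1^-1 * k R.
have h'E R : change g k' M R = (x R).1.1^-1 *: h R by rewrite /change scalerA.
have sp' P N : special h P N -> special (change g k' M) P N.
  move=> H R S RP SP RS; have := H R S RP SP RS.
  have x0 T : (x T).1.1^-1 != 0 by rewrite invr_eq0; have [] := xE T.
  by rewrite !h'E !det4E !mulf_eq0 !negb_or !x0.
exists M, k', (fun R => (x R).1.2), (fun R => (x R).2); split=> //.
- by move=> R; rewrite mulf_neq0 ?invr_neq0 //; have [] := xE R.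
- by rewrite h'E hQ; have [_ /(_ erefl) -> _] := xE Q; rewrite invr1 scale1r.
- by split; apply: sp'.
- move=> U UQ; have [x0 _ /(_ UQ)[hU s1 s2]] := xE U; split; try exact: sp'.
  by rewrite h'E hU scalerA mulVf // scale1r.
Qed.
End Chart.
End Quadric.

(** * Its deficiency is two *)

Section DeficiencyTwo.
Variable F : finFieldType.
Hypothesis ch2 : 2%N \in [pchar F].
Local Notation oppF := (oppF ch2).
Local Notation C12 := (det4C12 ch2).
Local Notation C23 := (det4C23 ch2).
Local Notation C34 := (det4C34 ch2).
Local Notation e0 := (vec4 1 0 0 0 : 'rV[F]_4).
Local Notation e1 := (vec4 0 1 0 0 : 'rV[F]_4).
Local Notation e2 := (vec4 0 0 1 0 : 'rV[F]_4).

Section Maximal.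
Variables (I : finType) (g : I -> 'rV[F]_4) (t : nat).
Hypotheses (arc_g : arc4 g) (cardI : (#|I| + t = #|F| + 3)%N)
  (tq : (t * t.-1 < #|F|)%N) (tI : (t.+1 < #|I|)%N) (I4 : (3 < #|I|)%N) (t0 : (0 < t)%N).
Hypothesis noext : forall X, exists U, ~ special g U X.
Variables (Q : I) (b c : I -> F).
Hypotheses (gQ : g Q = e0) (sQ1 : special g Q e1) (sQ2 : special g Q e2)
  (hU : forall U, U != Q -> [/\ g U = qpt (b U) (c U), special g U (vec4 (c U) 1 0 0) &
        special g U (vec4 (b U) 0 1 0)]).

Lemma c_inj : {in [set~ Q] &, injective c}.
Proof.
move=> R S; rewrite !inE => RQ SQ cc; apply: contraTeq (isT) => RS.
have [gR sR _] := hU RQ; have [gS _ _] := hU SQ.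
have /eqP[] // : c R != c S.
by apply: (@chart_neq _ _ _ I4 _ _ (b S) _ 1 _ S gR _ _ sR); rewrite ?scale1r // eq_sym.
Qed.

Lemma b_inj : {in [set~ Q] &, injective b}.
Proof.
move=> R S; rewrite !inE => RQ SQ bb; apply: contraTeq (isT) => RS; exfalso.
have [gR _ sR] := hU RQ; have [gS _ _] := hU SQ.
apply: (@special_out _ _ _ I4 R _ S 1 1 (c S - c R) sR _ (oner_neq0 _)); first by rewrite eq_sym.
by rewrite gS gR /qpt !vec4Z vec4D bb; congr vec4; ring.
Qed.

(** On the line of (cs, 1, 0, 0) and (b R, 0, 1, 0) special_second finds a special point at
    R other than the second one. Seen from R it is a point of the line c = cs of the
    quadric. It is not on the other line through a point S of the arc, as otherwise S
    would be in the plane of two special lines at R. *)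
Lemma missing_special cs : cs \notin [set c U | U in [set~ Q]] ->
  forall R, R != Q -> exists a, a \notin [set b U | U in [set~ Q]] /\ special g R (qpt a cs).
Proof.
move=> csn R RQ; have [gR s1 s2] := hU RQ.
have cne U : U != Q -> cs - c U != 0.
  by move=> UQ; rewrite subr_eq0; apply: contraNneq csn => ->; rewrite imset_f // !inE.
have [S SR|l sl] := special_second ch2 arc_g cardI tq I4 s2 (y := vec4 cs 1 0 0).
  case: (eqVneq S Q) => [->|SQ].
    rewrite gR gQ; have -> : det4 (qpt (b R) (c R)) (vec4 (b R) 0 1 0) (vec4 cs 1 0 0) e0 = 1.
      by rewrite /det4 !mxE /=; ring.
    exact: oner_neq0.
  have [gS _ _] := hU SQ; rewrite gR gS.
  have -> : det4 (qpt (b R) (c R)) (vec4 (b R) 0 1 0) (vec4 cs 1 0 0) (qpt (b S) (c S))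
     = (b R - b S) * (cs - c S).
    by rewrite /det4 !mxE /=; ring.
  rewrite mulf_neq0 ?cne // subr_eq0; apply: contraNneq SR => /b_inj -> //; by rewrite !inE.
rewrite vec4Z vec4D !(mulr0, mulr1, addr0, add0r) in sl.
have d := cne R RQ.
pose nu := l / (cs - c R).
have sY : special g R (vec4 ((1 + nu * b R) * cs) (1 + nu * b R) (nu * cs) nu).
  apply: (special_comb (l := nu) sl (oner_neq0 _)).
  by rewrite gR /qpt !vec4Z vec4D /nu; congr vec4; field.
have l0 : l != 0.
  apply/eqP => l0; rewrite l0 mul0r addr0 in sl.
  have E x : vec4 x 1 0 0 = e1 + x *: g Q.
    by rewrite gQ vec4Z vec4D; congr vec4; ring.
  rewrite (E (c R)) in s1; rewrite (E cs) in sl; have := special_match_inj ch2 arc_g cardI tI I4 sQ1 RQ s1 sl.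
  by move=> cc; rewrite cc subrr eqxx in d.
have nu0 : nu != 0 by rewrite mulf_neq0 ?invr_neq0.
pose a := (1 + nu * b R) / nu.
have sa : special g R (qpt a cs).
  apply: (special_comb (k := nu^-1) (l := 0) sY); first by rewrite invr_neq0.
  by rewrite scale0r addr0 /qpt vec4Z /a; congr vec4; field.
exists a; split=> //; apply/imsetP => -[S]; rewrite !inE => SQ ab.
have [gS _ _] := hU SQ.
case: (eqVneq S R) => [SR|SR].
  have : nu * a = nu * b R by rewrite ab SR.
  rewrite /a mulrCA mulfV // mulr1 => /eqP; rewrite -subr_eq0 addrK.
  by rewrite oner_eq0.
have D0 : det4 (g R) (g S) (qpt a cs) (vec4 (c R) 1 0 0) = 0.
  by rewrite gR gS ab /det4 !mxE /=; ring.
have [x [y]] := special_unique ch2 arc_g cardI tI I4 SR sa s1 D0.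
rewrite gR /qpt !vec4Z vec4D => /vec4_inj[E0 E1 E2 E3].
have x0 : x = 0.
  apply: (mulIf d); rewrite mul0r.
  have -> : x * (cs - c R) = (x * cs + y * c R) - (x * 1 + y * 1) * c R by ring.
  by rewrite -E2 -E3 mul0r subrr.
move: E1; rewrite x0 !mul0r !add0r in E3 *; rewrite mulr1 in E3; rewrite -E3 mul0r => /eqP.
by rewrite oner_eq0.
Qed.

(** t = 1 is impossible because b is injective. If t > 2, some value cs is not taken by c.
    Every R then has a special point qpt a cs, with a among the t - 2 values that b does
    not take; some a occurs for more than t points R, against few_specials. *)
Lemma deficiency_2 : (t ^ 3 <= #|F|)%N -> t = 2%N.
Proof.
move=> t3q.
have cJ : #|[set~ Q]| = #|I|.-1 by rewrite cardsC1.
have cb : #|[set b U | U in [set~ Q]]| = #|I|.-1 by rewrite card_in_imset //; apply: b_inj.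
have cc : #|[set c U | U in [set~ Q]]| = #|I|.-1 by rewrite card_in_imset //; apply: c_inj.
have le : (#|I|.-1 <= #|F|)%N by rewrite -cb max_card.
apply/eqP; case: (ltngtP t 2) => // lt.
  by move: lt le cardI t0 I4; clear; lia.
have [cs csn] : exists cs, cs \notin [set c U | U in [set~ Q]].
  have : (0 < #|~: [set c U | U in [set~ Q]]|)%N.
    by rewrite card_complF cc; move: lt cardI I4; clear; lia.
  by case/card_gt0P => x; rewrite inE; exists x.
have /fin_all_exists [a aE] : forall R, exists a, R != Q ->
    a \notin [set b U | U in [set~ Q]] /\ special g R (qpt a cs).
  move=> R; case: (eqVneq R Q) => [|RQ]; first by exists 0.
  by have [a aE] := missing_special csn RQ; exists a.
have [R RQ||z _ zE] := @pigeonhole _ _ [set~ Q] (~: [set b U | U in [set~ Q]]) a t.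
- by rewrite inE; have [] // := aE R; move: RQ; rewrite !inE.
- rewrite card_complF cb cJ; move: lt cardI I4 t3q; clear.
  rewrite !expnS expn0 muln1; move: #|F| #|I| => q n lt hI h4 hq.
  have : (t * 3 <= t * t)%N by rewrite leq_mul2l lt orbT.
  have : (t * t * 3 <= t * (t * t))%N by rewrite mulnA leq_mul2l lt orbT.
  nia.
have sp : {in [set x in [set~ Q] | a x == z], forall R, special g R (qpt z cs)}.
  move=> R; rewrite !inE => /andP[RQ /eqP <-].
  by have [] := aE R RQ.
have := few_specials ch2 arc_g cardI tq tI I4 noext sp.
by rewrite leqNgt zE.
Qed.
End Maximal.
End DeficiencyTwo.

(** * There is no arc of q + 3 points in space *)

(** (a, b) -> (b, h a b) permutes the ordered pairs of distinct elements in cycles of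
    length 3. *)
Lemma triple_system (T : finType) (h : T -> T -> T) :
  (forall a b, a != b -> [/\ h a b != a, h a b != b & h b (h a b) = a]) ->
  (3 %| #|T| * #|T|.-1)%N.
Proof.
move=> hP.
pose f (p : T * T) := if p.1 == p.2 then p else (p.2, h p.1 p.2).
have fE a b : a != b -> f (a, b) = (b, h a b) by rewrite /f /= => /negPf ->.
have ne a b : a != b -> b != h a b by move=> ab; rewrite eq_sym; case: (hP _ _ ab).
have f2 a b : a != b -> f (f (a, b)) = (h a b, a).
  by move=> ab; have [_ _ e] := hP _ _ ab; rewrite fE // fE ?ne // e.
have f3 : forall p, f (f (f p)) = p.
  move=> [a b]; case: (eqVneq a b) => [->|ab]; first by rewrite /f /= !eqxx.
  have [n1 n2 e] := hP _ _ ab.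
  rewrite f2 // fE //; congr pair.
  by have [_ _] := hP _ _ (ne _ _ ab); rewrite e.
pose D := [pred p : T * T | p.1 != p.2].
have fi : injective f by apply: (can_inj (g := fun x => f (f x))) => x; rewrite f3.
have cD : #|D| = (#|T| * #|T|.-1)%N.
  have := cardC D; rewrite card_prod.
  have -> : #|[predC D]| = #|T|.
    rewrite -(card_codom (f := fun x : T => (x, x))); last by move=> x y [].
    apply: eq_card => -[a b]; rewrite !inE /= negbK; apply/eqP/codomP => [->|[x [-> ->]] //].
    by exists b.
  by move=> e; rewrite -(addnK #|T| #|D|) e -subn1 mulnBr muln1.
have -> : (#|T| * #|T|.-1 = fcard f D * 3)%N.
  rewrite -cD fcard_order_set //.
    apply/subsetP => -[a b]; rewrite !inE /= => ab.
    have [n1 n2 e] := hP _ _ ab.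
    rewrite /order_set /=.
    rewrite (@order_cycle _ _ [:: (a, b); f (a, b); f (f (a, b))])  ?in_cons ?eqxx //.
      by rewrite /= !eqxx f3 eqxx.
    rewrite f2 // fE // /= !inE !xpair_eqE (negPf ab) [a == h a b]eq_sym (negPf n1).
    by rewrite [b == h a b]eq_sym (negPf n2).
  move=> [a b] y /eqP <-; rewrite !inE; case: (eqVneq a b) => [->|ab]; last by rewrite fE //= ne.
  by rewrite /f /= eqxx /= eqxx.
exact: dvdn_mull.
Qed.

Section Triples.
Variable F : finFieldType.
Hypothesis ch2 : 2%N \in [pchar F].
Local Notation oppF := (oppF ch2).

Lemma plucker4 (a b c d y z : 'rV[F]_4) :
  det4 a b c d * det4 a b y z = det4 a b c y * det4 a b d z + det4 a b c z * det4 a b d y.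
Proof.
rewrite -[det4 a b c z * _]oppF /det4; ring.
Qed.

Section Full.
Variables (I : finType) (g : I -> 'rV[F]_4).
Hypotheses (arc_g : arc4 g) (cardI : #|I| = (#|F| + 3)%N).

(** The q + 1 planes through the secant of A and B contain one further point of the arc
    each. *)
Lemma third_exists (A B : I) X Z0 : A != B -> det4 (g A) (g B) X Z0 != 0 ->
  exists C, [&& C != A, C != B & det4 (g A) (g B) (g C) X == 0].
Proof.
move=> AB hZ; have I4 : (3 < #|I|)%N.
  by rewrite cardI addnC; have := finRing_gt1 F; move: #|F| => q; clear; lia.
have [O] : exists x, x \notin [:: A; B] by apply: pick_out; exact: leq_trans I4.
rewrite !inE negb_or => /andP[OA OB].
case: (eqVneq (det4 (g A) (g B) (g O) X) 0) => [e|ne].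
  by exists O; rewrite OA OB e eqxx.
pose W := [set C : I | [&& C != A, C != B & C != O]].
pose s C := det4 (g A) (g B) (g C) X / det4 (g A) (g B) (g C) (g O).
have dO C : C \in W -> det4 (g A) (g B) (g C) (g O) != 0.
  by rewrite in_set => /and3P[CA CB CO]; apply: arc_g; rewrite // eq_sym.
have cW : #|W| = #|F|.
  have -> : W = ~: (A |: (B |: [set O])) by apply/setP => C; rewrite !inE !negb_or.
  apply/eqP; rewrite -(eqn_add2r #|A |: (B |: [set O])|) addnC cardsC cardI.
  by rewrite !cardsU1 !inE cards1 negb_or AB ![_ == O]eq_sym (negPf OA) (negPf OB).
have si : {in W &, injective s}.
  move=> C C' CW CW' sC; apply: contraTeq (isT) => CC.
  have d1 := dO _ CW; have d2 := dO _ CW'.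
  have e : det4 (g A) (g B) (g C) X * det4 (g A) (g B) (g C') (g O)
     = det4 (g A) (g B) (g C') X * det4 (g A) (g B) (g C) (g O).
    move/eqP: sC; rewrite /s eqr_div // => /eqP -> ; by [].
  have := plucker4 (g A) (g B) (g C) (g C') X (g O).
  rewrite e [X in X + _]mulrC addF // => /eqP; rewrite mulf_eq0.
  move: CW CW'; rewrite !in_set => /and3P[CA CB _] /and3P[CA' CB' _].
  have := arc_g AB _ _ _ _ CC; rewrite ![_ == C]eq_sym ![_ == C']eq_sym => /(_ CA CA' CB CB') /negPf ->.
  by rewrite (det4C34 ch2) (negPf ne).
have : 0 \in [set s C | C in W].
  suff -> : [set s C | C in W] = setT by rewrite inE.
  by apply/eqP; rewrite eqEcard subsetT cardsT card_in_imset // cW leqnn.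
case/imsetP => C CW s0; exists C; have d := dO _ CW.
move: CW; rewrite in_set => /and3P[-> -> _] /=.
by move/eqP: s0; rewrite eq_sym /s mulf_eq0 invr_eq0 (negPf d) orbF.
Qed.

Lemma third_unique (A B C C' : I) X Z0 : A != B -> det4 (g A) (g B) X Z0 != 0 ->
  C != A -> C != B -> C' != A -> C' != B ->
  det4 (g A) (g B) (g C) X = 0 -> det4 (g A) (g B) (g C') X = 0 -> C = C'.
Proof.
move=> AB hZ CA CB CA' CB' e e'; apply/eqP; apply: contraTT (isT) => CC.
have /eqP := plucker4 (g A) (g B) (g C) (g C') X Z0.
rewrite e e' mul0r mulr0 addr0 mulf_eq0 (negPf hZ) orbF.
by rewrite (negPf (arc_g _ _ _ _ _ _)) // eq_sym.
Qed.

(** Being coplanar with X defines a system of triples on S. *)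
Lemma full_triples (S : {set I}) X :
  (forall A B, A \in S -> B \in S -> A != B -> exists Z, det4 (g A) (g B) X Z != 0) ->
  (forall A B C, A \in S -> B \in S -> A != B -> det4 (g A) (g B) (g C) X = 0 -> C \in S) ->
  (3 %| #|S| * #|S|.-1)%N.
Proof.
move=> nz cl.
have /fin_all_exists2 [h hS hP] : forall p : I * I, exists2 C, (p.1 \in S -> p.2 \in S -> C \in S) &
   (p.1 \in S -> p.2 \in S -> p.1 != p.2 ->
     [&& C != p.1, C != p.2 & det4 (g p.1) (g p.2) (g C) X == 0]).
  move=> [A B] /=; case: (boolP [&& A \in S, B \in S & A != B]) => [/and3P[AS BS AB]|n].
    have [Z hZ] := nz _ _ AS BS AB; have [C hC] := third_exists AB hZ.
    by exists C => // _ _; apply: (cl A B) => //; case/and3P: hC => _ _ /eqP.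
  exists A => // a b c; by rewrite a b c in n.
pose h' (a b : {x | x \in S}) : {x | x \in S} :=
  exist _ (h (val a, val b)) (hS (val a, val b) (valP a) (valP b)).
have -> : #|S| = #|{: {x | x \in S}}| by rewrite card_sig.
apply: (@triple_system _ h') => -[A AS] [B BS]; rewrite -!val_eqE /= => AB.
have /and3P[/= n1 n2 /eqP d1] := hP (A, B) AS BS AB.
have CS := hS (A, B) AS BS; split=> //; apply: val_inj => /=.
move: (h (A, B)) n1 n2 d1 CS => C n1 n2 d1 CS.
have BC : B != C by rewrite eq_sym.
have /and3P[/= m1 m2 /eqP d2] := hP (B, C) BS CS BC.
have [Z hZ] := nz _ _ BS CS BC.
apply: (third_unique BC hZ) => //; first by rewrite eq_sym.
by rewrite -d1 -(det4C12 ch2) (det4C23 ch2) (det4C12 ch2) (det4C23 ch2).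
Qed.

Definition on_secant A B X := [forall Z, det4 (g A) (g B) X Z == 0].

(** If X is on no secant, the whole arc carries a system of triples; if X is on exactly
    one secant, the arc without two points does. So 3 divides (q + 3) (q + 2) and
    (q + 1) q, hence q. *)
Lemma no_full_arc : (4 <= #|F|)%N -> ~~ (3 %| #|F|)%N -> False.
Proof.
move=> q4 q3.
have I4 : (3 < #|I|)%N by rewrite cardI; move: q4; clear; lia.
have [R1 _] : exists x, x \notin (Nil I) by apply: pick_out; exact: leq_trans I4.
have [R2] : exists x, x \notin [:: R1] by apply: pick_out; exact: leq_trans I4.
rewrite !inE => n12.
have [R3] : exists x, x \notin [:: R1; R2] by apply: pick_out; exact: leq_trans I4.
rewrite !inE negb_or => /andP[n13 n23].
have arcn a b c d : b != a -> c != a -> d != a -> c != b -> d != b -> d != c ->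
  det4 (g a) (g b) (g c) (g d) != 0 by move=> *; apply: arc_g; rewrite eq_sym.
pose X l := g R1 + g R2 + l *: g R3.
have X0 : X 0 = g R1 + g R2 by rewrite /X scale0r addr0.
(* the point R1 + R2 lies on one secant only, which leaves q + 1 points *)
have D1 : (3 %| (#|F|.+1) * #|F|)%N.
  pose S := ~: [set R1; R2].
  have cS : #|S| = #|F|.+1.
    apply/eqP; rewrite -(eqn_add2r #|[set R1; R2]|) addnC cardsC cardI cards2.
    by rewrite [R1 == _]eq_sym n12 addn2 addn3.
  have := @full_triples S (X 0); rewrite cS /=; apply; rewrite X0.
    move=> A B; rewrite !inE !negb_or => /andP[A1 A2] /andP[B1 B2] AB; exists (g R1).
    rewrite !det4E // add0r; apply: arc_g; by rewrite // eq_sym.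
  move=> A B C; rewrite !inE !negb_or => /andP[A1 A2] /andP[B1 B2] AB e.
  apply/andP; split; apply: contra_eqN e => /eqP ->; rewrite !det4E // ?addr0 ?add0r; by apply: arc_g; rewrite // eq_sym.
(* a secant through X l with l <> 0 uses two of the q points other than R1, R2 and R3, and
   different l use different points; so some X l with l <> 0 is on no secant *)
have [R4] : exists x, x \notin [:: R1; R2; R3] by apply: pick_out; exact: leq_trans I4.
rewrite !inE !negb_or => /and3P[n14 n24 n34].
have sym A B l : on_secant A B (X l) -> on_secant B A (X l).
  by move=> /forallP sAB; apply/forallP => Z; rewrite (det4C12 ch2).
have out A B l : l != 0 -> A != B -> on_secant A B (X l) -> A \notin [:: R1; R2; R3].
  move=> l0 AB /forallP sAB; rewrite !inE !negb_or; apply/and3P; split; apply/eqP => AE; subst A.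
  - case: (eqVneq B R2) => [BE|B2]; [subst B; have := sAB (g R4)|have := sAB (g R2)].
      by rewrite /X !det4E // !add0r mulf_eq0 (negPf l0) /= (negPf (arcn _ _ _ _ _ _ _ _ _ _)).
    rewrite /X !det4E // !add0r mulf_eq0 (negPf l0) /=.
    case: (eqVneq B R3) => [BE|B3]; last by rewrite (negPf (arcn _ _ _ _ _ _ _ _ _ _)) // eq_sym.
    subst B; have := sAB (g R4); rewrite /X !det4E // mulr0 addr0 add0r.
    by rewrite (negPf (arcn _ _ _ _ _ _ _ _ _ _)) // eq_sym.
  - case: (eqVneq B R1) => [BE|B1]; [subst B; have := sAB (g R4)|have := sAB (g R1)].
      by rewrite /X !det4E // !add0r mulf_eq0 (negPf l0) /= (negPf (arcn _ _ _ _ _ _ _ _ _ _)) // eq_sym.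
    rewrite /X !det4E // !add0r mulf_eq0 (negPf l0) /=.
    case: (eqVneq B R3) => [BE|B3]; last by rewrite (negPf (arcn _ _ _ _ _ _ _ _ _ _)) // eq_sym.
    subst B; have := sAB (g R4); rewrite /X !det4E // mulr0 !addr0.
    by rewrite (negPf (arcn _ _ _ _ _ _ _ _ _ _)) // eq_sym.
  - case: (eqVneq B R1) => [BE|B1]; [subst B; have := sAB (g R4)|have := sAB (g R1)].
      by rewrite /X !det4E // mulr0 addr0 add0r (negPf (arcn _ _ _ _ _ _ _ _ _ _)) // eq_sym.
    rewrite /X !det4E // mulr0 addr0 add0r.
    case: (eqVneq B R2) => [BE|B2]; last by rewrite (negPf (arcn _ _ _ _ _ _ _ _ _ _)) // eq_sym.
    subst B; have := sAB (g R4); rewrite /X !det4E // mulr0 !addr0.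
    by rewrite (negPf (arcn _ _ _ _ _ _ _ _ _ _)) // eq_sym.
have partner A B B' l l' : l != 0 -> l' != 0 -> A != B -> A != B' ->
    on_secant A B (X l) -> on_secant A B' (X l') -> l = l' /\ B = B'.
  move=> l0 l0' AB AB' s1 s2.
  have := out _ _ _ l0 AB s1; have := out _ _ _ l0 _ (sym _ _ _ s1).
  have := out _ _ _ l0' _ (sym _ _ _ s2); rewrite eq_sym AB' => /(_ isT).
  rewrite !inE !negb_or => /and3P[v1 v2 v3]; rewrite eq_sym AB => /(_ isT) /and3P[u1 u2 u3] /and3P[w1 w2 w3].
  have BB : B = B'.
    apply: (@third_unique A R3 B B' (g R1 + g R2) (g R1)) => //; rewrite ?[_ == A]eq_sym //.
    + rewrite !det4E // add0r; apply: arcn => //; by rewrite // eq_sym.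
    + move/forallP/(_ (g R3))/eqP: s1; rewrite /X !det4E // mulr0 addr0 => e.
      by rewrite !(det4C23 ch2 (g A) (g R3)) !(det4C34 ch2 (g A) (g B) (g R3)).
    + move/forallP/(_ (g R3))/eqP: s2; rewrite /X !det4E // mulr0 addr0 => e.
      by rewrite !(det4C23 ch2 (g A) (g R3)) !(det4C34 ch2 (g A) (g B') (g R3)).
  split=> //; subst B'.
  have [T] : exists x, x \notin [:: A; B; R3] by apply: pick_out; exact: leq_trans I4.
  rewrite !inE !negb_or => /and3P[TA TB T3].
  have D := arcn A B R3 T; rewrite ![_ == A]eq_sym AB w3 eq_sym TA eq_sym u3 TB T3 in D.
  move: s1 s2 => /forallP/(_ (g T))/eqP s1 /forallP/(_ (g T))/eqP s2.
  have : det4 (g A) (g B) (X l) (g T) =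
      det4 (g A) (g B) (X l') (g T) + (l - l') * det4 (g A) (g B) (g R3) (g T).
    by rewrite /X !det4E //; ring.
  rewrite s1 s2 add0r => /esym/eqP; rewrite mulf_eq0 subr_eq0.
  case/orP => [/eqP|/eqP d0] //; move: (D isT isT isT isT isT isT); by rewrite d0 eqxx.
have [l [l0 lP]] : exists l, l != 0 /\ forall A B, A != B -> ~~ on_secant A B (X l).
  case: (boolP [exists l, (l != 0) && [forall A, forall B, (A != B) ==> ~~ on_secant A B (X l)]]).
    case/existsP => l /andP[l0 /forallP lP]; exists l; split=> // A B AB.
    by move/forallP/(_ B)/implyP: (lP A); apply.
  rewrite negb_exists => /forallP noF; exfalso.
  have /fin_all_exists [p pP] : forall l, exists p : I * I, l != 0 -> p.1 != p.2 /\ on_secant p.1 p.2 (X l).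
    move=> l; have := noF l; rewrite negb_and negbK; case/orP => [/eqP ->|]; first by exists (R1, R1); rewrite eqxx.
    rewrite negb_forall => /existsP[A]; rewrite negb_forall => /existsP[B].
    by rewrite negb_imply negbK => /andP[AB sAB]; exists (A, B).
  pose h (x : F * bool) := if x.2 then (p x.1).1 else (p x.1).2.
  have hi : {in [pred x : F * bool | x.1 != 0] &, injective h}.
    move=> [l b] [l' b'] /=; rewrite !inE /= => l0 l0'.
    have [a1 a2] := pP _ l0; have [b1 b2] := pP _ l0'.
    have a1' : (p l).2 != (p l).1 by rewrite eq_sym.
    have b1' : (p l').2 != (p l').1 by rewrite eq_sym.
    have a2' := sym _ _ _ a2; have b2' := sym _ _ _ b2.
    rewrite /h /=; case: b; case: b' => e.
    + by rewrite e in a1 a2; have [-> _] := partner _ _ _ _ _ l0 l0' a1 b1 a2 b2.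
    + rewrite e in a1 a2; have [ll _] := partner _ _ _ _ _ l0 l0' a1 b1' a2 b2'.
      by subst l'; rewrite e eqxx in b1.
    + rewrite e in a1' a2'; have [ll _] := partner _ _ _ _ _ l0 l0' a1' b1 a2' b2.
      by subst l'; rewrite e eqxx in b1.
    + by rewrite e in a1' a2'; have [-> _] := partner _ _ _ _ _ l0 l0' a1' b1' a2' b2'.
  have : (#|[pred x : F * bool | x.1 != 0%R]| <= #|~: [set R1; R2; R3]|)%N.
    rewrite -(card_in_image hi); apply/subset_leq_card/subsetP => R /imageP[[l b]]; rewrite inE /= => l0 ->.
    have [a1 a2] := pP _ l0; rewrite !inE -!orbA; have := out _ _ _ l0 a1 a2.
    have := out _ _ _ l0 _ (sym _ _ _ a2); rewrite eq_sym a1 => /(_ isT).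
    by rewrite /h !inE; case: b.
  have -> : #|[pred x : F * bool | x.1 != 0]| = (#|F|.-1 * 2)%N.
    rewrite -card_bool -(cardC1 (0 : F)) -cardX; apply: eq_card => -[x b]; by rewrite !inE /= andbT.
  have := cardsC [set R1; R2; R3]; rewrite cardI -setUA !cardsU1 !inE cards1 negb_or.
  rewrite ![R1 == _]eq_sym [R2 == R3]eq_sym n12 n13 n23; move: q4; clear; lia.
have D2 : (3 %| (#|F|.+3) * #|F|.+2)%N.
  have := @full_triples setT (X l); rewrite cardsT cardI addn3 /=; apply=> [A B _ _ AB|//].
  by have := lP _ _ AB; rewrite negb_forall => /existsP[Z]; exists Z.
move: D1 D2 q3; rewrite !Euclid_dvdM //; clear; move: #|F| => q; lia.
Qed.
End Full.
End Triples.

(** * Every arc in space lies on a curve of a quadric *)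

Section SpaceCurve.
Variable F : finFieldType.
Hypothesis ch2 : 2%N \in [pchar F].
Local Notation e0 := (vec4 1 0 0 0 : 'rV[F]_4).

(** The points (x f(x), x, f(x), 1) of the quadric form an arc of q + 1 points with the
    point (1, 0, 0, 0). *)
Definition space_curve (f : F -> F) := [/\ injective f,
  (forall x y z, x != y -> x != z -> y != z ->
     det4 e0 (qpt x (f x)) (qpt y (f y)) (qpt z (f z)) != 0) &
  (forall x y z w, x != y -> x != z -> x != w -> y != z -> y != w -> z != w ->
     det4 (qpt x (f x)) (qpt y (f y)) (qpt z (f z)) (qpt w (f w)) != 0)].

Lemma arc4_add (I : finType) (g : I -> 'rV[F]_4) X : arc4 g -> (forall R, special g R X) ->
  arc4 (add_point g X).
Proof.
move=> arc_g sX [i|] [j|] [k|] [l|] //=; rewrite ?(inj_eq (@Some_inj _)).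
- exact: arc_g.
- move=> ij ik _ jk _ _; rewrite (det4C34 ch2) (det4C23 ch2); apply: sX => //; by rewrite eq_sym.
- move=> ij _ il _ jl _; rewrite (det4C23 ch2); apply: sX => //; by rewrite eq_sym.
- move=> _ ik il _ _ kl; apply: sX => //; by rewrite eq_sym.
- move=> _ _ _ jk jl kl; rewrite (det4C12 ch2); apply: sX => //; by rewrite eq_sym.
Qed.

(** Extend the arc as far as possible. By no_full_arc this ends with t > 0, when
    hyperbolic_chart and deficiency_2 apply: b and c take every value once on the q points
    other than Q, and f is c in terms of b. *)
Lemma space_chart t (I : finType) (g : I -> 'rV[F]_4) : arc4 g -> (#|I| + t = #|F| + 3)%N ->
  (t ^ 3 <= #|F|)%N -> (8 <= #|F|)%N -> ~~ (3 %| #|F|)%N -> forall Q,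
  exists (M : 'M[F]_4) (k b : I -> F) (f : F -> F),
  [/\ M \in unitmx, forall R, k R != 0, change g k M Q = e0,
     (forall U, U != Q -> change g k M U = qpt (b U) (f (b U))) & space_curve f].
Proof.
move=> arc_g cardI t3 q8 q3; elim: t I g arc_g cardI t3 => [|t IH] I g arc_g cardI t3 Q.
  case: (@no_full_arc _ ch2 _ g arc_g) => //; first by rewrite -cardI addn0.
  exact: leq_trans q8.
have q_t : (t.+1 * t.+1 * t.+1 <= #|F|)%N by move: t3; rewrite !expnS expn0 muln1 mulnA.
have tq : (t.+1 * t.+1.-1 < #|F|)%N by move: q_t; clear; move: #|F| => q; nia.
have t2 : (t.+1 * 2 < #|F| + 2)%N by move: q8 q_t; clear; move: #|F| => q; nia.
have tI : (t.+2 < #|I|)%N by move: t2 cardI; clear; lia.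
have I4 : (3 < #|I|)%N by move: t2 cardI q8; clear; lia.
case: (boolP [exists X, forall R, forall A, forall B,
   (A != R) ==> (B != R) ==> (A != B) ==> (det4 (g R) X (g A) (g B) != 0)]).
  case/existsP => X /forallP sX.
  have {}sX R : special g R X.
    move=> A B AR BR AB; move/forallP/(_ A)/forallP/(_ B): (sX R).
    by rewrite AR BR AB.
  have [||M [k [b [f [Mu k0 eQ eU sc]]]]] := IH _ _ (arc4_add arc_g sX) _ _ (Some Q).
  - by rewrite card_option; move: cardI; clear; lia.
  - by apply: leq_trans t3; rewrite leq_exp2r.
  exists M, (fun R => k (Some R)), (fun R => b (Some R)), f; split=> // U UQ.
  by apply: (eU (Some U)).
move=> nX.
have noext X : exists U, ~ special g U X.
  move: nX; rewrite negb_exists => /forallP/(_ X); rewrite negb_forall => /existsP[U nU].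
  exists U => sU; case/negP: nU; apply/forallP => A; apply/forallP => B.
  by apply/implyP => AR; apply/implyP => BR; apply/implyP; apply: sU.
have [M [k [b [c [Mu k0 eQ [s1 s2] hU]]]]] := hyperbolic_chart ch2 arc_g cardI tq tI I4 isT noext t3 Q.
set h := change g k M in eQ s1 s2 hU.
have arc_h : arc4 h := arc4_change k0 Mu arc_g.
have nh := @noext_change _ _ g k M Mu noext.
have t_2 := deficiency_2 ch2 arc_h cardI tq tI I4 isT nh eQ s1 hU t3.
have bi := b_inj I4 hU; have ci := c_inj I4 hU.
have hb x : exists U, U != Q /\ b U = x.
  have : x \in [set b U | U in [set~ Q]].
    suff -> : [set b U | U in [set~ Q]] = setT by rewrite inE.
    apply/eqP; rewrite eqEcard subsetT cardsT card_in_imset // cardsC1.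
    by move: cardI; rewrite t_2 addn2 addn3 => -[->] /=.
  by case/imsetP => U; rewrite !inE => UQ ->; exists U.
have [u uP] := fin_all_exists hb.
have ub U : U != Q -> u (b U) = U.
  by move=> UQ; have [a e] := uP (b U); apply: bi; rewrite ?inE.
have hu x : h (u x) = qpt x (c (u x)) by have [a e] := uP x; have [-> _ _] := hU _ a; rewrite e.
have un x y : x != y -> u x != u y.
  by apply: contraNneq => e; have [_ <-] := uP x; have [_ <-] := uP y; rewrite e.
exists M, k, b, (c \o u); split=> //.
  by move=> U UQ /=; rewrite ub //; have [] := hU _ UQ.
split=> [x y /= e|x y z xy xz yz|x y z w xy xz xw yz yw zw] /=.
  have [a <-] := uP x; have [a' <-] := uP y; congr b; apply: ci e; by rewrite !inE.
  rewrite -eQ -!hu; apply: arc_h; rewrite ?un //; rewrite eq_sym; by case: (uP x) (uP y) (uP z) => ? _ [? _] [].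
by rewrite -!hu; apply: arc_h; apply: un.
Qed.
End SpaceCurve.

(** * O-polynomials and the form of the curve *)

Section FinPoly.
Variable F : finFieldType.

Lemma poly_fun0 (A : {set F}) (p : {poly F}) : (size p <= #|A|)%N -> {in A, forall x, p.[x] = 0} -> p = 0.
Proof.
move=> sp pA; apply: (@roots_geq_poly_eq0 _ p (enum A)); rewrite ?enum_uniq -?cardE //.
by apply/allP => x; rewrite mem_enum => /pA/eqP.
Qed.

Lemma poly_fun_inj (p r : {poly F}) : (size p <= #|F|)%N -> (size r <= #|F|)%N ->
  (forall x, p.[x] = r.[x]) -> p = r.
Proof.
move=> sp sr pr; apply/eqP; rewrite -subr_eq0; apply/eqP.
apply: (@poly_fun0 setT) => [|x _]; last by rewrite hornerD hornerN pr subrr.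
by rewrite cardsT (leq_trans (size_polyD _ _)) // geq_max sp size_polyN.
Qed.

Lemma interpolation (f : F -> F) : exists p : {poly F}, (size p <= #|F|)%N /\ forall x, p.[x] = f x.
Proof.
pose L (a : F) := \prod_(b in [set~ a]) ('X - b%:P).
have La a : (L a).[a] != 0.
  rewrite horner_prod; apply/prodf_neq0 => b; rewrite !inE => ba.
  by rewrite !hornerE subr_eq0 eq_sym.
have Lx a x : x != a -> (L a).[x] = 0.
  by move=> xa; rewrite /L horner_prod (bigD1 x) ?inE //= !hornerE subrr mul0r.
exists (\sum_a (f a / (L a).[a]) *: L a); split.
  apply: (leq_trans (size_sum _ _ _)); apply/bigmax_leqP => a _.
  apply: (leq_trans (size_scale_leq _ _)); rewrite /L -big_enum size_prod_XsubC.
  by rewrite -cardE cardsC1 prednK // (cardD1 a).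
move=> x; rewrite horner_sum (bigD1 x) //= hornerZ divfK // big1 ?addr0 // => a ax.
by rewrite eq_sym in ax; rewrite hornerZ (Lx _ _ ax) mulr0.
Qed.
End FinPoly.

Section OPolynomials.
Variable F : finFieldType.
Hypothesis ch2 : 2%N \in [pchar F].
Local Notation oppF := (oppF ch2).
Local Notation addF := (addF ch2).
Hypotheses (q_even : ~~ odd #|F|) (q8 : (8 <= #|F|)%N).

(** This is lagrange_coef for all the elements of F, with denominators 1 by prod_nz1. *)
Lemma sum_poly (p : {poly F}) : (size p <= #|F|)%N -> \sum_x p.[x] = p`_(#|F|.-1).
Proof.
move=> sp; have := @lagrange_coef F F setT id p (in2W (@inj_id F)); rewrite cardsT => /(_ sp) <-.
rewrite [RHS](eq_bigl xpredT); last by move=> x; rewrite inE.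
apply: eq_bigr => x _; rewrite (_ : \prod_(j in _) _ = 1) ?divr1 //.
rewrite -[RHS](prod_nz1 ch2) [RHS](reindex_inj (subrI x)) /=.
by apply: eq_bigl => y; rewrite !inE andbT subr_eq0 eq_sym.
Qed.

Lemma sum_nz : \sum_(x : F | x != 0) x = 0.
Proof.
have := @sum_poly 'X; rewrite size_polyX coefX (leq_trans _ q8) // => /(_ isT).
rewrite (bigD1 0) //= hornerX add0r.
rewrite (eq_bigr id) => [->|x _]; last by rewrite hornerX.
by case: eqP => // e; move: q8; rewrite -ltnS -[#|F|]prednK ?e // (leq_trans _ q8).
Qed.

(** Zero when the points of the graph of f over x, y and z are collinear. *)
Definition slope_bracket (f : F -> F) x y z := (f x + f z) * (y + z) + (f y + f z) * (x + z).
(** The graph of f and the two points at infinity of the axes form a hyperoval through the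
    origin. *)
Definition opoly (f : F -> F) := [/\ f 0 = 0, injective f &
  forall x y z, x != y -> x != z -> y != z -> slope_bracket f x y z != 0].

Lemma neq_add0 (x y : F) : (x + y != 0) = (x != y).
Proof. by rewrite -[y in x + y]oppF subr_eq0. Qed.

(** For fixed s the slopes (f(x) + f(s)) / (x + s) run through the nonzero elements, and
    their sum is 0. They are the values at x <> s of a polynomial of degree at most q - 2,
    whose values have sum 0; so its value at s, which is f'(s), is 0. As s is
    arbitrary, the derivative of f is 0. *)
Lemma opoly_even f : opoly f -> exists p : {poly F}, (size p <= #|F|./2)%N /\ forall x, f x = p.[x ^+ 2].
Proof.
case=> f0 fi fb; have [p [sp pf]] := interpolation f.
have d0 : p^`() = 0.
  apply: (@poly_fun0 _ setT) => [|s _].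
    by rewrite cardsT (leq_trans (size_poly _ _)) // (leq_trans (leq_pred _)).
  have /factor_theorem [r rE] : root (p - (f s)%:P) s by rewrite /root !hornerE pf subrr.
  have -> : p^`().[s] = r.[s].
    have := congr1 (fun p => (deriv p).[s]) rE.
    by rewrite derivB derivC subr0 derivM derivXsubC !hornerE subrr mulr0 add0r.
  have rx x : x != s -> r.[x] = (f x + f s) / (x + s).
    move=> xs; have := congr1 (horner^~ x) rE; rewrite !hornerE pf !oppF => ->.
    by rewrite mulfK // neq_add0.
  have sr : (size r < #|F|)%N.
    case: (eqVneq r 0) => [->|r0]; first by rewrite size_poly0 (leq_trans _ q8).
    have : (size (p - (f s)%:P)%R <= #|F|)%N.
      rewrite (leq_trans (size_polyD _ _)) // geq_max sp size_polyN (leq_trans (size_polyC_leq1 _)) //.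
      exact: leq_trans q8.
    by rewrite rE size_mul ?polyXsubC_eq0 // size_XsubC addn2.
  have : \sum_x r.[x] = 0.
    by rewrite sum_poly ?(ltnW sr) // nth_default // -ltnS prednK // (leq_trans _ q8).
  rewrite (bigD1 s) //= => /eqP; rewrite addrC addr_eq0 oppF => /eqP <-.
  pose m x := (f x + f s) / (x + s).
  have mi : {in [set~ s] &, injective m}.
    move=> x y; rewrite !inE => xs ys e; apply: contraTeq (isT) => xy.
    have := fb x y s xy xs ys; rewrite /slope_bracket.
    move/eqP: e; rewrite /m eqr_div ?neq_add0 // => /eqP ->.
    by rewrite eqxx.
  have im : m @: [set~ s] = [set~ 0].
    apply/eqP; rewrite eqEcard card_in_imset // !cardsC1 leqnn andbT.
    apply/subsetP => y /imsetP[x xs ->]; move: xs; rewrite !inE => xs.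
    by rewrite mulf_neq0 ?invr_eq0 ?neq_add0 // (inj_eq fi).
  rewrite (eq_bigr m) => [|x]; last exact: rx.
  rewrite -[RHS]sum_nz; transitivity (\sum_(y in m @: [set~ s]) y).
    by rewrite big_imset //=; apply: eq_bigl => x; rewrite !inE.
  by rewrite im; apply: eq_bigl => x; rewrite !inE.
exists (even_poly p); split.
  apply: (leq_trans (size_even_poly _)).
  by have := uphalf_leq sp; rewrite [uphalf #|F|]uphalf_half (negPf q_even).
move=> x; rewrite -pf -[in LHS](poly_even_odd p).
have -> : odd_poly p = 0.
  apply/polyP => i; rewrite coef_odd_poly coef0.
  have := congr1 (fun r : {poly F} => r`_(i.*2)) d0; rewrite coef_deriv coef0.
  by rewrite mulrS -addnn mulrnDr addF addr0.
by rewrite comp_poly0 mul0r addr0 horner_comp hornerXn.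
Qed.

Lemma sqr_inj : injective (fun x : F => x ^+ 2).
Proof.
move=> a b /eqP; rewrite -subr_eq0 subr_sqr mulf_eq0 subr_eq0.
by case/orP => /eqP //; move/eqP; rewrite addr_eq0 oppF => /eqP.
Qed.

(** With h = q / 2, opoly_even gives f(x) = p(x^2) and g(x) = r(x^2), where p and r have
    size at most h and r(0) = 0. So y^(h-1) r(1/y) is a polynomial r'(y), and
    p(y) r'(y) = y^(h-1) for y <> 0. The degrees are too small for this to hold
    without p r' = X^(h-1), so p is a monomial. *)
Lemma opoly_monomial f g : opoly f -> opoly g -> (forall x, x != 0 -> f x * g x^-1 = 1) ->
  exists k m, [/\ k != 0, (0 < m)%N && ~~ odd m, (m <= #|F| - 2)%N & forall x, f x = k * x ^+ m].
Proof.
move=> fo go fg; have [p [sp pf]] := opoly_even fo; have [r [sr rg]] := opoly_even go.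
have [f0 fi _] := fo; have [g0 _ _] := go.
have := odd_double_half #|F|; rewrite (negPf q_even) add0n -muln2 => qh.
move: (#|F|./2) sp sr qh => h sp sr qh.
have h4 : (4 <= h)%N by move: q8; rewrite -qh; clear; lia.
pose r' := \poly_(i < h.-1) r`_(h.-1 - i).
have r0 : r`_0 = 0 by rewrite -horner_coef0; have := rg 0; rewrite expr0n g0 => <-.
have r'E y : y != 0 -> r'.[y] = y ^+ h.-1 * r.[y^-1].
  move=> y0; rewrite horner_poly (@horner_coef_wide _ h r) //.
  rewrite -[in RHS](prednK (leq_trans _ h4)) // big_ord_recl /= r0 mul0r add0r big_distrr /=.
  rewrite (reindex_inj rev_ord_inj) /=; apply: eq_bigr => i _.
  rewrite subKn; last by rewrite /bump; move: (ltn_ord i); clear; lia.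
  rewrite mulrCA; congr (_ * _); rewrite exprVn.
  have -> : y ^+ h.-1 = y ^+ (h.-1 - i.+1) * y ^+ i.+1 by rewrite -exprD subnK.
  by rewrite mulfK ?expf_neq0.
have E : p * r' = 'X^(h.-1).
  apply/eqP; rewrite -subr_eq0; apply/eqP; apply: (@poly_fun0 _ [set~ 0]).
    rewrite cardsC1 (leq_trans (size_polyD _ _)) // geq_max size_polyN size_polyXn.
    apply/andP; split; last by rewrite -qh; move: h4; clear; lia.
    apply: (leq_trans (size_polyMleq _ _)).
    have : (size r' <= h.-1)%N by apply: size_poly.
    by move: sp h4; rewrite -qh; clear; lia.
  move=> y; rewrite !inE => y0; rewrite !hornerE r'E //.
  have [x xE] : exists x, x ^+ 2 = y.
    by have [s _ sK] := injF_bij sqr_inj; exists (s y); rewrite sK.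
  have x0 : x != 0 by apply: contraNneq y0 => e; rewrite -xE e expr0n.
  by rewrite -xE -exprVn -rg -pf mulrCA fg // mulr1 subrr.
have : p %| ('X - 0%:P) ^+ h.-1 by rewrite subr0 -E dvdp_mulr.
case/dvdp_exp_XsubCP => j jh; rewrite subr0 => /eqpP[[a b] /andP[/= a0 b0] ab].
have fE x : f x = b / a * x ^+ j.*2.
  have /(congr1 (horner^~ (x ^+ 2))) := ab; rewrite !hornerZ hornerXn -pf -exprM mul2n => e.
  by rewrite mulrAC -e mulrC mulKf.
exists (b / a), j.*2; split=> //.
- by rewrite mulf_neq0 ?invr_neq0.
- rewrite odd_double andbT double_gt0 lt0n; apply/eqP => j0; have /eqP := oner_neq0 F; apply; apply: fi.
  by rewrite !fE j0.
- by rewrite -qh; move: jh h4; clear; lia.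
Qed.

(** Squaring is injective, which reduces an even m to m / 2. For odd m the coefficients of
    X in (X - 1)^m and X^m - 1 show that m = 1. *)
Lemma additive_power m : (0 < m < #|F|)%N -> (forall x : F, (x + 1) ^+ m = x ^+ m + 1) ->
  exists e, m = (2 ^ e)%N.
Proof.
elim/ltn_ind: m => m IH /andP[m0 mq] H.
case: (boolP (odd m)) => om.
  have E : ('X - 1%:P) ^+ m = 'X^m - 1%:P :> {poly F}.
    apply: poly_fun_inj => [||x]; first by rewrite size_exp_XsubC.
      by rewrite size_XnsubC.
    by rewrite !(hornerE, horner_exp, hornerXn) !oppF.
  case: (posnP m.-1) => [m1|m1]; first by exists 0%N; rewrite expn0 -(prednK m0) m1.
  have := congr1 (fun p : {poly F} => p^`().[0]) E.
  rewrite deriv_exp derivXsubC derivB derivXn derivC subr0 mul1r !hornerMn horner_exp hornerXsubC.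
  rewrite hornerXn expr0n (gtn_eqF m1) mul0rn sub0r oppF expr1n.
  have := odd_double_half m; rewrite om -addnn => <-; rewrite mulrnDr mulrnDr addF addr0 mulr1n.
  by move/eqP; rewrite oner_eq0.
have := odd_double_half m; rewrite (negPf om) add0n => mE.
have lt : (m./2 < m)%N by move: m0 mE; clear; lia.
have [||e eE] := IH _ lt; first by move: mE m0 mq; clear; lia.
- move=> x; have := H x; rewrite -{1 2}mE -mul2n mulnC !exprM => e.
  by apply: sqr_inj => /=; rewrite e sqrrD mulr1 -mulr_natr (_ : 2%:R = 0) ?mulr0 ?addr0 ?expr1n //; exact: pcharf0.
by exists e.+1; rewrite expnS -eE -{1}mE mul2n.
Qed.

Lemma slope_bracket_rot f x y z : slope_bracket f x y z = slope_bracket f y z x.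
Proof.
apply/eqP; rewrite -subr_eq0; apply/eqP; rewrite /slope_bracket.
set a := f x; set b := f y; set c := f z.
transitivity ((c * z + c * z) - (a * x + a * x) : F); first by ring.
by rewrite !addF subr0.
Qed.

Lemma det4_slopes x y z a b c : det4 (vec4 1 0 0 0 : 'rV[F]_4) (qpt x a) (qpt y b) (qpt z c) =
  (a + c) * (y + z) + (b + c) * (x + z).
Proof.
transitivity ((x - z) * (b - c) - (y - z) * (a - c)); first by rewrite /det4 !mxE /=; ring.
by rewrite !oppF addrC; congr (_ + _); exact: mulrC.
Qed.

Lemma det4_translate (s c x y z a b d : F) :
  det4 (qpt s c) (qpt (x + s) (a + c)) (qpt (y + s) (b + c)) (qpt (z + s) (d + c)) =
  det4 (qpt 0 0) (qpt x a) (qpt y b) (qpt z d).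
Proof. by rewrite /det4 !mxE /=; ring. Qed.

(** By the inversion (x, a) -> (1/x, 1/a), planes through the point with parameters 0, 0
    become lines. *)
Lemma det4_cremona (x y z a b d : F) : x != 0 -> y != 0 -> z != 0 -> a != 0 -> b != 0 -> d != 0 ->
  det4 (qpt 0 0) (qpt x^-1 a) (qpt y^-1 b) (qpt z^-1 d) =
  (a * b * d / (x * y * z)) * ((a^-1 + d^-1) * (y + z) + (b^-1 + d^-1) * (x + z)).
Proof.
move=> x0 y0 z0 a0 b0 d0.
transitivity ((a * b * d / (x * y * z)) * ((a^-1 - d^-1) * (y - z) - (b^-1 - d^-1) * (x - z))).
  rewrite -[RHS]oppF /det4 !mxE /=; field.
  by rewrite x0 y0 z0 a0 b0 d0.
by rewrite !oppF.
Qed.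

Section Curve.
Variables (f : F -> F).
Hypothesis sc : space_curve f.

Lemma translate_opoly s : opoly (fun x => f (x + s) + f s).
Proof.
have [fi f3 f4] := sc; split; first by rewrite add0r addF.
  by move=> x y /addIr/fi/addIr.
move=> x y z xy xz yz.
have := f3 (x + s) (y + s) (z + s); rewrite !(inj_eq (addIr s)) => /(_ xy xz yz).
rewrite det4_slopes /slope_bracket.
have E (a b c : F) : a + c + (b + c) = a + b by rewrite addrACA addF addr0.
by rewrite !E.
Qed.

Lemma inverse_opoly s : opoly (fun u => (f (u^-1 + s) + f s)^-1).
Proof.
have [fi f3 f4] := sc; split; first by rewrite invr0 add0r addF invr0.
  by move=> x y /invr_inj/addIr/fi/addIr/invr_inj.
have nz u : u != 0 -> f (u^-1 + s) + f s != 0.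
  by move=> u0; rewrite neq_add0 (inj_eq fi) -subr_eq0 addrK invr_eq0.
have zero u v : u != 0 -> v != 0 -> u != v -> slope_bracket (fun u => (f (u^-1 + s) + f s)^-1) u v 0 != 0.
  move=> u0 v0 uv; have := f3 (u^-1 + s) (v^-1 + s) s.
  rewrite (inj_eq (addIr s)) (inj_eq invr_inj) -![_ + s == s]subr_eq0 !addrK !invr_eq0 => /(_ uv u0 v0).
  rewrite det4_slopes -!addrA addF !addr0 /slope_bracket invr0 add0r addF invr0 !addr0.
  have := nz u u0; have := nz v v0; move: (f (u^-1 + s) + f s) (f (v^-1 + s) + f s) => X Y Y0 X0.
  have -> : X^-1 * v + Y^-1 * u = u * v / (X * Y) * (X * v^-1 + Y * u^-1) by field; rewrite u0 v0 X0 Y0.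
  by move=> ne; rewrite !mulf_neq0 ?invr_neq0 ?mulf_neq0.
move=> x y z xy xz yz.
case: (eqVneq z 0) => [z0|z0]; first by subst z; apply: zero.
case: (eqVneq y 0) => [y0|y0].
  by subst y; rewrite -slope_bracket_rot; apply: zero; rewrite // eq_sym.
case: (eqVneq x 0) => [x0|x0].
  by subst x; rewrite slope_bracket_rot; apply: zero.
have := f4 s (x^-1 + s) (y^-1 + s) (z^-1 + s).
rewrite !(inj_eq (addIr s)) !(inj_eq invr_inj) ![s == _]eq_sym -![_ + s == s]subr_eq0 !addrK !invr_eq0.
move=> /(_ x0 y0 z0 xy xz yz).
have E u : f (u^-1 + s) = (f (u^-1 + s) + f s) + f s by rewrite -addrA addF addr0.
rewrite (E x) (E y) (E z) det4_translate det4_cremona ?nz // mulf_eq0 negb_or.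
by case/andP.
Qed.

(** Every f(x + s) + f(s) is a monomial, by translate_opoly and inverse_opoly. Comparing
    s = 0 and s = 1 gives (x + 1)^m = x^m + 1. *)
Lemma curve_power : exists k e, [/\ k != 0, (0 < e)%N, (2 ^ e <= #|F| - 2)%N &
  forall x, f x = k * x ^+ (2 ^ e) + f 0].
Proof.
have M s := opoly_monomial (translate_opoly s) (inverse_opoly s).
have mono s : exists k m, [/\ k != 0, (0 < m)%N && ~~ odd m, (m <= #|F| - 2)%N & forall x, f (x + s) + f s = k * x ^+ m].
  apply: M => x x0; rewrite invrK mulfV // neq_add0; apply/eqP => /(let: And3 fi _ _ := sc in fi)/eqP.
  by rewrite -subr_eq0 addrK (negPf x0).
have [k [m [k0 /andP[m0 mo] mq kE]]] := mono 0.
have fE x : f x = k * x ^+ m + f 0 by rewrite -kE addr0 -addrA addF addr0.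
have [k' [m' [k0' _ mq' kE']]] := mono 1.
have E x : k * ((x + 1) ^+ m + 1) = k' * x ^+ m'.
  by rewrite -kE' (fE (x + 1)) (fE 1) expr1n addrACA addF addr0 mulrDr.
have kk : k' = k.
  by have := E 1; rewrite addF expr0n (gtn_eqF m0) add0r expr1n !mulr1.
have [e me] : exists e, m = (2 ^ e)%N.
  apply: additive_power => [|x]; first by rewrite m0; move: mq q8; clear; lia.
  have mm : m' = m.
    have P : ('X - 1%:P) ^+ m - 1%:P = 'X^m' :> {poly F}.
      have le i : (i <= #|F| - 2 -> i < #|F|)%N by move: q8; clear; lia.
      apply: poly_fun_inj => [||y]; last first.
        rewrite !(hornerE, horner_exp) !oppF; apply: (mulfI k0); by rewrite E kk.
        by rewrite size_polyXn le.
      rewrite (leq_trans (size_polyD _ _)) // geq_max size_polyN size_exp_XsubC le //=.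
      by rewrite (leq_trans (size_polyC_leq1 _)) // (leq_trans _ q8).
    have := congr1 (fun p : {poly F} => size p) P; rewrite size_polyXn size_polyDl ?size_exp_XsubC.
      by case.
    by rewrite size_polyN size_polyC oner_eq0 ltnS.
  have := E x; rewrite kk mm => /(mulfI k0) <-.
  by rewrite -addrA addF addr0.
exists k, e; rewrite -me; split=> //.
by rewrite lt0n; apply: contraNneq mo => e0; rewrite me e0.
Qed.
End Curve.
End OPolynomials.

(** * Coordinates for the planar arc *)

Section PlaneChart.
Variable F : finFieldType.
Hypothesis ch2 : 2%N \in [pchar F].
Local Notation oppF := (oppF ch2).
Local Notation addF := (addF ch2).
Hypotheses (q_even : ~~ odd #|F|) (q8 : (8 <= #|F|)%N) (q3 : ~~ (3 %| #|F|)%N).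

Definition tail4 (v : 'rV[F]_4) : 'rV[F]_3 := \row_j v ord0 (lift ord0 j).
Definition cons4 (x : F) (v : 'rV[F]_3) : 'rV[F]_4 :=
  vec4 x (v ord0 (@Ordinal 3 0 isT)) (v ord0 (@Ordinal 3 1 isT)) (v ord0 (@Ordinal 3 2 isT)).

Lemma ord3P (P : 'I_3 -> Prop) : P (@Ordinal 3 0 isT) -> P (@Ordinal 3 1 isT) ->
  P (@Ordinal 3 2 isT) -> forall i, P i.
Proof.
by move=> h0 h1 h2 [[|[|[|//]]] h]; [move: h0|move: h1|move: h2]; congr P; apply: val_inj.
Qed.

Lemma tail4D u v : tail4 (u + v) = tail4 u + tail4 v.
Proof. by apply/rowP => j; rewrite !mxE. Qed.
Lemma tail4Z c v : tail4 (c *: v) = c *: tail4 v.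
Proof. by apply/rowP => j; rewrite !mxE. Qed.
Lemma tail4_cons x v : tail4 (cons4 x v) = v.
Proof. by apply/rowP; apply: ord3P; rewrite !mxE /=; congr (v _ _); apply: val_inj. Qed.
Lemma det4_cons x u v w :
  det4 (vec4 x 0 0 0) u v w = x * det3 (tail4 u) (tail4 v) (tail4 w).
Proof. by rewrite (vec4E u) (vec4E v) (vec4E w) /det4 /det3 /tail4 /vec4 !mxE /=; ring. Qed.

Definition pow_arc m := forall x y z : F, x != y -> x != z -> y != z ->
  slope_bracket (fun x => x ^+ m) x y z != 0.
(** With A1 and A2 these are the points of the hyperoval given by x -> x^m in the basis
    A1, A2, A3. *)
Definition hpt (A1 A2 A3 : 'rV[F]_3) m x := x *: A1 + x ^+ m *: A2 + A3.

Definition linear_form (l : 'rV[F]_3 -> F) := forall c u v, l (c *: u + v) = c * l u + l v.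

Section Planar.
Variables (J : finType) (r : J -> 'rV[F]_3) (x : J -> F) (t : nat).
(** An arc in space that the point (1, 0, 0, 0) projects onto r. *)
Definition lifted (o : option J) := if o is Some R then cons4 (x R) (r R) else vec4 1 0 0 0.
Hypotheses (arc_l : arc4 lifted) (cardJ : (#|J| + t = #|F| + 2)%N) (t3 : (t ^ 3 <= #|F|)%N).

Lemma base_arc : arc3 r.
Proof.
move=> i j k ij ik jk; have := arc_l (i := None) (j := Some i) (k := Some j) (l := Some k).
rewrite !(inj_eq (@Some_inj _)) => /(_ isT isT isT ij ik jk).
by rewrite /= det4_cons mul1r !tail4_cons.
Qed.

(** Project the curve of space_chart from the point (1, 0, 0, 0). The coordinate
    b f(b) that is lost gives the term in b^(m+1), and all the other terms of x are
    linear in r. *)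
Lemma planar_chart : exists (A1 A2 A3 : 'rV[F]_3) (l : 'rV[F]_3 -> F) (e : nat) (al : F) (k b : J -> F),
  [/\ det3 A1 A2 A3 != 0, [/\ (0 < e)%N, (2 ^ e <= #|F| - 2)%N & pow_arc (2 ^ e)],
    al != 0 /\ linear_form l, (forall R, k R != 0 /\ r R = k R *: hpt A1 A2 A3 (2 ^ e) (b R)) &
    forall R, x R = k R * al * b R ^+ (2 ^ e).+1 + l (r R)].
Proof.
have [|M [k [b [f [Mu k0 e0E fE sc]]]]] := space_chart ch2 arc_l _ t3 q8 q3 None.
  by rewrite card_option; move: cardJ; clear; lia.
have [ka [e [ka0 e0 eq pE]]] := curve_power ch2 q_even q8 sc.
move: (f 0) pE => f0 pE.
have [fi f3 _] := sc.
have pa : pow_arc (2 ^ e).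
  move=> u v w uv uw vw; have := f3 u v w uv uw vw.
  rewrite det4_slopes // !pE; apply: contraNneq => E.
  have -> : (ka * u ^+ (2 ^ e) + f0 + (ka * w ^+ (2 ^ e) + f0)) * (v + w) + (ka * v ^+ (2 ^ e) + f0 + (ka * w ^+ (2 ^ e) + f0)) * (u + w)
    = ka * slope_bracket (fun x => x ^+ (2 ^ e)) u v w + (f0 + f0) * (v + w + u + w).
    by rewrite /slope_bracket; ring.
  by rewrite E addF mul0r mulr0 addr0.
pose N := invmx M.
pose n i := row i N.
have o0 : (ord0 : 'I_4) = @Ordinal 4 0 isT by apply: val_inj.
have o1 : lift ord0 (ord0 : 'I_3) = @Ordinal 4 1 isT by apply: val_inj.
have o2 : lift ord0 (lift ord0 (ord0 : 'I_2)) = @Ordinal 4 2 isT by apply: val_inj.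
have o3 : lift ord0 (lift ord0 (lift ord0 (ord0 : 'I_1))) = @Ordinal 4 3 isT by apply: val_inj.
have back o : lifted o = (k o)^-1 *: (change lifted k M o *m N).
  by rewrite /change -scalemxAl scalerA mulVf // scale1r mulmxK.
have qN y : qpt y (f y) *m N = (y * f y) *: n (@Ordinal 4 0 isT) + y *: n (@Ordinal 4 1 isT) +
    f y *: n (@Ordinal 4 2 isT) + n (@Ordinal 4 3 isT).
  rewrite mulmx_sum_row !big_ord_recl big_ord0 !mxE /= scale1r addr0 !addrA.
  by rewrite o3 o2 o1 o0.
have n0 : n (@Ordinal 4 0 isT) = k None *: (vec4 1 0 0 0).
  have := back None; rewrite e0E /= => /(congr1 (fun v => k None *: v)).
  rewrite scalerA mulfV // scale1r => ->.
  rewrite mulmx_sum_row !big_ord_recl big_ord0 !mxE /= scale1r !scale0r !addr0.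
  by rewrite o0.
pose w i := tail4 (n i).
exists (w (@Ordinal 4 1 isT)), (ka *: w (@Ordinal 4 2 isT)), (w (@Ordinal 4 3 isT) + f0 *: w (@Ordinal 4 2 isT)).
have Nu : N \in unitmx by rewrite unitmx_inv.
have w0 : det3 (w (@Ordinal 4 1 isT)) (w (@Ordinal 4 2 isT)) (w (@Ordinal 4 3 isT)) != 0.
  have : \det N != 0 by rewrite -unitfE -unitmxE.
  rewrite det4_det -/(n _) n0 det4Z1 det4_cons mul1r mulf_eq0 negb_or.
  by case/andP.
pose p i := n i ord0 ord0.
move: w0; set w1 := w (@Ordinal 4 1 isT); set w2 := w (@Ordinal 4 2 isT); set w3 := w (@Ordinal 4 3 isT) => w0.
pose c1 := f0 * k None + p (@Ordinal 4 1 isT).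
pose c2 := p (@Ordinal 4 2 isT); pose c3 := p (@Ordinal 4 3 isT).
pose l v := (det3 v w2 w3 * c1 + det3 w1 v w3 * c2 + det3 w1 w2 v * c3) / det3 w1 w2 w3.
have bE R : lifted (Some R) = (k (Some R))^-1 *: (qpt (b (Some R)) (f (b (Some R))) *m N).
  by rewrite back fE.
exists l, e, (k None * ka), (fun R => (k (Some R))^-1), (fun R => b (Some R)).
have rE R : r R = (k (Some R))^-1 *: hpt w1 (ka *: w2) (w3 + f0 *: w2) (2 ^ e) (b (Some R)).
  have := congr1 tail4 (bE R); rewrite /= tail4_cons qN n0 pE !(tail4D, tail4Z) => ->.
  congr (_ *: _); rewrite /hpt -/(w _) -/(w _) -/(w _) -/w1 -/w2 -/w3.
  have -> : tail4 (vec4 1 0 0 0 : 'rV[F]_4) = 0 by apply/rowP; apply: ord3P; rewrite !mxE.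
  rewrite !scaler0 add0r; apply/rowP => j; rewrite !mxE; ring.
split=> //.
- by rewrite det3Z2 det3D3 det3Z3 det3abb // mulr0 addr0 mulf_neq0.
- split; first by rewrite mulf_neq0.
  by move=> c u v; rewrite /l !(det3D1, det3D2, det3D3, det3Z1, det3Z2, det3Z3); ring.
- by move=> R; split; rewrite ?invr_neq0.
move=> R; rewrite rE /l /hpt.
rewrite !(det3D1, det3D2, det3D3, det3Z1, det3Z2, det3Z3) !(det3aab, det3aba, det3abb) //.
have := congr1 (fun v : 'rV[F]_4 => v ord0 ord0) (bE R).
rewrite /= qN n0 pE !mxE /= => ->.
have nE i : N i ord0 = p i by rewrite /p /n mxE.
rewrite !nE -/c2 -/c3 exprS /c1.
by field; rewrite w0 k0.
Qed.
End Planar.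
End PlaneChart.

(** * Translation axes of a hyperoval *)

Section Axes.
Variable F : finFieldType.
Hypothesis ch2 : 2%N \in [pchar F].
Local Notation oppF := (oppF ch2).
Local Notation addF := (addF ch2).
Hypotheses (q8 : (8 <= #|F|)%N).
Local Notation neq_add0 := (neq_add0 ch2).

Lemma pow2D e (x y : F) : (x + y) ^+ (2 ^ e) = x ^+ (2 ^ e) + y ^+ (2 ^ e).
Proof.
elim: e => [|e IH]; first by rewrite expn0 !expr1.
by rewrite expnSr !exprM IH sqrrD mulr2n addF addr0.
Qed.

Lemma pow2_inj e : injective (fun x : F => x ^+ (2 ^ e)).
Proof.
move=> x y /= /eqP; rewrite -subr_eq0 oppF -pow2D expf_eq0 => /andP[_].
by rewrite addr_eq0 oppF => /eqP.
Qed.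

Lemma cramer3 (A1 A2 A3 v : 'rV[F]_3) : det3 A1 A2 A3 *: v =
  det3 v A2 A3 *: A1 + det3 A1 v A3 *: A2 + det3 A1 A2 v *: A3.
Proof. by apply/rowP; apply: ord3P; rewrite /det3 !mxE; ring. Qed.

Lemma coord_inj (A1 A2 A3 : 'rV[F]_3) x y z x' y' z' : det3 A1 A2 A3 != 0 ->
  x *: A1 + y *: A2 + z *: A3 = x' *: A1 + y' *: A2 + z' *: A3 -> [/\ x = x', y = y' & z = z'].
Proof.
move=> D0 E.
have h := (det3D1, det3D2, det3D3, det3Z1, det3Z2, det3Z3, @det3aab F, @det3aba F, @det3abb F).
split; apply: (mulIf D0).
- by have := congr1 (fun v => det3 v A2 A3) E; rewrite !h !(mulr0, addr0).
- by have := congr1 (fun v => det3 A1 v A3) E; rewrite !h !(mulr0, addr0, add0r).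
- by have := congr1 (fun v => det3 A1 A2 v) E; rewrite !h !(mulr0, addr0, add0r).
Qed.

Lemma three_ones (a b : F) : 1 + (1 + a) + (1 + b) = 1 + (a + b).
Proof.
transitivity (1 + (a + b) + (1 + 1)); first by ring.
by rewrite addF addr0.
Qed.

Section Hyperoval.
Variables (A1 A2 A3 : 'rV[F]_3) (e : nat).
Hypotheses (D0 : det3 A1 A2 A3 != 0) (e0 : (0 < e)%N) (eq : (2 ^ e <= #|F| - 2)%N) (pa : @pow_arc F (2 ^ e)).
Local Notation m := (2 ^ e)%N.
Local Notation h := (hpt A1 A2 A3 m).

(** The points of a hyperoval; true and false stand for the points A1 and A2 at infinity. *)
Definition opt (s : F + bool) : 'rV[F]_3 :=
  match s with inl x => h x | inr true => A1 | inr false => A2 end.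

Lemma bracket_hpt x y z : det3 (h x) (h y) (h z) = det3 A1 A2 A3 * slope_bracket (fun x => x ^+ m) x y z.
Proof.
transitivity (det3 A1 A2 A3 * ((x - z) * (y ^+ m - z ^+ m) - (y - z) * (x ^+ m - z ^+ m))).
  by rewrite /hpt; move: (x ^+ m) (y ^+ m) (z ^+ m) => a b c; rewrite /det3 !mxE; ring.
by rewrite !oppF /slope_bracket addrC; congr (_ * (_ + _)); exact: mulrC.
Qed.
Lemma bracket_A1 x y : det3 A1 (h x) (h y) = det3 A1 A2 A3 * (x + y) ^+ m.
Proof.
rewrite pow2D -[y ^+ m]oppF /hpt; move: (x ^+ m) (y ^+ m) => a b; rewrite /det3 !mxE; ring.
Qed.
Lemma bracket_A2 x y : det3 A2 (h x) (h y) = det3 A1 A2 A3 * (x + y).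
Proof.
transitivity (det3 A1 A2 A3 * (y - x)); last by rewrite oppF addrC.
rewrite /hpt; move: (x ^+ m) (y ^+ m) => a b; rewrite /det3 !mxE; ring.
Qed.
Lemma bracket_A1A2 x : det3 A1 A2 (h x) = det3 A1 A2 A3.
Proof. by rewrite /hpt; move: (x ^+ m) => a; rewrite /det3 !mxE; ring. Qed.

Lemma opt_arc : arc3 opt.
Proof.
have d1 x y : x != y -> det3 A1 (h x) (h y) != 0.
  by move=> xy; rewrite bracket_A1 mulf_neq0 // expf_neq0 // neq_add0.
have d2 x y : x != y -> det3 A2 (h x) (h y) != 0.
  by move=> xy; rewrite bracket_A2 mulf_neq0 // neq_add0.
have d3 x : det3 A1 A2 (h x) != 0 by rewrite bracket_A1A2.
have rot := det3rot ch2; have C23 := det3C23 ch2.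
move=> [x|[]] [y|[]] [z|[]] // xy xz yz; rewrite [opt _]/= [X in det3 _ X _]/= [X in det3 _ _ X]/=.
- by rewrite bracket_hpt mulf_neq0 // pa.
- by rewrite rot rot d1.
- by rewrite rot rot d2.
- by rewrite C23 rot rot d1.
- by rewrite rot d3.
- by rewrite C23 rot rot d2.
- by rewrite C23 rot d3.
- by rewrite d1.
- by rewrite C23 d3.
- by rewrite d3.
- by rewrite d2.
- by rewrite -rot d3.
- by rewrite rot C23 d3.
Qed.

Definition on_opt v := exists s c, c != 0 /\ v = c *: opt s.

Lemma on_affine X Y Z : Z != 0 -> on_opt (X *: A1 + Y *: A2 + Z *: A3) ->
  exists y, X = Z * y /\ Y = Z * y ^+ m.
Proof.
move=> Z0 [[y|[]] [c [c0]]] /=.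
- rewrite /hpt !scalerDr !scalerA => /(coord_inj D0)[-> -> ->]; by exists y.
- have -> : c *: A1 = c *: A1 + 0 *: A2 + 0 *: A3 by rewrite !scale0r !addr0.
  by move=> /(coord_inj D0)[_ _ z0]; rewrite z0 eqxx in Z0.
- have -> : c *: A2 = 0 *: A1 + c *: A2 + 0 *: A3 by rewrite !scale0r addr0 add0r.
  by move=> /(coord_inj D0)[_ _ z0]; rewrite z0 eqxx in Z0.
Qed.

(** In the affine plane in which U V is the line at infinity, the points are closed under
    sums of three, that is, they form a coset of a group of translations. *)
Definition translation_axis (on : 'rV[F]_3 -> Prop) U V := forall P1 P2 P3, on P1 -> on P2 -> on P3 ->
  det3 U V P1 != 0 -> det3 U V P1 = det3 U V P2 -> det3 U V P1 = det3 U V P3 -> on (P1 + P2 + P3).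

(** x -> x^m is additive. *)
Lemma chart_axis : translation_axis on_opt A1 A2.
Proof.
have aff v : on_opt v -> det3 A1 A2 v != 0 -> exists y c, c != 0 /\ v = c *: h y.
  case=> [[y|[]]] [c [c0]] /= -> n; first by exists y, c.
    by rewrite det3Z3 det3aba // mulr0 eqxx in n.
  by rewrite det3Z3 det3abb // mulr0 eqxx in n.
move=> P1 P2 P3 o1 o2 o3 n1 e2 e3; have n2 := n1; have n3 := n1.
rewrite e2 in n2; rewrite e3 in n3.
have [x [c [c0 E1]]] := aff _ o1 n1; have [y [c' [_ E2]]] := aff _ o2 n2.
have [z [c'' [_ E3]]] := aff _ o3 n3.
move: e2 e3; rewrite E1 E2 E3 !det3Z3 !bracket_A1A2 => /(mulIf D0) <- /(mulIf D0) <-.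
exists (inl (x + y + z)), c; split=> //=.
rewrite -!scalerDr; congr (_ *: _); rewrite /hpt !pow2D.
have E : A3 + A3 + A3 = A3.
  by rewrite -[X in X + X]scale1r -scalerDl addF scale0r add0r.
rewrite -[in RHS]E; apply/rowP => j; rewrite !mxE; ring.
Qed.

Lemma on_A1 : on_opt A1.
Proof. by exists (inr true), 1; rewrite oner_neq0 scale1r. Qed.
Lemma on_A2 : on_opt A2.
Proof. by exists (inr false), 1; rewrite oner_neq0 scale1r. Qed.
Lemma on_h c y : c != 0 -> on_opt (c *: h y).
Proof. by exists (inl y), c. Qed.
Lemma on_scale c v : c != 0 -> on_opt v -> on_opt (c *: v).
Proof. by move=> c0 [s [c' [c0' ->]]]; exists s, (c * c'); rewrite mulf_neq0 // scalerA. Qed.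

Lemma m_gt0 : (0 < m)%N. Proof. by rewrite expn_gt0. Qed.

(** The case v = 1 is that of additive_power. *)
Lemma additive_exponent n : (0 < n < #|F|)%N -> (forall u v : F, u != 0 -> v != 0 -> u != v ->
  (u + v) ^+ n = u ^+ n + v ^+ n) -> exists i, n = (2 ^ i)%N.
Proof.
move=> nq H; apply: (additive_power ch2 nq) => x.
case: (eqVneq x 0) => [->|x0].
  by rewrite add0r expr0n expr1n; case: n nq {H} => //= *; rewrite add0r.
case: (eqVneq x 1) => [->|x1]; last by rewrite H ?oner_neq0 // expr1n.
by rewrite addF expr0n expr1n addF; case: n nq {H}.
Qed.

(** Scaled to the axis, the points are A1 and
    u h(1/u + s) = A1 + u h(s) + u^(q-m) A2 for u <> 0. Being closed under sums of three
    means that u -> u^(q-m) is additive. *)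
Lemma axis_A2 s : translation_axis on_opt A2 (h s) -> exists i, (m + 2 ^ i = #|F|)%N.
Proof.
move=> ax; pose n := (#|F| - m)%N.
have nE (u : F) : u != 0 -> u ^+ n = u * u^-1 ^+ m.
  move=> u0; apply: (mulIf (expf_neq0 m u0)); rewrite -exprD subnK ?expf_card.
    by rewrite -mulrA -exprMn mulVf // expr1n mulr1.
  by move: eq q8; clear; lia.
have [|u v u0 v0 uv|i iE] := @additive_exponent n.
- by rewrite /n; move: eq q8 m_gt0; clear; lia.
- set w := u + v; have w0 : w != 0 by rewrite /w neq_add0.
  have := ax A1 (u *: h (u^-1 + s)) (v *: h (v^-1 + s)).
  rewrite !det3Z3 !bracket_A2 (det3C23 ch2) (det3C12 ch2) bracket_A1A2.
  have b y : y != 0 -> y * (det3 A1 A2 A3 * (s + (y^-1 + s))) = det3 A1 A2 A3.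
    by move=> y0; rewrite [s + _]addrC -addrA addF addr0 mulrCA mulfV // mulr1.
  rewrite !b // => /(_ on_A1 (on_h _ u0) (on_h _ v0) D0 erefl erefl).
  have -> : A1 + u *: h (u^-1 + s) + v *: h (v^-1 + s) = (1 + u * (u^-1 + s) + v * (v^-1 + s)) *: A1
      + (u * (u^-1 + s) ^+ m + v * (v^-1 + s) ^+ m) *: A2 + w *: A3.
    by rewrite /hpt; apply/rowP => j; rewrite !mxE /w; ring.
  case/(on_affine w0) => y [Xe Ye].
  have ye : y = w^-1 + s.
    apply: (mulfI w0); rewrite -Xe !mulrDr !mulfV // three_ones.
    by rewrite /w mulrDl.
  move: Ye; rewrite ye !pow2D !mulrDr !nE // => E.
  apply: (addIr (w * s ^+ m)); rewrite -E [in RHS]/w mulrDl.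
  by rewrite addrACA.
by exists i; rewrite -iE /n; move: eq q8; clear; lia.
Qed.

(** Scaled to the axis, the points are A2 and
    u^m h(1/u + s) = A2 + u^m h(s) + u^(m-1) A1 for u <> 0. So u -> u^(m-1) is additive,
    and m - 1 is a power of 2 like m. *)
Lemma axis_A1 s : translation_axis on_opt A1 (h s) -> m = 2%N.
Proof.
move=> ax.
have pm (u : F) : u * u ^+ m.-1 = u ^+ m by rewrite -exprS prednK // m_gt0.
have m1 : (1 < m)%N by case: e e0 => // e' _; rewrite expnS; have := expn_gt0 2 e'; clear; lia.
have [|u v u0 v0 uv|i iE] := @additive_exponent m.-1.
- by move: eq q8 m1; clear; lia.
- set w := u + v; have w0 : w != 0 by rewrite /w neq_add0.
  have n0 (y : F) : y != 0 -> y ^+ m != 0 by apply: expf_neq0.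
  have := ax A2 (u ^+ m *: h (u^-1 + s)) (v ^+ m *: h (v^-1 + s)).
  rewrite !det3Z3 !bracket_A1 (det3C23 ch2) bracket_A1A2.
  have b y : y != 0 -> y ^+ m * (det3 A1 A2 A3 * (s + (y^-1 + s)) ^+ m) = det3 A1 A2 A3.
    move=> y0; rewrite [s + _]addrC -addrA addF addr0 mulrCA -exprMn mulfV //.
    by rewrite expr1n mulr1.
  rewrite !b // => /(_ on_A2 (on_h _ (n0 _ u0)) (on_h _ (n0 _ v0)) D0 erefl erefl).
  have -> : A2 + u ^+ m *: h (u^-1 + s) + v ^+ m *: h (v^-1 + s) =
     (u ^+ m * (u^-1 + s) + v ^+ m * (v^-1 + s)) *: A1
      + (1 + u ^+ m * (u^-1 + s) ^+ m + v ^+ m * (v^-1 + s) ^+ m) *: A2 + w ^+ m *: A3.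
    rewrite /w pow2D /hpt; set p := (u^-1 + s) ^+ m; set p' := (v^-1 + s) ^+ m.
    by move: p p' (u ^+ m) (v ^+ m) => p p' a c; apply/rowP => j; rewrite !mxE; ring.
  case/(on_affine (n0 _ w0)) => y [Xe Ye].
  have ye : y = w^-1 + s.
    apply: (mulfI w0); apply: (@pow2_inj e); rewrite /= exprMn -Ye mulrDr mulfV // !pow2D expr1n.
    rewrite !mulrDr -!exprMn !mulfV // !expr1n three_ones.
    by rewrite -pow2D -mulrDl.
  move: Xe; rewrite ye -!pm !mulrDr -!mulrA ![_ ^+ m.-1 * _^-1]mulrC !mulrA !mulfV // !mul1r => E.
  apply: (addIr (w * w ^+ m.-1 * s)); rewrite -E (pm w) /w pow2D mulrDl -!pm addrACA.
  by [].
have : (2 ^ i).+1 = m by rewrite -iE prednK // m_gt0.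
case: e e0 => // e' _; rewrite expnS; case: i {iE} => [|i]; first by rewrite expn0; clear; lia.
by rewrite expnS; clear; lia.
Qed.

(** With d = s + s', the sum of A1, A2 and h(s + d z), scaled to the axis, is a point of
    the hyperoval only if z^(m m) = z. If this holds for all z, then every z + z^m is
    fixed by the m-th power, so it is 0 or 1 because no three points of the graph are
    collinear. This leaves only 4 values for z. *)
Lemma no_axis_off s s' : s != s' -> ~ translation_axis on_opt (h s) (h s').
Proof.
move=> ss ax; have [d dE] : exists d, d = s + s' by exists (s + s').
have d0 : d != 0 by rewrite dE neq_add0.
have dm0 : d ^+ m != 0 by apply: expf_neq0.
have sd : s' = s + d by rewrite dE addrA addF add0r.
have zm0 : 0 ^+ m = 0 :> F by rewrite expr0n (gtn_eqF m_gt0).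
have pz (z : F) : z != 0 -> z != 1 -> z + z ^+ m != 0.
  move=> z0 z1; have := pa z1 z0 (oner_neq0 F).
  by rewrite /slope_bracket zm0 expr1n !addr0 mulr1 mul1r addrC.
have fixmm (z : F) : (z ^+ m) ^+ m = z.
  case: (eqVneq z 0) => [->|z0]; first by rewrite !zm0.
  case: (eqVneq z 1) => [->|z1]; first by rewrite !expr1n.
  have k0 := pz _ z0 z1; set k := z + z ^+ m in k0.
  have K0 : d * d ^+ m * k != 0 by rewrite !mulf_neq0.
  have := ax ((d ^+ m)^-1 *: A1) (d^-1 *: A2) ((d * d ^+ m * k)^-1 *: h (s + d * z)).
  have o x : x + x = 0 := addF x.
  have aa (x y : F) : x + (x + y) = y by rewrite addrA addF add0r.
  have ab (x y w : F) : x + y + (x + w) = y + w by rewrite addrACA addF add0r.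
  have -> : det3 (h s) (h s') ((d * d ^+ m * k)^-1 *: h (s + d * z)) = det3 A1 A2 A3.
    rewrite det3Z3 bracket_hpt sd /slope_bracket !pow2D exprMn.
    have -> : (s ^+ m + (s ^+ m + d ^+ m * z ^+ m)) * (s + d + (s + d * z)) +
       (s ^+ m + d ^+ m + (s ^+ m + d ^+ m * z ^+ m)) * (s + (s + d * z)) = d * d ^+ m * k.
      rewrite !aa !ab /k.
      transitivity (d * d ^+ m * (z + z ^+ m) + d ^+ m * z ^+ m * d * z + d ^+ m * z ^+ m * d * z); first by ring.
      by rewrite -addrA o addr0.
    by rewrite mulrCA mulVf // mulr1.
  rewrite det3Z3 (det3rot ch2 (h s)) (det3rot ch2 (h s')) bracket_A1 -dE mulrCA mulVf // mulr1.
  rewrite det3Z3 (det3rot ch2 (h s)) (det3rot ch2 (h s')) bracket_A2 -dE mulrCA mulVf // mulr1.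
  move=> /(_ (on_scale _ on_A1) (on_scale _ on_A2) (on_h _ _) D0 erefl erefl).
  rewrite !invr_eq0 => /(_ dm0 d0 K0)/(on_scale K0).
  have -> : (d * d ^+ m * k) *: ((d ^+ m)^-1 *: A1 + d^-1 *: A2 + (d * d ^+ m * k)^-1 *: h (s + d * z)) =
     (d * k + s + d * z) *: A1 + (d ^+ m * k + (s + d * z) ^+ m) *: A2 + 1 *: A3.
    rewrite !scalerDr !scalerA mulfV // /hpt; set p := (_ + _) ^+ m.
    have -> : d * d ^+ m * k / d ^+ m = d * k by rewrite mulrAC mulfK.
    have -> : d * d ^+ m * k / d = d ^+ m * k by move: (d ^+ m) => dd; field.
    by move: p (d ^+ m) => p dd; apply/rowP => j; rewrite !mxE; ring.
  case/(on_affine (oner_neq0 F)) => y; rewrite !mul1r => -[<-].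
  rewrite -addrA !pow2D !exprMn => /addIr/(mulfI dm0).
  by rewrite /k pow2D addrC => /addrI/esym.
have fixm (z : F) : z ^+ m = z -> (z == 0) || (z == 1).
  move=> zm; case: (eqVneq z 0) => //= z0; case: (eqVneq z 1) => // z1.
  by have := pz _ z0 z1; rewrite zm addF eqxx.
have one (y : F) : y != 0 -> y != 1 -> y ^+ m = y + 1.
  move=> y0 y1; have := fixm (y + y ^+ m); rewrite pow2D fixmm addrC => /(_ erefl).
  rewrite (negPf (pz _ y0 y1)) /= => /eqP E.
  by rewrite -E addrA addF add0r.
have [y0] : exists y, y \notin [:: 0; 1 : F] by apply: pick_out; exact: leq_trans q8.
rewrite !inE negb_or => /andP[y00 y01].
have [y1] : exists y, y \notin [:: 0; 1; y0; y0 + 1 : F] by apply: pick_out; exact: leq_trans q8.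
rewrite !inE !negb_or => /and4P[y10 y11 y12 y13].
have := fixm (y1 + y0); rewrite pow2D !one // addrACA addF addr0 => /(_ erefl).
rewrite addr_eq0 oppF (negPf y12) /= => /eqP E.
by case/eqP: y13; rewrite -E addrCA addF addr0.
Qed.
End Hyperoval.
End Axes.

(** * The axes have a common end *)

Section CommonEnd.
Variable F : finFieldType.
Hypothesis ch2 : 2%N \in [pchar F].
Local Notation oppF := (oppF ch2).
Local Notation addF := (addF ch2).
Hypotheses (q8 : (8 <= #|F|)%N).
Let C12 := det3C12 ch2.
Let C23 := det3C23 ch2.
Let rot := det3rot ch2.

Section Base.
Variables (J : finType) (r : J -> 'rV[F]_3) (t : nat).
Hypotheses (arc_r : arc3 r) (cardJ : (#|J| + t = #|F| + 2)%N) (tJ : (t < #|J|)%N) (J3 : (2 < #|J|)%N).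

(** The hyperoval that completes the arc, described without coordinates. *)
Definition on_arc v := (exists R c, c != 0 /\ v = c *: r R) \/ extends r v.

(** In the coordinates (u, v, w) of r R with respect to U, V, A3, the function x is
    u v / w up to a factor and a linear form. *)
Definition polar U V (x : J -> F) := exists A3 al l, [/\ det3 U V A3 != 0, al != 0, linear_form l &
  forall R, det3 U V (r R) != 0 /\
    x R = al * (det3 (r R) V A3 * det3 U (r R) A3) / det3 U V (r R) + l (r R)].

Lemma polar_swap U V x : polar U V x -> polar V U x.
Proof.
case=> A3 [al [l [D0 al0 lf xE]]]; exists A3, al, l; rewrite C12; split=> // R.
have [w0 ->] := xE R; rewrite ![det3 V U _]C12; split=> //.
by rewrite [det3 (r R) U _]C12 [det3 V (r R) _]C12 [det3 U (r R) A3 * _]mulrC.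
Qed.

Lemma polar_scale U V c d x : c != 0 -> d != 0 -> polar (c *: U) (d *: V) x -> polar U V x.
Proof.
move=> c0 d0 [A3 [al [l [D0 al0 lf xE]]]]; exists A3, al, l.
have nz v : det3 (c *: U) (d *: V) v != 0 -> det3 U V v != 0.
  by rewrite det3Z1 det3Z2 mulrA mulf_eq0 negb_or => /andP[].
split; rewrite ?nz // => R; have [w0 ->] := xE R; have w1 := nz _ w0; split=> //.
rewrite !(det3Z1, det3Z2); congr (_ + _); field.
by rewrite w1 c0 d0.
Qed.

(** Another third point A3 changes u and v by multiples of w and by factors, so it changes
    u v / w by a linear form and a factor. *)
Lemma polar_relation U V x x' : polar U V x -> polar U V x' -> exists lam mu l,
  [/\ lam != 0, linear_form l & forall R, lam * x R + mu * x' R = l (r R)].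
Proof.
move=> [A [al [l [D0 al0 lf xE]]]] [A' [al' [l' [D0' al0' lf' xE']]]].
have AE := cramer3 U V A A'; set D := det3 U V A in D0 AE.
pose p := det3 A' V A / D; pose s := det3 U A' A / D; pose tau := det3 U V A' / D.
have {}AE : A' = p *: U + s *: V + tau *: A.
  by rewrite -[A'](scalerK D0) AE !scalerDr !scalerA /p /s /tau ![D^-1 * _]mulrC.
have tau0 : tau != 0 by rewrite mulf_neq0 ?invr_neq0.
exists (al' * tau ^+ 2), al, (fun v => al' * tau ^+ 2 * l v + al * l' v +
  al * al' * (p * s * det3 U V v + p * tau * det3 U v A + tau * s * det3 v V A)).
split; first exact: (mulf_neq0 al0' (expf_neq0 _ tau0)).
  by move=> c u v; rewrite lf lf' !(det3D1, det3D2, det3D3, det3Z1, det3Z2, det3Z3); ring.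
move=> R; have [w0 ->] := xE R; have [_ ->] := xE' R.
have -> : det3 (r R) V A' = p * det3 U V (r R) + tau * det3 (r R) V A.
  by rewrite AE !(det3D3, det3Z3) det3abb // mulr0 addr0 [det3 (r R) V U]rot [det3 V U _]C12.
have -> : det3 U (r R) A' = s * det3 U V (r R) + tau * det3 U (r R) A.
  by rewrite AE !(det3D3, det3Z3) det3aba // mulr0 add0r [det3 U (r R) V]C23.
move: w0; set w := det3 U V (r R); set u := det3 (r R) V A; set v := det3 U (r R) A => w0.
pose X := al * al' * (tau * tau * u * v / w).
transitivity ((X + X) + (al' * tau ^+ 2 * l (r R) + al * l' (r R) +
   al * al' * (p * s * w + p * tau * v + tau * s * u))); last by rewrite addF add0r.
by rewrite /X; field.
Qed.

Section Chart.
Variables (A1 A2 A3 : 'rV[F]_3) (e : nat) (k b : J -> F).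
Hypotheses (D0 : det3 A1 A2 A3 != 0) (e0 : (0 < e)%N) (eq : (2 ^ e <= #|F| - 2)%N) (pa : @pow_arc F (2 ^ e)).
Hypothesis rE : forall R, k R != 0 /\ r R = k R *: hpt A1 A2 A3 (2 ^ e) (b R).
Local Notation opt := (opt A1 A2 A3 e).
Let arc_o : arc3 opt := opt_arc ch2 D0 pa.

(** The parameters of the points of the hyperoval that are not on the arc. *)
Definition missing : {set F + bool} := ~: [set inl (b R) | R : J].

Lemma chart_inj : injective b.
Proof.
move=> R S bRS; apply/eqP; apply: contraTT (isT) => RS.
have [T] : exists T, T \notin [:: R; S] by apply: pick_out.
rewrite !inE negb_or => /andP[TR TS].
have := arc_r RS (k := T); rewrite eq_sym TR eq_sym TS => /(_ isT isT).
by have [_ ->] := rE R; have [_ ->] := rE S; rewrite bRS det3Z1 det3Z2 det3aab // !mulr0 eqxx.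
Qed.

Lemma card_missing : #|missing| = t.
Proof.
have cS : #|[set (inl (b R) : F + bool) | R : J]| = #|J|.
  by rewrite card_imset // => R S [] /chart_inj.
have := cardsC [set (inl (b R) : F + bool) | R : J]; rewrite cS card_sum card_bool.
by rewrite -/missing -cardJ => /addnI.
Qed.

Lemma missing_ext s : s \in missing -> extends r (opt s).
Proof.
rewrite inE => sM R S SR; have [kR ->] := rE R; have [kS ->] := rE S.
rewrite det3Z1 det3Z3 !mulf_neq0 //; apply: (arc_o (i := inl _) (k := inl _)).
- by apply: contraNneq sM => <-; apply: imset_f.
- by apply: contraNneq SR => -[/chart_inj ->].
- by apply: contraNneq sM => ->; apply: imset_f.
Qed.

Lemma opt_prop s s' c : opt s' = c *: opt s -> s = s'.
Proof.
move=> E; apply/eqP; apply: contraTT (isT) => ss.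
have [u] : exists u, u \notin [:: s; s'].
  by apply: pick_out; rewrite card_sum card_bool addn2 !ltnS (leq_trans _ q8).
rewrite !inE negb_or => /andP[us us'].
have := arc_o ss (k := u); rewrite eq_sym us eq_sym us' => /(_ isT isT).
by rewrite E det3Z2 det3aab // mulr0 eqxx.
Qed.

(** The t missing points have distinct labels in extends_code, so they take all of them. *)
Lemma ext_missing v : extends r v -> exists s c, [/\ s \in missing, c != 0 & v = c *: opt s].
Proof.
move=> ev; have [a [B [cB [aB aE]]]] := extends_code ch2 arc_r cardJ tJ J3.
have ai : {in missing &, injective (a \o opt)}.
  move=> s s' sM sM' /= E.
  by have [c cE] := aE _ _ (missing_ext sM) (missing_ext sM') E; apply: opt_prop cE.
have im : (a \o opt) @: missing = B.
  apply/eqP; rewrite eqEcard card_in_imset // card_missing cB leqnn andbT.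
  by apply/subsetP => y /imsetP[s sM ->]; apply/aB/missing_ext.
have := aB _ ev; rewrite -im => /imsetP[s sM E].
have [c cE] := aE _ _ (missing_ext sM) ev (esym E).
exists s, c; split=> //; have := extends_nz J3 ev.
by rewrite cE; apply: contraNneq => ->; rewrite scale0r.
Qed.

(** So the hyperoval of a chart does not depend on the chart. *)
Lemma on_chart v : on_arc v <-> on_opt A1 A2 A3 e v.
Proof.
split=> [[[R [c [c0 ->]]]|ev]|[s [c [c0 ->]]]].
- have [kR ->] := rE R; exists (inl (b R)), (c * k R); rewrite scalerA; split=> //.
  exact: mulf_neq0.
- by have [s [c [_ c0 ->]]] := ext_missing ev; exists s, c.
case: (boolP (s \in missing)) => [sM|].
  right=> R S SR; have := missing_ext sM SR.
  by move=> ne; rewrite det3Z2 mulf_neq0.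
rewrite inE negbK => /imsetP[R _ ->]; left; exists R, (c / k R).
have [kR ->] := rE R; rewrite scalerA divfK //; split=> //.
by rewrite mulf_neq0 ?invr_neq0.
Qed.
End Chart.
End Base.

Section Star.
Variables (T J : finType) (r : J -> 'rV[F]_3) (x : T -> J -> F).
Hypotheses (q_even : ~~ odd #|F|) (q3 : ~~ (3 %| #|F|)%N) (q4 : (4 %| #|F|)%N).
Hypotheses (cardJ : (#|J| + #|T| = #|F| + 2)%N) (t3 : (#|T| ^ 3 <= #|F|)%N).
Hypothesis arcs : forall a, arc4 (lifted r (x a)).
Hypothesis indep : forall a a', a != a' -> forall lam mu l, linear_form l ->
  (forall R, lam * x a R + mu * x a' R = l (r R)) -> lam = 0.

Lemma axis_swap on U V : @translation_axis F on U V -> translation_axis on V U.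
Proof. by move=> ax P1 P2 P3; rewrite ![det3 V U _]C12; apply: ax. Qed.

Lemma axis_scale on U V c d : c != 0 -> d != 0 -> @translation_axis F on (c *: U) (d *: V) ->
  translation_axis on U V.
Proof.
move=> c0 d0 ax P1 P2 P3 o1 o2 o3 n e1 e2; apply: ax => //; rewrite !(det3Z1, det3Z2) ?mulf_neq0 //; congruence.
Qed.

(** Every a gives an axis of the hyperoval with both ends among the t missing points. In
    the chart of a0 all these axes have the end z, which is A1 if m = 2 and A2 otherwise, by
    axis_A1, axis_A2 and no_axis_off. By polar_relation and indep the other ends are
    distinct, but there are only t - 1 points for them. *)
Lemma no_common_charts : (0 < #|T|)%N -> False.
Proof.
move=> /card_gt0P[a0 _].
have t_lt : (#|T| * 2 < #|F|)%N.
  move: t3 q8; rewrite !expnS expn0 muln1; move: #|T| #|F| => t q; clear.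
  by case: (leqP t 2) => h; nia.
have tJ : (#|T| < #|J|)%N by move: cardJ t_lt; clear; lia.
have J3 : (2 < #|J|)%N by move: cardJ t_lt q8; clear; lia.
have arc_r : arc3 r := base_arc (arcs a0).
have [A1 [A2 [A3 [l0 [e [al0 [k [b [D0 [e0 eq pa] _ rE _]]]]]]]]] :=
  planar_chart ch2 q_even q8 q3 (arcs a0) cardJ t3.
pose Ms := missing b; pose opt := opt A1 A2 A3 e.
pose z : F + bool := inr ((2 ^ e)%N == 2%N).
have onE v := on_chart arc_r cardJ tJ J3 D0 pa rE v.
have edge a : exists s s', [/\ s \in Ms, s' \in Ms, s != s', polar r (opt s) (opt s') (x a) &
    translation_axis (on_opt A1 A2 A3 e) (opt s) (opt s')].
  have [B1 [B2 [B3 [l [e' [al [k' [b' [D0' [e0' eq' pa'] [al0' lf] rE' xE]]]]]]]]] :=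
    planar_chart ch2 q_even q8 q3 (arcs a) cardJ t3.
  have onE' v := on_chart arc_r cardJ tJ J3 D0' pa' rE' v.
  have e1 : extends r B1.
    by apply: (missing_ext arc_r J3 D0' pa' rE' (s := inr true)); rewrite inE; apply/imsetP => -[].
  have e2 : extends r B2.
    by apply: (missing_ext arc_r J3 D0' pa' rE' (s := inr false)); rewrite inE; apply/imsetP => -[].
  have [s [c [sM c0 E1]]] := ext_missing arc_r cardJ tJ J3 D0 pa rE e1.
  have [s' [d [sM' d0 E2]]] := ext_missing arc_r cardJ tJ J3 D0 pa rE e2.
  exists s, s'; split=> //.
  - by apply: contraNneq D0' => ss; rewrite E1 E2 ss det3Z1 det3Z2 det3aab // !mulr0.
  - apply: (polar_scale c0 d0); rewrite -E1 -E2; exists B3, (al / det3 B1 B2 B3), l.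
    split=> // [|R]; first by rewrite mulf_neq0 ?invr_neq0.
    have [kR rR] := rE' R; rewrite xE rR !(det3Z1, det3Z2, det3Z3) bracket_A1A2 /hpt.
    rewrite !(det3D1, det3D2, det3Z1, det3Z2) !(det3aab, det3aba, det3abb) //.
    rewrite !(mulr0, addr0, add0r) exprS; split; first by rewrite mulf_neq0.
    by congr (_ + _); field; rewrite kR D0'.
  - apply: (axis_scale c0 d0); rewrite -E1 -E2 => P1 P2 P3 o1 o2 o3 n n1 n2.
    apply/onE/onE'; apply: (chart_axis ch2 D0') => //; by apply/onE'/onE.
have star a : exists s, [/\ s \in Ms, s != z & polar r (opt z) (opt s) (x a)].
  have [s [s' [sM sM' ss po ax]]] := edge a.
  have via1 y : translation_axis (on_opt A1 A2 A3 e) A1 (hpt A1 A2 A3 (2 ^ e) y) -> z = inr true.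
    by move=> /(axis_A1 ch2 q8 D0 e0 eq) m2; rewrite /z m2.
  have via2 y : translation_axis (on_opt A1 A2 A3 e) A2 (hpt A1 A2 A3 (2 ^ e) y) -> z = inr false.
    move=> /(axis_A2 ch2 q8 D0 eq)[i iE]; rewrite /z; case: eqP => // m2.
    move: iE q4 q8; rewrite m2; case: i => [|[|i]]; rewrite ?expnS ?expn0; move: #|F| => q; clear; lia.
  have po' := polar_swap po; have ax' := axis_swap ax.
  move: ss po ax po' ax' sM sM'; rewrite /opt.
  case: s => [y|[]]; case: s' => [y'|[]] // ss po ax po' ax' sM sM'.
  - by case: (no_axis_off ch2 q8 D0 pa (s := y) (s' := y')).
  - by exists (inl y); rewrite (via1 _ ax'); split.
  - by exists (inl y); rewrite (via2 _ ax'); split.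
  - by exists (inl y'); rewrite (via1 _ ax); split.
  - by rewrite /z; case: eqP => _; [exists (inr false)|exists (inr true)]; split.
  - by exists (inl y'); rewrite (via2 _ ax); split.
  - by rewrite /z; case: eqP => _; [exists (inr false)|exists (inr true)]; split.
have [f fP] := fin_all_exists star.
have fi : injective f.
  move=> a a' E; apply/eqP; apply: contraTT (isT) => aa.
  have [_ _ p1] := fP a; have [_ _ p2] := fP a'; rewrite -E in p2.
  have [lam [mu [l [lam0 lf rel]]]] := polar_relation p1 p2.
  by rewrite (indep aa lf rel) eqxx in lam0.
have zM : z \in Ms by rewrite inE; apply/imsetP => -[].
have : (#|T| <= #|Ms :\ z|)%N.
  rewrite -(card_imset _ fi) subset_leq_card //; apply/subsetP => s /imsetP[a _ ->].
  by have [sM sz _] := fP a; rewrite !inE sz; move: sM; rewrite inE.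
have := cardsD1 z Ms; rewrite zM (card_missing arc_r cardJ J3 rE).
by move=> ->; rewrite add1n ltnn.
Qed.
End Star.
End CommonEnd.

(** * Functions with few slopes *)

Section Slopes.
Variable F : finFieldType.

(** Suppose that the graph of g is not a line. Then a line contains fewer points of it than
    there are slopes, because a point Q of the graph off the line sees them in distinct
    directions, other than the direction of the line. So at most t + 1 lines through the
    point over 0 have at most t - 1 further points each, and q <= t^2. *)
Lemma few_slopes_affine (g : F -> F) (N : {set F}) t : (0 < t)%N ->
  (forall a b, a != b -> (g a - g b) / (a - b) \in N) -> (#|N| <= t.+1)%N -> (t * t < #|F|)%N ->
  forall a, g a = g 0 + a * (g 1 - g 0).
Proof.
move=> t0 gN cN tq x; apply/eqP; apply: contraTT (isT) => nx.
have short m (L : {set F}) : m \in N -> (1 < #|L|)%N ->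
    {in L &, forall a b, g a - g b = m * (a - b)} -> (#|L| <= t)%N.
  move=> mN L1 LE.
  have /card_gt0P[P PL] : (0 < #|L|)%N by apply: leq_trans L1.
  have [Q nQ] : exists Q, g Q - g P != m * (Q - P).
    apply/existsP; apply: contraNT nx; rewrite negb_exists => /forallP al.
    have E a : g a = g P + m * (a - P).
      by have := al a; rewrite negbK => /eqP <-; rewrite addrC subrK.
    by apply/eqP; rewrite (E x) (E 0) (E 1); ring.
  have nQ' a : a \in L -> g a - g Q != m * (a - Q).
    move=> aL; apply: contra nQ => /eqP e; apply/eqP.
    have := LE _ _ aL PL => e'.
    have -> : g Q - g P = (g a - g P) - (g a - g Q) by ring.
    by rewrite e e'; ring.
  have aQ a : a \in L -> a - Q != 0.
    by move=> aL; rewrite subr_eq0; apply: contraNneq (nQ' _ aL) => ->; rewrite !subrr mulr0.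
  pose s a := (g a - g Q) / (a - Q).
  have si : {in L &, injective s}.
    move=> a b aL bL e; apply/eqP; apply: contraTT (isT) => ab.
    have ea : g a - g Q = s a * (a - Q) by rewrite /s divfK ?aQ.
    have eb : g b - g Q = s a * (b - Q) by rewrite e /s divfK ?aQ.
    have : (m - s a) * (a - b) == 0.
      rewrite mulrBl -(LE _ _ aL bL).
      have -> : g a - g b = (g a - g Q) - (g b - g Q) by ring.
      by rewrite ea eb; apply/eqP; ring.
    rewrite mulf_eq0 !subr_eq0 (negPf ab) orbF => /eqP ms.
    by have := nQ' _ aL; rewrite ms ea eqxx.
  have : (#|s @: L| <= #|N :\ m|)%N.
    apply/subset_leq_card/subsetP => _ /imsetP[a aL ->]; rewrite !inE gN; last by rewrite -subr_eq0 aQ.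
    rewrite andbT; apply: contra (nQ' _ aL) => /eqP <-; by rewrite /s divfK ?aQ.
  rewrite card_in_imset //; have := cardsD1 m N; rewrite mN; move: cN; clear; lia.
have [a|| m mN mE] := @pigeonhole _ _ [set~ 0] N (fun a => (g a - g 0) / (a - 0)) t.-1.
- by rewrite !inE => /gN.
- rewrite cardsC1; have : (#|N| * t.-1 <= t.+1 * t.-1)%N by rewrite leq_mul2r cN orbT.
  by move: tq t0; clear; move: #|F| #|N| => q n; nia.
set X := [set a in _ | _] in mE.
have X0 : 0 \notin X by rewrite !inE eqxx.
have XE a : a \in X -> g a - g 0 = m * a.
  by rewrite !inE => /andP[a0 /eqP <-]; rewrite subr0 divfK.
have := short m (0 |: X) mN; rewrite cardsU1 X0 add1n => h.
have : (t < #|X|.+1)%N by move: mE t0; clear; lia.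
have X1 : (1 < #|X|.+1)%N by move: mE; clear; lia.
rewrite ltnNge (h X1) // => a b {h}; rewrite !in_setU1 => aX bX.
have E c : (c == 0) || (c \in X) -> g c - g 0 = m * c.
  by case/orP => [/eqP ->|]; [rewrite subrr mulr0|exact: XE].
have -> : g a - g b = (g a - g 0) - (g b - g 0) by ring.
by rewrite !E //; ring.
Qed.

(** The slope of y in the direction i is an affine function in every other direction j;
    as it has no zero, it is constant. *)
Lemma separately_linear d (y : 'rV[F]_d -> F) : y 0 = 0 ->
  (forall w i, exists s, s != 0 /\ forall a, y (w + a *: delta_mx 0 i) = y w + a * s) ->
  exists c : 'cV[F]_d, forall u, y u = (u *m c) ord0 ord0.
Proof.
move=> y0 yE.
pose s i w := y (w + delta_mx 0 i) - y w.
have sE i w a : y (w + a *: delta_mx 0 i) = y w + a * s i w.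
  have [m [_ mE]] := yE w i; rewrite mE /s; congr (_ + _ * _).
  by have := mE 1; rewrite scale1r mul1r => ->; rewrite addrC addKr.
have s0 i w : s i w != 0.
  have [m [m0 mE]] := yE w i; suff -> : s i w = m by [].
  by rewrite /s; have := mE 1; rewrite scale1r mul1r => ->; rewrite addrC addKr.
have sc i j w b : s i (w + b *: delta_mx 0 j) = s i w.
  case: (eqVneq i j) => [<-|ij].
    rewrite {1}/s; have -> : w + b *: delta_mx 0 i + delta_mx 0 i = w + (b + 1) *: delta_mx 0 i.
      by rewrite scalerDl scale1r addrA.
    by rewrite !sE; ring.
  have E c : s i (w + c *: delta_mx 0 j) = s i w + c * (s j (w + delta_mx 0 i) - s j w).
    rewrite {1}/s; have -> : w + c *: delta_mx 0 j + delta_mx 0 i = w + delta_mx 0 i + c *: delta_mx 0 j by rewrite addrAC.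
    by rewrite !sE /s; ring.
  case: (eqVneq (s j (w + delta_mx 0 i) - s j w) 0) => [e|ne]; first by rewrite E e mulr0 addr0.
  move: ne E; set p := _ - _ => ne E; have := E (- (s i w / p)).
  by rewrite mulNr divfK // subrr => e; have := s0 i (w + - (s i w / p) *: delta_mx 0 j); rewrite e eqxx.
have sw i w : s i w = s i 0.
  have sum_i (r : seq 'I_d) : s i (\sum_(j <- r) w ord0 j *: delta_mx 0 j) = s i 0.
    elim: r => [|j r IH]; first by rewrite big_nil.
    by rewrite big_cons addrC sc.
  by rewrite -[RHS](sum_i (index_enum _)) -row_sum_delta.
exists (\col_i s i 0) => u.
have sum_y (r : seq 'I_d) : y (\sum_(j <- r) u ord0 j *: delta_mx 0 j) = \sum_(j <- r) u ord0 j * s j 0.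
  elim: r => [|j r IH]; first by rewrite !big_nil.
  by rewrite !big_cons addrC sE IH sw addrC.
rewrite {1}[u]row_sum_delta sum_y mxE; apply: eq_bigr => j _.
by rewrite mxE.
Qed.
End Slopes.

(** * The level set is a hyperplane *)

Lemma leq_card_sum (I : finType) (Z : {set I}) (P : pred I) :
  {in Z, forall i, P i} -> (#|Z| <= \sum_i P i)%N.
Proof.
move=> ZP; rewrite -sum1_card big_mkcond /=; apply: leq_sum => i _.
by case: ifP => // /ZP ->.
Qed.

Section Codim.
Variables (F : finFieldType) (t : nat) (K : finType) (g : K -> 'cV[F]_(t + 3)) (f : 'rV[F]_(t + 3) -> F).
Hypotheses (t0 : (0 < t)%N) (tq : (t * t < #|F|)%N) (cardK : (#|K| + (t + 3) = #|F|.+1)%N).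
Local Notation ev u k := ((u *m g k) ord0 ord0).
Hypothesis sep : forall u v : 'rV[F]_(t + 3), u != v -> (\sum_i (u ord0 i == v ord0 i) +
  \sum_k (ev u k == ev v k) + (f u == f v) < t + 3)%N.
Let e (i : 'I_(t + 3)) : 'rV[F]_(t + 3) := delta_mx 0 i.
Let l : 'I_(t + 3) := rshift t ord0.

Lemma agree_bound (u v : 'rV[F]_(t + 3)) (A : {set 'I_(t + 3)}) (B : {set K}) : u != v ->
  (forall i, i \notin A -> u ord0 i = v ord0 i) -> {in B, forall k, ev u k = ev v k} ->
  (#|B| + (f u == f v) < #|A|)%N.
Proof.
move=> uv hA hB; have := sep uv.
have := @leq_card_sum _ (~: A) (fun i => u ord0 i == v ord0 i).
have := @leq_card_sum _ B (fun k => ev u k == ev v k).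
have h1 : {in ~: A, forall i, u ord0 i == v ord0 i} by move=> i; rewrite inE => /hA ->.
have h2 : {in B, forall k, ev u k == ev v k} by move=> k /hB ->.
have := cardsC A; rewrite card_ord => cA /(_ h2) a /(_ h1) b.
move: cA a b; set s := (\sum_i _)%N; set s' := (\sum_k _)%N; clear; case: (_ == _) => /=; lia.
Qed.

Lemma ev_0 k : ev (0 : 'rV[F]_(t + 3)) k = 0. Proof. by rewrite mul0mx mxE. Qed.
Lemma ev_D (u v : 'rV[F]_(t + 3)) k : ev (u + v) k = ev u k + ev v k. Proof. by rewrite mulmxDl mxE. Qed.
Lemma ev_Z a (u : 'rV[F]_(t + 3)) k : ev (a *: u) k = a * ev u k. Proof. by rewrite -scalemxAl mxE. Qed.
Lemma ev_e i k : ev (e i) k = g k i (ord0 : 'I_1).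
Proof. by rewrite -rowE mxE. Qed.

Lemma e_nz i : e i != 0.
Proof. by apply/eqP => /rowP/(_ i); rewrite !mxE !eqxx => /eqP; rewrite oner_eq0. Qed.

Lemma g_nz k i : g k i (ord0 : 'I_1) != 0.
Proof.
apply/eqP => gi.
have := @agree_bound (e i) 0 [set i] [set k] (e_nz i); rewrite !cards1 => H.
have : (1 + (f (e i) == f 0) < 1)%N.
  apply: H => [j|k']; rewrite !inE; first by rewrite !mxE => /negPf ->.
  by move/eqP => ->; rewrite ev_e gi mul0mx mxE.
by [].
Qed.

Lemma shiftE (u : 'rV[F]_(t + 3)) i a c : (u + a *: e i) ord0 c = u ord0 c + a *+ (c == i).
Proof. by rewrite !mxE mulr_natr. Qed.

Lemma line_inj (u : 'rV[F]_(t + 3)) a b : f (u + a *: e l) = f (u + b *: e l) -> a = b.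
Proof.
move=> ff; apply/eqP; apply: contraTT (isT) => ab.
have uv : u + a *: e l != u + b *: e l.
  by rewrite (inj_eq (addrI u)) -subr_eq0 -scalerBl scaler_eq0 subr_eq0 (negPf ab) (negPf (e_nz _)).
have := @agree_bound _ _ [set l] set0 uv; rewrite cards0 cards1 ff eqxx => H.
have : (0 + true < 1)%N; last by [].
apply: H => [c|k]; rewrite !inE // => /negPf cl.
by rewrite !shiftE cl !mulr0n.
Qed.

(** On a line in the direction e l, the symbol f takes every value once. *)
Lemma level_height : exists y : 'rV[F]_(t + 3) -> F,
  (forall u, f (u + y u *: e l) = f 0) /\ forall u b, f (u + b *: e l) = f 0 -> b = y u.
Proof.
have ex (u : 'rV[F]_(t + 3)) : exists b, f (u + b *: e l) = f 0.
  have inj : injective (fun b => f (u + b *: e l)) by move=> a b; apply: line_inj.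
  by have [h _ hK] := injF_bij inj; exists (h (f 0)); rewrite hK.
have [y yE] := fin_all_exists ex; exists y; split=> // u b E.
by apply: (@line_inj u); rewrite E yE.
Qed.

(** Two points of the level set that differ in the coordinates i and l only are not
    joined by a line of slope 0 or - g_ki / g_kl, since they would agree in too many
    positions. This leaves t + 1 slopes for y in the direction i. *)
Lemma level_linear : exists c : 'cV[F]_(t + 3), forall u : 'rV[F]_(t + 3), u != 0 ->
  (\sum_i (u ord0 i == 0%R) + \sum_k (ev u k == 0%R) + ((u *m c) ord0 ord0 == 0%R) < t + 3)%N.
Proof.
have [y [yE yU]] := level_height.
have y0 : y 0 = 0 by symmetry; apply: yU; rewrite scale0r addr0.
have yl u a : y (u + a *: e l) = y u - a.
  by symmetry; apply: yU; rewrite -addrA -scalerDl [a + _]addrC subrK yE.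
have [c cE] : exists c : 'cV[F]_(t + 3), forall u, y u = (u *m c) ord0 ord0.
  apply: separately_linear => // u i.
  case: (eqVneq i l) => [->|il].
    by exists (-1); rewrite oppr_eq0 oner_eq0; split=> // a; rewrite yl mulrN1.
  pose bad := [set - (g k i (ord0 : 'I_1) / g k l (ord0 : 'I_1)) | k : K].
  pose N := ~: (0 |: bad).
  pose h a := y (u + a *: e i).
  have hN a b : a != b -> (h a - h b) / (a - b) \in N.
    move=> ab; have ab0 : a - b != 0 by rewrite subr_eq0.
    pose p := u + a *: e i + h a *: e l; pose p' := u + b *: e i + h b *: e l.
    have fp : f p == f p' by rewrite /p /p' !yE eqxx.
    have pp : p != p'.
      apply/eqP => /rowP/(_ i); rewrite !shiftE eqxx (negPf il) !mulr0n !addr0 !mulr1n => /addrI/eqP.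
      by rewrite (negPf ab).
    have pi c : c \notin [set i; l] -> p ord0 c = p' ord0 c.
      by rewrite !inE negb_or !shiftE => /andP[/negPf -> /negPf ->].
    rewrite !inE negb_or; apply/andP; split.
      rewrite mulf_eq0 invr_eq0 (negPf ab0) orbF subr_eq0; apply/eqP => hh.
      have := @agree_bound p p' [set i] set0 pp; rewrite cards0 cards1 fp => H.
      have : (0 + true < 1)%N; last by [].
      apply: H => [c|k]; rewrite !inE // => /negPf ci.
      by rewrite !shiftE ci hh.
    apply/imsetP => -[k _ E].
    have := @agree_bound p p' [set i; l] [set k] pp pi; rewrite cards2 il cards1 fp => H.
    have : (1 + true < (true).+1)%N; last by [].
    apply: H => k'; rewrite inE => /eqP ->; rewrite !ev_D !ev_Z !ev_e.
    have gl := g_nz k l; have {}E : h a - h b = - (g k i (ord0 : 'I_1) / g k l (ord0 : 'I_1)) * (a - b).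
      by rewrite -E divfK.
    apply/eqP; rewrite -subr_eq0; apply/eqP.
    transitivity ((a - b) * g k i (ord0 : 'I_1) + (h a - h b) * g k l (ord0 : 'I_1)); first by ring.
    by rewrite E; field.
  have cN : (#|N| <= t.+1)%N.
    have zb : 0 \notin bad.
      apply/imsetP => -[k _ /esym/eqP]; rewrite oppr_eq0 mulf_eq0 invr_eq0.
      by rewrite (negPf (g_nz _ _)) (negPf (g_nz _ _)).
    rewrite card_complF cardsU1 zb card_imset; first by rewrite (_ : (true + #|K|)%N = #|K|.+1) //; move: cardK; clear; lia.
    move=> k k' E; apply/eqP; apply: contraTT (isT) => kk.
    pose v := e i + (- (g k i (ord0 : 'I_1) / g k l (ord0 : 'I_1))) *: e l.
    have v0 : v != 0.
      apply/eqP => /rowP/(_ i); rewrite shiftE !mxE !eqxx (negPf il) addr0 => /eqP.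
      by rewrite oner_eq0.
    have := @agree_bound v 0 [set i; l] [set k; k'] v0; rewrite !cards2 il kk => H.
    suff : (2 + (f v == f 0) < 2)%N by [].
    apply: H => [c|k2]; rewrite !inE.
      by rewrite negb_or shiftE !mxE => /andP[/negPf -> /negPf ->]; rewrite addr0.
    have gv k3 : - (g k i (ord0 : 'I_1) / g k l (ord0 : 'I_1)) = - (g k3 i (ord0 : 'I_1) / g k3 l (ord0 : 'I_1)) ->
       ev v k3 = 0.
      by rewrite /v => ->; rewrite ev_D ev_Z !ev_e mulNr divfK ?g_nz // subrr.
    by rewrite ev_0 => /orP[] /eqP ->; apply: gv.
  exists (h 1 - h 0); split.
    have := hN 1 0 (oner_neq0 F); rewrite subr0 divr1 => n1; apply/eqP => h0.
    by rewrite h0 !inE eqxx in n1.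
  move=> a; have := few_slopes_affine t0 hN cN tq a.
  by rewrite /h scale0r addr0.
exists c => u u0; rewrite -cE.
have sep0 : (\sum_i (u ord0 i == (0%R : 'rV[F]_(t + 3)) ord0 i) + \sum_k (ev u k == ev (0%R : 'rV[F]_(t + 3)) k) =
   \sum_i (u ord0 i == 0%R) + \sum_k (ev u k == 0%R))%N.
  congr (_ + _)%N; apply: eq_bigr => i _; first by rewrite mxE.
  by rewrite ev_0.
case: (eqVneq (y u) 0) => yu.
  have fu : f u = f 0 by have := yE u; rewrite yu scale0r addr0.
  by have := sep u0; rewrite fu eqxx sep0.
have := sep u0; rewrite sep0 addn0; apply: leq_ltn_trans; exact: leq_addr.
Qed.
End Codim.

(** * No long arc *)

Section LongArc.
Variable F : finFieldType.
Hypothesis ch2 : 2%N \in [pchar F].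
Hypotheses (q8 : (8 <= #|F|)%N) (q_even : ~~ odd #|F|) (q3 : ~~ (3 %| #|F|)%N) (q4 : (4 %| #|F|)%N).
Variables (t : nat) (K : finType) (g : K -> 'cV[F]_(t + 3)).
Hypotheses (t0 : (0 < t)%N) (t3 : (t ^ 3 <= #|F|)%N) (cardK : (#|K| + (t + 3) = #|F| + 2)%N).
Hypothesis few_zeros : forall u : 'rV[F]_(t + 3), u != 0 ->
  (\sum_i (u ord0 i == 0%R) + \sum_k ((u *m g k) ord0 ord0 == 0%R) < t + 3)%N.

Let J := ('I_3 + K)%type.
Let r (R : J) : 'rV[F]_3 := match R with inl i => delta_mx 0 i | inr k => \row_i g k (rshift t i) ord0 end.
Let x (a : 'I_t) (R : J) : F := match R with inl _ => 0 | inr k => g k (lshift 3 a) ord0 end.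
Let value (al : 'I_t -> F) (be : 'I_3 -> F) (R : J) := \sum_a al a * x a R + \sum_i be i * r R ord0 i.

Lemma few_val_zeros al be : (exists a, al a != 0) \/ (exists i, be i != 0) ->
  (\sum_a (al a == 0%R) + \sum_R (value al be R == 0%R) < t + 3)%N.
Proof.
move=> nz; pose u : 'rV[F]_(t + 3) := row_mx (\row_a al a) (\row_i be i).
have ul a : u ord0 (lshift 3 a) = al a by rewrite row_mxEl mxE.
have ur i : u ord0 (rshift t i) = be i by rewrite row_mxEr mxE.
have u0 : u != 0.
  apply/eqP => /rowP uE; case: nz => -[i /eqP]; apply.
    by rewrite -ul uE mxE.
  by rewrite -ur uE mxE.
have := few_zeros u0; rewrite big_split_ord /= big_sumType /= addnA.
have -> : (\sum_i (u ord0 (lshift 3 i) == 0%R) = \sum_a (al a == 0%R))%N.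
  by apply: eq_bigr => i _; rewrite ul.
have -> : (\sum_i (u ord0 (rshift t i) == 0%R) = \sum_i (value al be (inl i) == 0%R))%N.
  apply: eq_bigr => i _; rewrite ur /value /= big1 ?add0r => [|a _]; last by rewrite mulr0.
  rewrite (bigD1 i) //= mxE !eqxx mulr1 big1 ?addr0 // => j ji.
  by rewrite mxE (negPf ji) andbF mulr0.
have -> : (\sum_k ((u *m g k) ord0 ord0 == 0%R) = \sum_k (value al be (inr k) == 0%R))%N.
  apply: eq_bigr => k _; rewrite mxE big_split_ord /= /value /=; congr (nat_of_bool (_ + _ == _)).
    by apply: eq_bigr => a _; rewrite ul.
  by apply: eq_bigr => a _; rewrite ur mxE.
by [].
Qed.

Lemma cardJ : (#|{: J}| + #|'I_t| = #|F| + 2)%N.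
Proof. by rewrite card_sum !card_ord -cardK addnC addnA [(t + 3 + _)%N]addnC. Qed.

Lemma linear_form_sum (l : 'rV[F]_3 -> F) v : linear_form l ->
  l v = \sum_i v ord0 i * l (delta_mx 0 i).
Proof.
move=> lf; have l0 : l 0 = 0 by have := lf (-1) 0 0; rewrite scaler0 addr0 mulN1r addNr.
rewrite {1}[v]row_sum_delta; elim: (index_enum _) => [|i s IH]; first by rewrite !big_nil.
by rewrite !big_cons lf IH.
Qed.

Lemma sum_delta a lam R : \sum_b (lam *+ (b == a)) * x b R = lam * x a R.
Proof.
rewrite (bigD1 a) //= eqxx mulr1n big1 ?addr0 // => b /negPf ba.
by rewrite ba mulr0n mul0r.
Qed.

(** The relation gives a nonzero functional with value 0 at all the points over J. *)
Lemma charts_indep (a a' : 'I_t) : a != a' -> forall lam mu l, linear_form l ->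
  (forall R, lam * x a R + mu * x a' R = l (r R)) -> lam = 0.
Proof.
move=> aa lam mu l lf E; apply/eqP; apply: contraTT (isT) => lam0.
pose al b := lam *+ (b == a) + mu *+ (b == a').
pose be i := - l (delta_mx 0 i).
have nz : (exists b, al b != 0) \/ (exists i, be i != 0).
  by left; exists a; rewrite /al eqxx (negPf aa) addr0.
have v0 R : value al be R = 0.
  rewrite /value /al; under eq_bigr do rewrite mulrDl.
  rewrite big_split /= !sum_delta E (linear_form_sum _ lf) -big_split big1 // => i _.
  by rewrite /= /be mulNr mulrC subrr.
have := few_val_zeros nz; rewrite [X in (_ + X)%N](eq_bigr (fun=> 1%N)) => [|R _]; last by rewrite v0 eqxx.
rewrite sum1_card; move=> /(leq_ltn_trans (leq_addl _ _)).
have := cardJ; rewrite card_ord.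
move: t3 q8; rewrite !expnS expn0 muln1; move: #|F| #|{: J}| t; clear => q n t.
by case: (leqP t 2) => h; nia.
Qed.

Lemma sum_option (V : finType) (h : option V -> nat) :
  (\sum_o h o = h None + \sum_v h (Some v))%N.
Proof.
rewrite (bigD1 None) //=; congr (_ + _)%N.
rewrite (reindex_omap Some id) /=; last by case.
by apply: eq_bigl => v; rewrite eqxx.
Qed.

(** A functional of the four coordinates that vanishes at four vectors of the arc vanishes
    at the t - 1 unit vectors other than a as well, which makes t + 3 zeros. *)
Lemma charts_arc a : arc4 (lifted r (x a)).
Proof.
pose L := lifted r (x a).
move=> i j k l ij ik il jk jl kl; apply/eqP => D0.
have : \det (mat4 (L i) (L j) (L k) (L l))^T == 0 by rewrite det_tr det_mat4 D0.
case/det0P => v v0 vE.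
pose be (c : 'I_3) := v ord0 (lift ord0 c).
pose al (b : 'I_t) := v ord0 ord0 *+ (b == a).
pose Z (o : option J) := \sum_c v ord0 c * L o ord0 c == 0.
have zero p : p \in [set i; j; k; l] -> Z p.
  have h (s : 'I_4) : \sum_c v ord0 c * (mat4 (L i) (L j) (L k) (L l)) s c = 0.
    have := congr1 (fun M : 'rV[F]_4 => M ord0 s) vE; rewrite !mxE => E; rewrite -[RHS]E.
    by apply: eq_bigr => c _; rewrite !mxE.
  have row (s : 'I_4) : \sum_c v ord0 c * [:: L i; L j; L k; L l]`_s ord0 c = 0.
    by rewrite -[RHS](h s); apply: eq_bigr => c _; rewrite mxE.
  rewrite !inE -!orbA => /or4P[] /eqP ->; apply/eqP; [exact: row (@Ordinal 4 0 isT)|exact: row (@Ordinal 4 1 isT)|exact: row (@Ordinal 4 2 isT)|exact: row (@Ordinal 4 3 isT)].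
have ZS R : Z (Some R) = (value al be R == 0).
  rewrite /Z big_ord_recl /value sum_delta /=; congr (_ * _ + _ == 0); first by rewrite mxE.
  apply: eq_bigr => c _; congr (_ * _).
  by rewrite -[r R in RHS](tail4_cons (x a R)) [RHS]mxE.
have ZN : Z None = (v ord0 ord0 == 0).
  rewrite /Z big_ord_recl mxE /= mulr1 big1 ?addr0 // => c _.
  by case: c => [[|[|[|c]]] h] //; rewrite mxE /= mulr0.
have nz : (exists b, al b != 0) \/ (exists c, be c != 0).
  case/rV0Pn: v0 => c; case: (unliftP ord0 c) => [c'|] -> vc; [right; exists c'|left; exists a] => //.
  by rewrite /al eqxx.
have := few_val_zeros nz.
have -> : (\sum_b (al b == 0%R) = (v ord0 ord0 == 0%R) + t.-1)%N.
  rewrite (bigD1 a) //= /al eqxx mulr1n; congr (_ + _)%N.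
  rewrite (eq_bigr (fun=> 1%N)) => [|b /negPf ->]; last by rewrite mulr0n eqxx.
  by rewrite sum1_card cardC1 card_ord.
have : (4 <= Z None + \sum_R (value al be R == 0%R))%N.
  have <- : #|[set i; j; k; l]| = 4%N.
    rewrite -!setUA !cardsU1 !inE cards1 !negb_or ij ik il jk jl kl.
    by [].
  rewrite (eq_bigr (fun R => nat_of_bool (Z (Some R)))) => [|R _]; last by rewrite ZS.
  rewrite -(sum_option (fun o => nat_of_bool (Z o))); exact: leq_card_sum.
rewrite ZN; move: t0; move: (v ord0 ord0 == 0) (\sum_R _)%N => b n; clear; case: b => /=; lia.
Qed.

(** The projections from the first t unit vectors, and from all of them but a, are the arcs
    of no_common_charts. *)
Lemma no_long_arc : False.
Proof.
apply: (no_common_charts ch2 q8 q_even q3 q4 cardJ) charts_arc charts_indep _; rewrite card_ord //.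
Qed.
End LongArc.

(** * The theorem *)

(** The first d coordinates determine a word of V, because a nonzero word has fewer than d
    zeros. *)
Lemma systematic_generator (F : finFieldType) d n' (V : {vspace 'rV[F]_(d + n')}) : \dim V = d ->
  (forall x, x \in V -> x != 0%R -> (#|[set i | x ord0 i == 0%R]| < d)%N) ->
  exists G : 'M[F]_(d, n'), forall u, row_mx u (u *m G) \in V.
Proof.
move=> dV few; pose n := (d + n')%N.
pose B : 'M[F]_(d, n) := \matrix_(i, j) (vbasis V)`_i ord0 j.
have uB (u : 'rV_d) : u *m B = \sum_i u ord0 i *: (vbasis V)`_i.
  by rewrite mulmx_sum_row; apply: eq_bigr => i _; congr (_ *: _); apply/rowP => j; rewrite !mxE.
have BV (u : 'rV[F]_d) : u *m B \in V.
  rewrite uB; apply: memv_suml => i _; apply: memvZ; apply: vbasis_mem; apply: mem_nth.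
  by rewrite size_tuple dV.
have Bi (u : 'rV[F]_d) : u *m B = 0 -> u = 0.
  rewrite uB => E; apply/rowP => i; rewrite mxE.
  have /freeP fr := basis_free (vbasisP V).
  rewrite -(cast_ordKV dV i); apply: (fr (fun j => u ord0 (cast_ord dV j))).
  rewrite -[RHS]E (reindex (cast_ord dV)) //=.
  by apply: onW_bij; exact: Bijective (cast_ordK dV) (cast_ordKV dV).
have Lu : lsubmx B \in unitmx.
  rewrite -row_free_unit; apply: inj_row_free => u uL; apply: Bi; apply/eqP; apply: contraTT (isT) => ne.
  have := few _ (BV u) ne; rewrite ltnNge => /negP[].
  rewrite -[X in (X <= _)%N]card_ord -(card_imset _ (@lshift_inj d n')).
  apply/subset_leq_card/subsetP => _ /imsetP[i _ ->]; rewrite inE.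
  have -> : (u *m B) ord0 (lshift n' i) = (u *m lsubmx B) ord0 i.
    by rewrite !mxE; apply: eq_bigr => j _; rewrite [lsubmx B _ _]mxE.
  by rewrite uL mxE.
exists (invmx (lsubmx B) *m rsubmx B) => u.
have -> : row_mx u (u *m (invmx (lsubmx B) *m rsubmx B)) = u *m invmx (lsubmx B) *m B.
  have E w : w *m B = row_mx (w *m lsubmx B) (w *m rsubmx B) by rewrite -mul_mx_row hsubmxK.
  by rewrite E mulmxKV // mulmxA.
exact: BV.
Qed.

Lemma even_field (F : finFieldType) : ~~ odd #|F| ->
  2%N \in [pchar F] /\ exists h, #|F| = (2 ^ h)%N.
Proof.
move=> ev; have [p pp pF] := finPcharP F.
have cF : #|F| = (p ^ logn p #|F|)%N := card_pprimeChar pF.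
have p2 : p = 2%N.
  by case: (even_prime pp) => // op; case/negP: ev; rewrite cF oddX op orbT.
by rewrite p2 in pF cF; split=> //; exists (logn 2 #|F|).
Qed.

(** f is the symbol at a deleted position j0 of the word of C' over a word of V. *)
Lemma extension_symbol (F : finFieldType) t n' m (V : {vspace 'rV[F]_(t + 3 + n')}) (C' : {set 'rV[F]_m})
    (D : {set 'I_m}) (e : #|~: D| = (t + 3 + n')%N) : \dim V = (t + 3)%N ->
  (forall x, x \in V -> x != 0%R -> (#|[set i | x ord0 i == 0%R]| < t + 3)%N) ->
  (t + 3 + n' < m)%N -> {in C' &, forall x y, x != y -> (#|agree x y| < t + 3)%N} ->
  [set x | x \in V] = [set delete e w | w in C'] ->
  exists (g : 'I_n' -> 'cV[F]_(t + 3)) (f : 'rV[F]_(t + 3) -> F), forall u v : 'rV[F]_(t + 3), u != v ->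
   (\sum_i (u ord0 i == v ord0 i) + \sum_k ((u *m g k) ord0 ord0 == (v *m g k) ord0 ord0) + (f u == f v) < t + 3)%N.
Proof.
move=> dV few nm agC' VC.
have [G GV] := systematic_generator dV few.
pose c (u : 'rV[F]_(t + 3)) := row_mx u (u *m G).
have exW u : exists w, w \in C' /\ delete e w = c u.
  have : c u \in [set delete e w | w in C'] by rewrite -VC inE GV.
  by case/imsetP => w wC ->; exists w.
have [W WP] := fin_all_exists exW.
have [j0 j0D] : exists j0, j0 \in D.
  by apply/card_gt0P; have := cardsC D; rewrite card_ord e; move: nm; clear; lia.
exists (fun k => col k G), (fun u => W u ord0 j0) => u v uv.
have [Wu du] := WP u; have [Wv dv] := WP v.
have Wuv : W u != W v.
  apply: contraNneq uv => E; apply/eqP.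
  by have := du; rewrite E dv => /eq_row_mx[].
apply: leq_ltn_trans (agC' _ _ Wu Wv Wuv).
pose p (j : 'I_(t + 3 + n')) : 'I_m := enum_val (cast_ord (esym e) j).
have pi : injective p by move=> a b /enum_val_inj/cast_ord_inj.
have pD j : p j \notin D by have := enum_valP (cast_ord (esym e) j); rewrite inE.
have cp w j : delete e w ord0 j = w ord0 (p j) by rewrite mxE.
pose X := [set p j | j in agree (c u) (c v)].
have cX : #|X| = (\sum_i (u ord0 i == v ord0 i) +
    \sum_k ((u *m col k G) ord0 ord0 == (v *m col k G) ord0 ord0))%N.
  have cG x k : (x *m col k G) ord0 ord0 = (x *m G) ord0 k.
    by rewrite !mxE; apply: eq_bigr => i _; rewrite mxE.
  rewrite card_imset // -sum1_card big_mkcond big_split_ord /=.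
  congr (_ + _)%N; apply: eq_bigr => i _; rewrite inE.
    by rewrite !row_mxEl; case: eqP.
  by rewrite !row_mxEr !cG; case: eqP.
have sX : X \subset agree (W u) (W v).
  by apply/subsetP => _ /imsetP[j jA ->]; move: jA; rewrite !inE -!cp du dv.
have j0X : j0 \notin X by apply/imsetP => -[j _ E]; move: (pD j); rewrite -E j0D.
rewrite -cX; case: eqP => f0; last by rewrite addn0 subset_leq_card.
rewrite addn1; have <- : #|j0 |: X| = #|X|.+1 by rewrite cardsU1 j0X.
by apply: subset_leq_card; rewrite subUset sX sub1set inE f0 eqxx.
Qed.

Local Close Scope ring_scope.
Theorem theorem7p7 (F : finFieldType) (q k : nat) (C : {set 'rV[F]_(q.+1)})
  (hq_even : ~~ odd q) (hqk : (k.+1 < q)%N)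
  (hC : linear_MDS_code k.+1 q C)
  (hk : (k = 3 \/ k = 4) \/ ((5 <= k)%N /\ ((k - 2) ^ 3 <= q)%N)) :
  maximal_MDS_code k.+1 q C.
Proof.
have [mdsC [V [dV CE]]] := hC; have [cF cC agC] := mdsC.
split=> // m C' [nm [_ cC' agC'] [D [e CD]]].
have [ch2 [h qh]] : 2 \in [pchar F]%R /\ exists h, #|F| = (2 ^ h)%N.
  by apply: even_field; rewrite cF.
pose t := (k - 2)%N.
have kt : k.+1 = (t + 3)%N by rewrite /t; move: hk; clear; lia.
have t0 : (0 < t)%N by rewrite /t; move: hk; clear; lia.
have q4 : (4 < #|F|)%N by rewrite cF; move: hk hqk; clear; lia.
have h3 : exists h', h = h'.+3.
  case: h qh => [|[|[|h']]] qh; rewrite qh ?expn1 // in q4; by exists h'.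
have [h' hE] := h3; rewrite hE in qh.
have q8 : (8 <= #|F|)%N by rewrite qh !expnS; have := expn_gt0 2 h'; clear; lia.
have t3 : (t ^ 3 <= #|F|)%N.
  by case: hk => [[k3|k4]|[_]]; rewrite /t ?k3 ?k4 // ?cF // -cF (leq_trans _ q8).
have ev : ~~ odd #|F| by rewrite cF.
have q3 : ~~ (3 %| #|F|) by rewrite qh Euclid_dvdX.
have q4' : 4 %| #|F| by rewrite qh !expnS mulnA dvdn_mulr.
have fewV x : x \in V -> x != 0%R -> #|[set i | x ord0 i == 0%R]| < k.+1.
  move=> xV x0; have := agC x 0%R; rewrite CE !inE => /(_ xV (mem0v V) x0).
  by congr (_ < _); apply: eq_card => i; rewrite !inE mxE.
have [n' nE] : exists n', q.+1 = t + 3 + n'.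
  by exists (q.+1 - (t + 3)); move: kt hqk; clear; lia.
have nF : n' + (t + 3) = #|F|.+1 by rewrite cF nE addnC.
clear mdsC hC agC cC; rewrite CE in CD; clear CE C.
rewrite kt in dV fewV agC'.
move: V e dV fewV CD nm; rewrite nE => V e dV fewV CD nm.
have [g [f sep]] := extension_symbol dV fewV nm agC' CD.
have tq : t * t < #|F|.
  move: t3 q8; rewrite !expnS expn0 !muln1; move: #|F| => n; clear -t0.
  by case: (leqP t 2) => h; nia.
have [|y yP] := @level_linear F t 'I_n' g f t0 tq _ sep; first by rewrite card_ord.
apply: (@no_long_arc F ch2 q8 ev q3 q4' t (option 'I_n') (fun o => if o is Some k then g k else y)) => //.
  by rewrite card_option card_ord addSn nF addn2.
move=> u u0; rewrite sum_option [X in (_ + X)%N]addnC addnA.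
exact: yP.
Qed.
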